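(* For all positive integers $m$ and $p$: $$W(2p+2m-1,2m)=2(-1)^m\sum_{j=0}^{p-1}\bar\zeta(2p-2-2j)\sum_{n=1}^\infty\frac{T_n(\{1\}_{2m-1})T_n(\{1\}_{2j+1})}{n}(-1)^n,$$ $$W(2p+2m-2,2m)=2(-1)^m\sum_{j=0}^{p-2}\bar\zeta(2p-3-2j)\sum_{n=1}^\infty\frac{T_n(\{1\}_{2m-1})T_n(\{1\}_{2j+1})}{n}(-1)^n+(-1)^m\sum_{n=1}^\infty\frac{T_n(\{1\}_{2m-1})S_n(\{1\}_{2p-2})}{n}(-1)^n,$$ $$W(2p+2m-2,2m-1)=4(-1)^{m-1}\sum_{j=0}^{p-1}\bar\zeta(2p-1-2j)\sum_{n=1}^\infty\frac{T_n(\{1\}_{2m-2})T_n(\{1\}_{2j})}{2n-1}(-1)^n+2(-1)^{m-1}\sum_{n=1}^\infty\frac{T_n(\{1\}_{2m-2})S_n(\{1\}_{2p-1})}{2n-1}(-1)^n,$$ $$W(2p+2m-3,2m-1)=4(-1)^{m-1}\sum_{j=0}^{p-1}\bar\zeta(2p-2-2j)\sum_{n=1}^\infty\frac{T_n(\{1\}_{2m-2})T_n(\{1\}_{2j})}{2n-1}(-1)^n.$$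
   Context: $\{1\}_a$ denotes the sequence of $a$ ones. For positive integers $k_1,\dots,k_r$, $\bar T(k_1,\ldots,k_r):=2^r\sum_{0<n_1<\cdots<n_r}\frac{(-1)^{n_r}}{(2n_1-1)^{k_1}(2n_2-2)^{k_2}\cdots(2n_r-r)^{k_r}}$. $I(k,r)$ is the set of tuples $(k_1,\dots,k_r)$ of positive integers with sum $k$, and $W(k,r):=\sum_{(k_1,\dots,k_r)\in I(k,r)}\bar T(k_1,\dots,k_r)$. $\bar\zeta(s):=\sum_{n\ge1}(-1)^{n-1}n^{-s}$ for $s\ge1$, $\bar\zeta(0):=1/2$. Multiple $T$- and $S$-harmonic sums (for $n\ge1$, $a\ge1$), with $T_n(\emptyset)=S_n(\emptyset)=1$: $T_n(\{1\}_{2a-1})=\sum\frac{2^{2a-1}}{(2n_1-1)(2n_2)(2n_3-1)\cdots(2n_{2a-2})(2n_{2a-1}-1)}$ over $0<n_1\le n_2<n_3\le n_4<\cdots\le n_{2a-2}<n_{2a-1}\le n$; $T_n(\{1\}_{2a})=\sum\frac{2^{2a}}{\prod_{i=1}^a(2n_{2i-1}-1)(2n_{2i})}$ over $0<n_1\le n_2<n_3\le\cdots<n_{2a-1}\le n_{2a}<n$; $S_n(\{1\}_{2a-1})=\sum\frac{2^{2a-1}}{(2n_1)(2n_2-1)(2n_3)\cdots(2n_{2a-2}-1)(2n_{2a-1})}$ over $1\le n_1<n_2\le n_3<\cdots<n_{2a-2}\le n_{2a-1}<n$; $S_n(\{1\}_{2a})=\sum\frac{2^{2a}}{\prod_{i=1}^a(2n_{2i-1})(2n_{2i}-1)}$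 over $1\le n_1<n_2\le n_3<\cdots\le n_{2a-1}<n_{2a}\le n$ (empty sums are $0$). *)

(* Defs.v *)
From Stdlib Require Import Reals List Arith.
From Coquelicot Require Import Coquelicot.
Open Scope R_scope.

Definition fsum (n : nat) (f : nat -> R) : R :=
  fold_right Rplus 0 (map f (seq 0 n)).

Definition isum (lo hi : nat) (f : nat -> R) : R :=
  fold_right Rplus 0 (map f (seq lo (S hi - lo))).

Fixpoint comps (k r : nat) : list (list nat) :=
  match r with
  | O => match k with O => nil :: nil | S _ => nil end
  | S r' => flat_map (fun a => map (cons a) (comps (k - a) r')) (seq 1 k)
  end.

(* Tinner ks j N = sum over 0 < n_1 < ... < n_j < N of
   prod_{i=1}^{j} 1/(2 n_i - i)^{k_i}, with k_i = nth (i-1) ks 0 *)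
Fixpoint Tinner (ks : list nat) (j N : nat) : R :=
  match j with
  | O => 1
  | S j' => isum 1 (N - 1) (fun m =>
      Tinner ks j' m / (2 * INR m - INR (S j')) ^ (nth j' ks 0%nat))
  end.

Definition Tbar_term (ks : list nat) (n : nat) : R :=
  let r := length ks in
  2 ^ r * (-1) ^ n * Tinner ks (r - 1) n
    / (2 * INR n - INR r) ^ (nth (r - 1) ks 0%nat).

Definition Tbar (ks : list nat) : R := Series (fun n => Tbar_term ks (S n)).

Definition W (k r : nat) : R := fold_right Rplus 0 (map Tbar (comps k r)).

Definition W_conv (k r : nat) : Prop :=
  List.Forall (fun ks => ex_series (fun n => Tbar_term ks (S n))) (comps k r).

Definition zbar (s : nat) : R :=
  match s with
  | O => / 2
  | S _ => Series (fun n => (-1) ^ n / (INR (S n)) ^ s)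
  end.

Fixpoint Tn (n a : nat) : R :=
  match a with
  | O => 1
  | S a' => if Nat.even a'
            then isum 1 n (fun i => 2 / (2 * INR i - 1) * Tn i a')
            else isum 1 (n - 1) (fun i => 2 / (2 * INR i) * Tn i a')
  end.

Fixpoint Sn (n a : nat) : R :=
  match a with
  | O => 1
  | S a' => if Nat.even a'
            then isum 1 (n - 1) (fun i => 2 / (2 * INR i) * Sn i a')
            else isum 1 n (fun i => 2 / (2 * INR i - 1) * Sn i a')
  end.

Definition TT_even (a b n : nat) : R := Tn n a * Tn n b / INR n * (-1) ^ n.
Definition TS_even (a b n : nat) : R := Tn n a * Sn n b / INR n * (-1) ^ n.
Definition TT_odd (a b n : nat) : R :=
  Tn n a * Tn n b / (2 * INR n - 1) * (-1) ^ n.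
Definition TS_odd (a b n : nat) : R :=
  Tn n a * Sn n b / (2 * INR n - 1) * (-1) ^ n.

(* Main.v *)
Require Import Defs.
From Stdlib Require Import Reals List Arith Lra Lia.
From Coquelicot Require Import Coquelicot.
Open Scope R_scope.

(** Put [t = exp (-x)], [u = (1 - t) / (1 + t)] and [y = 2 atan u] for [x >= 0], so that
    [y' = 2 t / (1 + t^2)] and [x = 2 artanh u].  Up to sign, [W (k + r) r] and the
    right-hand sides both equal the integral over [0 < x < oo] of
    [y^(r-1) / (r-1)! * x^k / k! * y'].

    On the left, [Phi_(i,k)], the alternating sum of [t^(2n-i)] with the coefficients obtained
    by summing over compositions, satisfies
    [Phi_(i,k)' = - Phi_(i,k-1) + y' Phi_(i-1,k)]; hence the derivative of
    [sum_(i < r, j <= k) (-1)^i (y^i / i!) (x^j / j!) Phi_(r-i,k-j)] is the integrand up to sign,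
    while its value at [x = 0] is [W (k + r) r].  On the right, the coefficients of [y^r / r!]
    as a power series in [u] are the sums [T_n({1}_(r-1))], and the moments of
    [(2 artanh u)^k / k!] against [u^(2n-1)] and [u^(2n-2)] obey, by parts, a two-term
    recursion solved by [T_n], [S_n] and the alternating zeta values.

    Everything is carried out with partial sums of length [N] and on [0 <= x <= X]: the two
    truncation errors have explicitly dominated derivatives, [X] tends to infinity first, and
    the remaining error is a power of [log N] divided by [N]. *)

(* Coquelicot equations live in the carrier of a canonical structure, where [ring] fails. *)
Ltac eqR := match goal with |- @eq _ ?a ?b => change (@eq R a b) end.

(** * Finite sums *)

(** The obstacle is conditional convergence: the terms on both sides are of size a power of log n
    over n, so no absolute bound allows sums and integrals to be exchanged. Moreover the two
    expansions degenerate at opposite ends, the one in exp(-2x) at x = 0, where [W] is read off, and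
    the one in u as x tends to infinity, where u tends to 1. With finite sums every identity is
    exact up to a boundary term at [N]. Multiplication by 1 + w, with w = exp(-2x) or w = u^2, is an
    Abel summation: it turns partial sums with sign (-1)^n into differences and leaves a remainder
    of size w^N up to logarithms; integrating this remainder over the half-line gains the factor
    1/N. The sum over compositions is one coefficient of a product of factors 1/(l - x), so the only
    exponent that survives is k, the weight minus the depth, and a single linear recursion replaces
    the whole family of [Tbar]. The double sum of divided powers of x and y is a repeated
    integration by parts: the powers of x remove the first term of the derivative of [Phi], the
    powers of y the second. *)

Definition lsum {A : Type} (f : A -> R) (l : list A) : R :=
  fold_right Rplus 0 (map f l).

Lemma lsum_nil {A : Type} (f : A -> R) : lsum f nil = 0.
Proof. reflexivity. Qed.

Lemma lsum_cons {A : Type} (f : A -> R) (a : A) (l : list A) :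
  lsum f (a :: l) = f a + lsum f l.
Proof. reflexivity. Qed.

Lemma lsum_app {A : Type} (f : A -> R) (l1 l2 : list A) :
  lsum f (l1 ++ l2) = lsum f l1 + lsum f l2.
Proof.
  induction l1 as [|a l1 IH]; simpl app.
  - rewrite lsum_nil; ring.
  - rewrite !lsum_cons, IH; ring.
Qed.

Lemma lsum_ext {A : Type} (f g : A -> R) (l : list A) :
  (forall a, In a l -> f a = g a) -> lsum f l = lsum g l.
Proof.
  induction l as [|a l IH]; intros H; [reflexivity|].
  rewrite !lsum_cons, (H a), IH; auto; intros; [apply H|]; simpl; auto.
Qed.

Lemma lsum_zero {A : Type} (f : A -> R) (l : list A) :
  (forall a, In a l -> f a = 0) -> lsum f l = 0.
Proof.
  induction l as [|a l IH]; intros H; [reflexivity|].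
  rewrite lsum_cons, (H a), IH; [ring| |]; intros; [apply H|]; simpl; auto.
Qed.

Lemma lsum_plus {A : Type} (f g : A -> R) (l : list A) :
  lsum (fun a => f a + g a) l = lsum f l + lsum g l.
Proof.
  induction l as [|a l IH]; [rewrite !lsum_nil; ring|].
  rewrite !lsum_cons, IH; ring.
Qed.

Lemma lsum_scal {A : Type} (c : R) (f : A -> R) (l : list A) :
  lsum (fun a => c * f a) l = c * lsum f l.
Proof.
  induction l as [|a l IH]; [rewrite !lsum_nil; ring|].
  rewrite !lsum_cons, IH; ring.
Qed.

Lemma lsum_map {A B : Type} (h : A -> B) (f : B -> R) (l : list A) :
  lsum f (map h l) = lsum (fun a => f (h a)) l.
Proof. unfold lsum; now rewrite map_map. Qed.

Lemma lsum_flat_map {A B : Type} (h : A -> list B) (f : B -> R) (l : list A) :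
  lsum f (flat_map h l) = lsum (fun a => lsum f (h a)) l.
Proof.
  induction l as [|a l IH]; [reflexivity|].
  simpl flat_map; now rewrite lsum_app, lsum_cons, IH.
Qed.

Lemma lsum_swap {A B : Type} (f : A -> B -> R) (l : list A) (l' : list B) :
  lsum (fun a => lsum (f a) l') l = lsum (fun b => lsum (fun a => f a b) l) l'.
Proof.
  induction l as [|a l IH].
  - rewrite lsum_nil; symmetry; now apply lsum_zero.
  - rewrite lsum_cons, IH, <- lsum_plus. now apply lsum_ext.
Qed.

Lemma lsum_le {A : Type} (f g : A -> R) (l : list A) :
  (forall a, In a l -> f a <= g a) -> lsum f l <= lsum g l.
Proof.
  induction l as [|a l IH]; intros H; [apply Rle_refl|].
  rewrite !lsum_cons; apply Rplus_le_compat; [|apply IH; intros]; apply H;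
    simpl; auto.
Qed.

Lemma lsum_Rabs {A : Type} (f : A -> R) (l : list A) :
  Rabs (lsum f l) <= lsum (fun a => Rabs (f a)) l.
Proof.
  induction l as [|a l IH]; [rewrite !lsum_nil, Rabs_R0; lra|].
  rewrite !lsum_cons; eapply Rle_trans; [apply Rabs_triang|lra].
Qed.

Lemma lsum_seq_S (f : nat -> R) (a n : nat) :
  lsum f (seq a (S n)) = lsum f (seq a n) + f (a + n)%nat.
Proof. rewrite seq_S, lsum_app, lsum_cons, lsum_nil; ring. Qed.

Lemma lsum_seq_Sl (f : nat -> R) (a n : nat) :
  lsum f (seq a (S n)) = f a + lsum (fun i => f (S i)) (seq a n).
Proof. simpl seq; rewrite lsum_cons, <- seq_shift, lsum_map; reflexivity. Qed.

Lemma fsumE (n : nat) (f : nat -> R) : fsum n f = lsum f (seq 0 n).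
Proof. reflexivity. Qed.

Lemma isum1E (n : nat) (f : nat -> R) : isum 1 n f = lsum f (seq 1 n).
Proof. unfold isum; now replace (S n - 1)%nat with n by lia. Qed.

Lemma isum1_0 (f : nat -> R) : isum 1 0 f = 0.
Proof. reflexivity. Qed.

Lemma isum1_S (n : nat) (f : nat -> R) :
  isum 1 (S n) f = isum 1 n f + f (S n).
Proof. rewrite !isum1E, lsum_seq_S; reflexivity. Qed.

Lemma sum_n_isum1 (f : nat -> R) (n : nat) :
  sum_n (fun k => f (S k)) n = isum 1 (S n) f.
Proof.
  induction n as [|n IH].
  - rewrite sum_O, isum1_S, isum1_0; eqR; ring.
  - rewrite sum_Sn, IH, (isum1_S (S n)); reflexivity.
Qed.

Lemma is_derive_lsum {A : Type} (f : A -> R -> R) (f' : A -> R) (x : R)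
    (l : list A) :
  (forall a, In a l -> is_derive (f a) x (f' a)) ->
  is_derive (fun y => lsum (fun a => f a y) l) x (lsum f' l).
Proof.
  induction l as [|a l IH]; intros H.
  - apply (is_derive_const (V := R_NormedModule) 0).
  - apply (is_derive_plus (V := R_NormedModule) (f a)
             (fun y => lsum (fun a => f a y) l)); [|apply IH; intros];
      apply H; simpl; auto.
Qed.

Lemma is_lim_seq_lsum {A : Type} (u : A -> nat -> R) (v : A -> R) (l : list A) :
  (forall a, In a l -> is_lim_seq (u a) (v a)) ->
  is_lim_seq (fun n => lsum (fun a => u a n) l) (lsum v l).
Proof.
  induction l as [|a l IH]; intros H.
  - apply is_lim_seq_const.
  - apply (is_lim_seq_plus' (u a) (fun n => lsum (fun a => u a n) l));
      [|apply IH; intros]; apply H; simpl; auto.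
Qed.

Lemma is_series_lsum {A : Type} (u : A -> nat -> R) (l : list A) :
  (forall a, In a l -> ex_series (u a)) ->
  is_series (fun n => lsum (fun a => u a n) l) (lsum (fun a => Series (u a)) l).
Proof.
  induction l as [|a l IH]; intros H.
  - change (is_lim_seq (sum_n (fun n => lsum (fun a => u a n) nil)) 0).
    apply (is_lim_seq_ext (fun _ => 0)).
    + intros n; symmetry. unfold lsum; simpl.
      induction n as [|n IHn]; [now rewrite sum_O|].
      rewrite sum_Sn, IHn; unfold plus; simpl; eqR; ring.
    + apply is_lim_seq_const.
  - apply (is_series_plus (V := R_NormedModule) (u a)
             (fun n => lsum (fun a => u a n) l)).
    + apply Series_correct, H; simpl; auto.
    + apply IH; intros; apply H; simpl; auto.
Qed.

(** * Polylogarithmic growth *)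

(** This harmonic number stands in for log n: its increment is exactly 1/n, so sums of logarithmic
    size are handled without integrals. The added 1 keeps it at least 1, which makes its powers
    monotone in the exponent. *)
Definition lam (n : nat) : R := 1 + isum 1 n (fun i => / INR i).

Lemma lam_S (n : nat) : lam (S n) = lam n + / INR (S n).
Proof. unfold lam; rewrite isum1_S; ring. Qed.

Lemma lam_ge1 (n : nat) : 1 <= lam n.
Proof.
  induction n as [|n IH]; [unfold lam; rewrite isum1_0; lra|].
  rewrite lam_S. assert (0 < / INR (S n)) by (apply Rinv_0_lt_compat, lt_0_INR; lia).
  lra.
Qed.

Lemma lam_le_S (n : nat) : lam n <= lam (S n).
Proof.
  rewrite lam_S. assert (0 < / INR (S n)) by (apply Rinv_0_lt_compat, lt_0_INR; lia).
  lra.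
Qed.

Lemma lam_S_le (n : nat) : lam (S n) <= 2 * lam n.
Proof.
  rewrite lam_S. assert (H := lam_ge1 n).
  assert (/ INR (S n) <= 1).
  { rewrite <- Rinv_1. apply Rinv_le_contravar; [lra|].
    rewrite S_INR; assert (H1 := pos_INR n); lra. }
  lra.
Qed.

Lemma pow_lam_ge1 (n c : nat) : 1 <= lam n ^ c.
Proof. apply pow_R1_Rle, lam_ge1. Qed.

Lemma pow_lam_mono (n c d : nat) : (c <= d)%nat -> lam n ^ c <= lam n ^ d.
Proof. intros; apply Rle_pow; [apply lam_ge1|assumption]. Qed.

Definition polylog (U : nat -> R) : Prop :=
  exists (C : R) (c : nat), 0 <= C /\ forall n, Rabs (U n) <= C * lam n ^ c.

Lemma polylog_ext (U V : nat -> R) : (forall n, U n = V n) -> polylog U -> polylog V.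
Proof. intros E (C & c & HC & H); exists C, c; split; auto; intros; rewrite <- E; auto. Qed.

Lemma polylog_le (U V : nat -> R) :
  (forall n, Rabs (V n) <= Rabs (U n)) -> polylog U -> polylog V.
Proof.
  intros E (C & c & HC & H); exists C, c; split; auto; intros.
  eapply Rle_trans; [apply E|apply H].
Qed.

Lemma polylog_const (a : R) : polylog (fun _ => a).
Proof. exists (Rabs a), 0%nat; split; [apply Rabs_pos|]; intros; simpl; lra. Qed.

Lemma polylog_plus (U V : nat -> R) : polylog U -> polylog V -> polylog (fun n => U n + V n).
Proof.
  intros (C & c & HC & H) (D & d & HD & K); exists (C + D), (c + d)%nat.
  split; [lra|]; intros n. specialize (H n); specialize (K n).
  assert (H1 := pow_lam_mono n c (c + d) ltac:(lia)).
  assert (H2 := pow_lam_mono n d (c + d) ltac:(lia)).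
  eapply Rle_trans; [apply Rabs_triang|]. nra.
Qed.

Lemma polylog_mult (U V : nat -> R) : polylog U -> polylog V -> polylog (fun n => U n * V n).
Proof.
  intros (C & c & HC & H) (D & d & HD & K); exists (C * D), (c + d)%nat.
  split; [nra|]; intros n. rewrite Rabs_mult, pow_add.
  replace (C * D * (lam n ^ c * lam n ^ d)) with ((C * lam n ^ c) * (D * lam n ^ d)) by ring.
  apply Rmult_le_compat; auto; apply Rabs_pos.
Qed.

Lemma polylog_scal (a : R) (U : nat -> R) : polylog U -> polylog (fun n => a * U n).
Proof. intros; apply polylog_mult; [apply polylog_const|assumption]. Qed.

Lemma polylog_shift (U : nat -> R) : polylog U -> polylog (fun n => U (S n)).
Proof.
  intros (C & c & HC & H); exists (C * 2 ^ c), c.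
  split; [apply Rmult_le_pos; [lra|apply pow_le; lra]|]; intros n.
  eapply Rle_trans; [apply H|]. rewrite Rmult_assoc, <- Rpow_mult_distr.
  apply Rmult_le_compat_l; auto. apply pow_incr.
  split; [generalize (lam_ge1 (S n)); lra|apply lam_S_le].
Qed.

Lemma polylog_lsum {A : Type} (U : A -> nat -> R) (l : list A) :
  (forall a, In a l -> polylog (U a)) -> polylog (fun n => lsum (fun a => U a n) l).
Proof.
  induction l as [|a l IH]; intros H; [apply (polylog_const 0)|].
  apply (polylog_plus (U a)); [|apply IH; intros]; apply H; simpl; auto.
Qed.

(** Finitely many values are absorbed one at a time into the constant, so values at small indices,
    where a denominator may vanish, do no harm. *)
Lemma polylog_eventually (U : nat -> R) (C : R) (N : nat) :
  (forall n, (N <= n)%nat -> Rabs (U n) <= C) -> polylog U.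
Proof.
  revert C; induction N as [|N IH]; intros C H.
  - exists C, 0%nat; split.
    + eapply Rle_trans; [apply Rabs_pos|apply (H 0%nat); lia].
    + intros n; simpl; rewrite Rmult_1_r; apply H; lia.
  - apply (IH (Rmax C (Rabs (U N)))); intros n Hn.
    destruct (Nat.eq_dec n N) as [->|]; [apply Rmax_r|].
    eapply Rle_trans; [apply H; lia|apply Rmax_l].
Qed.

Lemma polylog_isum (f : nat -> R) :
  polylog (fun n => INR n * f n) -> polylog (fun n => isum 1 n f).
Proof.
  intros (C & c & HC & H); exists C, (S c); split; auto; intros n.
  (* The factor [lam n - 1] is the harmonic number itself: it is 0 at the empty sum and grows by the
     very 1/n that bounds the new term. *)
  assert (K : Rabs (isum 1 n f) <= C * lam n ^ c * (lam n - 1)).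
  { induction n as [|n IH].
    - rewrite isum1_0, Rabs_R0. unfold lam; rewrite isum1_0; simpl; nra.
    - rewrite isum1_S. eapply Rle_trans; [apply Rabs_triang|].
      assert (Hn : 0 < INR (S n)) by (apply lt_0_INR; lia).
      assert (F : Rabs (f (S n)) <= C * lam (S n) ^ c * / INR (S n)).
      { apply (Rmult_le_reg_l (INR (S n))); auto.
        replace (INR (S n) * (C * lam (S n) ^ c * / INR (S n)))
          with (C * lam (S n) ^ c) by (field; lra).
        rewrite <- (Rabs_right (INR (S n))) at 1 by lra.
        rewrite <- Rabs_mult; apply H. }
      assert (M : C * lam n ^ c * (lam n - 1) <= C * lam (S n) ^ c * (lam n - 1)).
      { apply Rmult_le_compat_r; [generalize (lam_ge1 n); lra|].
        apply Rmult_le_compat_l; auto. apply pow_incr; split;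
          [generalize (lam_ge1 n); lra|apply lam_le_S]. }
      rewrite (lam_S n) at 2. lra. }
  eapply Rle_trans; [apply K|]. simpl pow.
  assert (P : 0 <= C * lam n ^ c).
  { apply Rmult_le_pos; auto. generalize (pow_lam_ge1 n c); lra. }
  nra.
Qed.

(** Each induction step spends half of the rate [d] on one factor z, through z <= (2/d) exp(dz/2),
    and keeps the other half for the remaining power. *)
Lemma pow_le_exp (c : nat) : forall d, 0 < d ->
  exists C, 0 <= C /\ forall z, 0 <= z -> z ^ c <= C * exp (d * z).
Proof.
  induction c as [|c IH]; intros d Hd.
  - exists 1; split; [lra|]; intros z Hz; simpl.
    generalize (exp_ineq1_le (d * z)); nra.
  - destruct (IH (d / 2)) as (C & HC & H); [lra|].
    exists (2 / d * C); split.
    { apply Rmult_le_pos; auto. apply Rlt_le, Rdiv_lt_0_compat; lra. }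
    intros z Hz; simpl pow.
    replace (2 / d * C * exp (d * z))
      with ((2 / d * exp (d / 2 * z)) * (C * exp (d / 2 * z))).
    2:{ replace (d * z) with (d / 2 * z + d / 2 * z) by field.
        rewrite exp_plus; ring. }
    apply Rmult_le_compat; auto; [now apply pow_le|].
    apply (Rmult_le_reg_l (d / 2)); [lra|].
    replace (d / 2 * (2 / d * exp (d / 2 * z))) with (exp (d / 2 * z)) by (field; lra).
    generalize (exp_ineq1_le (d / 2 * z)); nra.
Qed.

Lemma exp_lam_le (n : nat) : exp (lam (S n)) <= exp 2 * INR (S n).
Proof.
  induction n as [|n IH].
  - unfold lam; rewrite isum1_S, isum1_0. simpl INR.
    replace (1 + (0 + / 1)) with 2 by field. lra.
  - rewrite lam_S, exp_plus.
    set (m := INR (S n)) in *. assert (Hm : 0 < m) by (apply lt_0_INR; lia).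
    replace (INR (S (S n))) with (m + 1) by (unfold m; rewrite (S_INR (S n)); ring).
    assert (E : exp (/ (m + 1)) <= (m + 1) / m).
    { assert (K := exp_ineq1_le (- / (m + 1))).
      rewrite exp_Ropp in K.
      assert (Q : 1 + - / (m + 1) = m / (m + 1)) by (field; lra).
      rewrite Q in K.
      replace ((m + 1) / m) with (/ (m / (m + 1))) by (field; lra).
      rewrite <- (Rinv_inv (exp _)).
      apply Rinv_le_contravar; auto. apply Rdiv_lt_0_compat; lra. }
    replace (exp 2 * (m + 1)) with (exp 2 * m * ((m + 1) / m)) by (field; lra).
    apply Rmult_le_compat; auto; apply Rlt_le, exp_pos.
Qed.

(** The square root is a convenient majorant of all powers of log n: divided by n it tends to 0, and
    divided by n^2 it is summable. *)
Lemma pow_lam_le_sqrt (c : nat) : exists C, 0 <= C /\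
  forall n, lam (S n) ^ c <= C * sqrt (INR (S n)).
Proof.
  destruct (pow_le_exp c (/ 2)) as (C & HC & H); [lra|].
  exists (C * sqrt (exp 2)); split; [apply Rmult_le_pos; auto; apply sqrt_pos|].
  intros n. eapply Rle_trans; [apply H; generalize (lam_ge1 (S n)); lra|].
  rewrite Rmult_assoc; apply Rmult_le_compat_l; auto.
  rewrite <- sqrt_mult by (try apply pos_INR; apply Rlt_le, exp_pos).
  replace (exp (/ 2 * lam (S n))) with (sqrt (exp (lam (S n)))).
  { apply sqrt_le_1; [apply Rlt_le, exp_pos| |apply exp_lam_le].
    apply Rmult_le_pos; [apply Rlt_le, exp_pos|apply pos_INR]. }
  replace (lam (S n)) with (/ 2 * lam (S n) + / 2 * lam (S n)) at 1 by field.
  rewrite exp_plus. apply sqrt_square, Rlt_le, exp_pos.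
Qed.

Lemma polylog_le_sqrt (U : nat -> R) : polylog U ->
  exists C, 0 <= C /\ forall n, Rabs (U (S n)) <= C * sqrt (INR (S n)).
Proof.
  intros (C & c & HC & H). destruct (pow_lam_le_sqrt c) as (D & HD & K).
  exists (C * D); split; [nra|]; intros n.
  eapply Rle_trans; [apply H|]. rewrite Rmult_assoc. now apply Rmult_le_compat_l.
Qed.

Lemma is_lim_seq_inv_sqrt : is_lim_seq (fun n => / sqrt (INR (S n))) 0.
Proof.
  replace (Finite 0) with (Rbar_inv p_infty) by reflexivity.
  apply is_lim_seq_inv; [|discriminate].
  apply (is_lim_seq_incr_1 (fun n => sqrt (INR n))).
  apply (filterlim_comp _ _ _ INR sqrt eventually (Rbar_locally p_infty));
    [apply is_lim_seq_INR|apply filterlim_sqrt_p].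
Qed.

Lemma polylog_lim0 (U : nat -> R) : polylog (fun n => INR n * U n) ->
  is_lim_seq (fun n => U (S n)) 0.
Proof.
  intros H; apply polylog_le_sqrt in H; destruct H as (C & HC & H).
  apply is_lim_seq_abs_0.
  apply (is_lim_seq_le_le (fun _ => 0) _ (fun n => C * / sqrt (INR (S n)))).
  - intros n; split; [apply Rabs_pos|].
    assert (P : 0 < INR (S n)) by (apply lt_0_INR; lia).
    assert (Q := sqrt_lt_R0 _ P).
    apply (Rmult_le_reg_l (INR (S n))); auto.
    rewrite <- (Rabs_right (INR (S n))) at 1 by lra.
    rewrite <- Rabs_mult. eapply Rle_trans; [apply H|].
    rewrite <- (sqrt_sqrt (INR (S n))) at 2 by lra. right; field; lra.
  - apply is_lim_seq_const.
  - replace (Finite 0) with (Rbar_mult C 0) by (simpl; f_equal; ring).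
    apply is_lim_seq_scal_l, is_lim_seq_inv_sqrt.
Qed.

Lemma ex_series_sqrt : ex_series (fun n => / (INR (S n) * sqrt (INR (S n)))).
Proof.
  (* telescoping: [1/sqrt n - 1/sqrt (n+1) >= 1/(2 (n+1)^(3/2))] *)
  assert (T : ex_series (fun n => 2 * (/ sqrt (INR (S n)) - / sqrt (INR (S (S n)))))).
  { apply (ex_series_scal_l 2 (fun n => / sqrt (INR (S n)) - / sqrt (INR (S (S n))))).
    exists (1 - 0).
    change (is_lim_seq (sum_n (fun n => / sqrt (INR (S n)) - / sqrt (INR (S (S n))))) (1 - 0)).
    apply (is_lim_seq_ext (fun n => 1 - / sqrt (INR (S (S n))))).
    - intros n; induction n as [|n IH].
      + rewrite sum_O. simpl (INR 1). rewrite sqrt_1, Rinv_1. reflexivity.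
      + rewrite sum_Sn, <- IH. change (plus ?a ?b) with (Rplus a b); eqR; ring.
    - apply is_lim_seq_minus'; [apply is_lim_seq_const|].
      apply (is_lim_seq_incr_1 (fun n => / sqrt (INR (S n)))), is_lim_seq_inv_sqrt. }
  apply (ex_series_incr_1 (fun n => / (INR (S n) * sqrt (INR (S n))))).
  eapply (ex_series_le (K := R_AbsRing) (V := R_CompleteNormedModule)); [|exact T].
  intros n; unfold norm; simpl norm. change (abs ?x) with (Rabs x).
  set (x := INR (S n)). replace (INR (S (S n))) with (x + 1)
    by (unfold x; rewrite (S_INR (S n)); ring).
  assert (Hx : 0 < x) by (apply lt_0_INR; lia).
  assert (Hx1 : 0 < x + 1) by lra.
  assert (P := sqrt_lt_R0 _ Hx). assert (Q := sqrt_lt_R0 _ Hx1).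
  set (a := sqrt x) in *. set (b := sqrt (x + 1)) in *.
  assert (Ea : a * a = x) by (apply sqrt_sqrt; lra).
  assert (Eb : b * b = x + 1) by (apply sqrt_sqrt; lra).
  assert (Hab : a <= b) by (apply sqrt_le_1; lra).
  rewrite <- Eb.
  rewrite Rabs_right by (apply Rle_ge, Rlt_le, Rinv_0_lt_compat; nra).
  replace (/ a - / b) with ((b - a) / (a * b)) by (field; lra).
  replace (b - a) with (/ (a + b)).
  2:{ apply (Rmult_eq_reg_l (a + b)); [|lra]. rewrite Rinv_r by lra. nra. }
  replace (2 * (/ (a + b) / (a * b))) with (/ ((a + b) * (a * b) / 2)) by (field; lra).
  apply Rinv_le_contravar.
  - apply Rdiv_lt_0_compat; [|lra]. apply Rmult_lt_0_compat; nra.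
  - assert (b * a <= b * b) by nra. assert (0 < a * b) by nra. nra.
Qed.

Lemma polylog_ex_series (U : nat -> R) : polylog (fun n => INR n ^ 2 * U n) ->
  ex_series (fun n => U (S n)).
Proof.
  intros H; apply polylog_le_sqrt in H; destruct H as (C & HC & H).
  apply (ex_series_le (K := R_AbsRing) (V := R_CompleteNormedModule) _
           (fun n => C * / (INR (S n) * sqrt (INR (S n))))).
  2:{ apply (ex_series_scal_l (K := R_AbsRing) C
             (fun n => / (INR (S n) * sqrt (INR (S n))))), ex_series_sqrt. }
  intros n; unfold norm; simpl norm. change (abs ?x) with (Rabs x).
  assert (P : 0 < INR (S n)) by (apply lt_0_INR; lia).
  assert (Q := sqrt_lt_R0 _ P).
  apply (Rmult_le_reg_l (INR (S n) ^ 2)); [apply pow_lt; auto|].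
  rewrite <- (Rabs_right (INR (S n) ^ 2)) at 1 by (apply Rle_ge, Rlt_le, pow_lt; auto).
  rewrite <- Rabs_mult. eapply Rle_trans; [apply H|].
  right. rewrite <- (sqrt_sqrt (INR (S n))) at 2 3 by lra. field; lra.
Qed.

(** * Slowly varying sequences and convergence of alternating series *)

Definition Slow (U : nat -> R) : Prop :=
  polylog U /\ polylog (fun n => INR n * (U (S n) - U n)).

(** [Slow] and [Slow1] are discrete symbol classes of order 0 and -1 up to logarithms: a difference
    gains one factor 1/n. They are stable under products, and order -1 suffices for an alternating
    series to converge. *)
Definition Slow1 (A : nat -> R) : Prop :=
  polylog (fun n => INR n * A n) /\ polylog (fun n => INR n ^ 2 * (A (S n) - A n)).

Lemma Slow_const (a : R) : Slow (fun _ => a).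
Proof.
  split; [apply polylog_const|]. apply (polylog_ext (fun _ => 0)); [intros; ring|apply polylog_const].
Qed.

Lemma Slow_mult (U V : nat -> R) : Slow U -> Slow V -> Slow (fun n => U n * V n).
Proof.
  intros [U0 U1] [V0 V1]; split; [now apply polylog_mult|].
  apply (polylog_ext (fun n => (INR n * (U (S n) - U n)) * V (S n)
                          + U n * (INR n * (V (S n) - V n)))); [intros; ring|].
  apply polylog_plus; apply polylog_mult; auto. now apply polylog_shift.
Qed.

Lemma Slow1_mult (U A : nat -> R) : Slow U -> Slow1 A -> Slow1 (fun n => U n * A n).
Proof.
  intros [U0 U1] [A0 A1]; split.
  { apply (polylog_ext (fun n => U n * (INR n * A n))); [intros; ring|now apply polylog_mult]. }
  (* Leibniz rule for differences, with the two factors [INR n] shared out;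
     [INR (S n) * A (S n) - A (S n)] is [INR n * A (S n)]. *)
  apply (polylog_ext (fun n => (INR n * (U (S n) - U n)) *
      (INR (S n) * A (S n) - A (S n)) + U n * (INR n ^ 2 * (A (S n) - A n)))).
  { intros; rewrite S_INR; ring. }
  apply polylog_plus; apply polylog_mult; auto.
  apply (polylog_le (fun n => INR (S n) * A (S n))); [|now apply (polylog_shift (fun n => INR n * A n))].
  intros n. replace (INR (S n) * A (S n) - A (S n)) with (INR n * A (S n))
    by (rewrite S_INR; ring).
  rewrite !Rabs_mult. apply Rmult_le_compat_r; [apply Rabs_pos|].
  rewrite !Rabs_right by (apply Rle_ge, pos_INR). apply le_INR; lia.
Qed.

(** The factor [INR 0] hides [A 0], which is why its modulus is added to the constant. *)
Lemma polylog_div_INR (A : nat -> R) : polylog (fun n => INR n * A n) -> polylog A.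
Proof.
  intros H. destruct H as (C & c & HC & H).
  exists (C + Rabs (A 0%nat)), c; split.
  { generalize (Rabs_pos (A 0%nat)); lra. }
  intros [|n].
  - generalize (pow_lam_ge1 0 c) (Rabs_pos (A 0%nat)); nra.
  - specialize (H (S n)). rewrite Rabs_mult, Rabs_right in H by (apply Rle_ge, pos_INR).
    rewrite S_INR in H. generalize (pow_lam_ge1 (S n) c) (Rabs_pos (A 0%nat))
      (pos_INR n) (Rabs_pos (A (S n))); nra.
Qed.

Lemma Slow1_Slow (A : nat -> R) : Slow1 A -> Slow A.
Proof.
  intros [A0 A1]; split; [now apply polylog_div_INR|]. apply polylog_div_INR.
  eapply polylog_ext; [|exact A1]. intros; simpl; ring.
Qed.

Lemma Slow_pow (A : nat -> R) (k : nat) : Slow A -> Slow (fun n => A n ^ k).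
Proof.
  intros H; induction k as [|k IH]; [apply (Slow_const 1)|].
  now apply (Slow_mult A (fun n => A n ^ k)).
Qed.

Lemma Slow_isum (f : nat -> R) :
  polylog (fun n => INR n * f n) -> Slow (fun n => isum 1 n f).
Proof.
  intros H; split; [now apply polylog_isum|].
  apply (polylog_le (fun n => INR (S n) * f (S n))); [|now apply (polylog_shift (fun n => INR n * f n))].
  intros n. rewrite isum1_S. replace (isum 1 n f + f (S n) - isum 1 n f) with (f (S n)) by ring.
  rewrite !Rabs_mult. apply Rmult_le_compat_r; [apply Rabs_pos|].
  rewrite !Rabs_right by (apply Rle_ge, pos_INR). apply le_INR; lia.
Qed.

Lemma isum_pred_S (n : nat) (f : nat -> R) :
  (1 <= n)%nat -> isum 1 (S n - 1) f = isum 1 (n - 1) f + f n.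
Proof.
  intros H. replace (S n - 1)%nat with (S (n - 1)) by lia.
  rewrite isum1_S. now replace (S (n - 1)) with n by lia.
Qed.

Lemma Slow_isum_pred (f : nat -> R) :
  polylog (fun n => INR n * f n) -> Slow (fun n => isum 1 (n - 1) f).
Proof.
  intros H; split.
  - apply (polylog_le (fun n => Rabs (isum 1 n f) + Rabs (f n))).
    + intros [|n]; [simpl; rewrite isum1_0, !Rabs_R0; apply Rabs_pos|].
      rewrite (Rabs_right (_ + _))
        by (apply Rle_ge, Rplus_le_le_0_compat; apply Rabs_pos).
      rewrite isum1_S. replace (S n - 1)%nat with n by lia.
      replace (isum 1 n f) with ((isum 1 n f + f (S n)) + - f (S n)) at 1 by ring.
      eapply Rle_trans; [apply Rabs_triang|]. rewrite Rabs_Ropp; lra.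
    + apply polylog_plus.
      * eapply polylog_le; [|apply polylog_isum, H]. intros; rewrite Rabs_Rabsolu; lra.
      * eapply polylog_le; [|apply polylog_div_INR, H]. intros; rewrite Rabs_Rabsolu; lra.
  - eapply polylog_le; [|exact H]. intros [|n]; [right; simpl INR; f_equal; ring|].
    rewrite isum_pred_S by lia. right; f_equal; ring.
Qed.

Lemma Slow1_inv (b : R) : 0 <= b -> Slow1 (fun n => / (2 * INR n - b)).
Proof.
  intros Hb. destruct (INR_unbounded b) as [N HN].
  (* Beyond this index 2n - b is at least n + 1, so the sign and the possible zero of the
     denominator at smaller n are irrelevant. *)
  assert (K : forall n, (S N <= n)%nat -> b + 1 <= INR n).
  { intros n Hn. apply le_INR in Hn. rewrite S_INR in Hn. lra. }
  split.
  - apply (polylog_eventually _ 1 (S N)); intros n Hn. specialize (K n Hn).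
    rewrite Rabs_right.
    + apply (Rmult_le_reg_r (2 * INR n - b)); [lra|].
      rewrite Rmult_assoc, Rinv_l by lra. lra.
    + apply Rle_ge, Rmult_le_pos; [lra|]. apply Rlt_le, Rinv_0_lt_compat; lra.
  - apply (polylog_eventually _ 2 (S N)); intros n Hn. specialize (K n Hn).
    rewrite S_INR. set (x := INR n) in *.
    replace (x ^ 2 * (/ (2 * (x + 1) - b) - / (2 * x - b)))
      with (- (2 * x ^ 2 / ((2 * (x + 1) - b) * (2 * x - b)))) by (field; lra).
    rewrite Rabs_Ropp, Rabs_right.
    + apply (Rmult_le_reg_r ((2 * (x + 1) - b) * (2 * x - b))); [nra|].
      unfold Rdiv; rewrite Rmult_assoc, Rinv_l by nra. nra.
    + apply Rle_ge, Rlt_le, Rdiv_lt_0_compat; nra.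
Qed.

(* [(-1)^n A_n] is [(-1)^n (A_n - A_(n+1)) / 2] up to a telescoping term. *)
Lemma ex_series_alt (A : nat -> R) : Slow1 A ->
  ex_series (fun n => (-1) ^ S n * A (S n)).
Proof.
  intros [A0 A1].
  set (B := fun n => (-1) ^ n * A n / 2).
  apply (ex_series_ext (fun n => (B (S n) - B (S (S n)))
     + (-1) ^ S n * (A (S n) - A (S (S n))) / 2)).
  { intros n; unfold B. change ((-1) ^ S (S n)) with (-1 * (-1) ^ S n). eqR; field. }
  apply (ex_series_plus (V := R_NormedModule)
           (fun n => B (S n) - B (S (S n)))
           (fun n => (-1) ^ S n * (A (S n) - A (S (S n))) / 2)).
  - exists (B 1%nat - 0).
    change (is_lim_seq (sum_n (fun n => B (S n) - B (S (S n)))) (B 1%nat - 0)).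
    apply (is_lim_seq_ext (fun n => B 1%nat - B (S (S n)))).
    + intros n; induction n as [|n IH]; [now rewrite sum_O|].
      rewrite sum_Sn, <- IH. change (plus ?a ?b) with (Rplus a b); eqR; ring.
    + apply is_lim_seq_minus'; [apply is_lim_seq_const|].
      apply (is_lim_seq_incr_1 (fun n => B (S n))), polylog_lim0.
      apply (polylog_le (fun n => INR n * A n)); auto. intros n; unfold B.
      rewrite !Rabs_mult. unfold Rdiv; rewrite !Rabs_mult, pow_1_abs, (Rabs_right (/ 2)) by lra.
      generalize (Rabs_pos (INR n)) (Rabs_pos (A n)); nra.
  - apply (polylog_ex_series (fun n => (-1) ^ n * (A n - A (S n)) / 2)).
    apply (polylog_le (fun n => INR n ^ 2 * (A (S n) - A n))); auto. intros n.
    rewrite !Rabs_mult. unfold Rdiv; rewrite !Rabs_mult, pow_1_abs, (Rabs_right (/ 2)) by lra.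
    rewrite (Rabs_minus_sym (A n)).
    generalize (Rabs_pos (INR n ^ 2)) (Rabs_pos (A (S n) - A n)); nra.
Qed.

(** * Sums over compositions *)

(* Coefficient of [x^k] in [(sum_j g j x^j) / (l - x)]. *)
Fixpoint divg (g : nat -> R) (l : R) (k : nat) : R :=
  match k with
  | O => g O / l
  | S k' => (divg g l k' + g (S k')) / l
  end.

(* [hinner i k n] is the coefficient of [x^k] in the sum over [0 < n_1 < ... < n_i < n] of
   [prod_j 1 / (2 n_j - j - x)]. *)
Fixpoint hinner (i k n : nat) : R :=
  match i with
  | O => match k with O => 1 | S _ => 0 end
  | S i' => isum 1 (n - 1) (fun m =>
              divg (fun j => hinner i' j m) (2 * INR m - INR (S i')) k)
  end.

(** The same product with one more factor, whose index, the outermost, is fixed at [n]. Since 1/(l -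
    x) has coefficients 1/l^(j+1), [k] is the excess of the weight over the depth. *)
Definition hcoef (i k n : nat) : R :=
  divg (fun j => hinner i j n) (2 * INR n - INR (S i)) k.

Lemma hinner_S (i k n : nat) : hinner (S i) k n = isum 1 (n - 1) (hcoef i k).
Proof. reflexivity. Qed.

Lemma divg_lsum (g : nat -> R) (l : R) (k : nat) :
  divg g l k = lsum (fun a => g (S k - a)%nat / l ^ a) (seq 1 (S k)).
Proof.
  induction k as [|k IH].
  - simpl seq; rewrite lsum_cons, lsum_nil; simpl. unfold Rdiv; rewrite Rmult_1_r; ring.
  - simpl divg. rewrite IH, (lsum_seq_Sl _ 1 (S k)). cbv beta. replace (S (S k) - 1)%nat with (S k) by lia.
    replace (lsum (fun i => g (S (S k) - S i)%nat / l ^ S i) (seq 1 (S k)))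
      with (/ l * lsum (fun a => g (S k - a)%nat / l ^ a) (seq 1 (S k))).
    + unfold Rdiv. rewrite pow_1. ring.
    + rewrite <- lsum_scal. apply lsum_ext; intros a _.
      change (S (S k) - S a)%nat with (S k - a)%nat.
      change (l ^ S a) with (l * l ^ a). unfold Rdiv. rewrite Rinv_mult; ring.
Qed.

Lemma divg_zero (g : nat -> R) (l : R) (k : nat) :
  (forall j, g j = 0) -> divg g l k = 0.
Proof.
  intros E; induction k as [|k IH]; simpl; rewrite ?IH, E; unfold Rdiv; ring.
Qed.

Lemma hinner_zero (i k n : nat) : (n <= S i)%nat -> hinner (S i) k n = 0.
Proof.
  revert k n; induction i as [|i IH]; intros k n Hn; rewrite hinner_S, isum1E;
    apply lsum_zero; intros m Hm; apply in_seq in Hm; [lia|].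
  apply divg_zero; intros j. apply IH. lia.
Qed.

(** No strictly increasing chain of [i] positive integers fits below [n]. This covers every index at
    which 2n - i - 1 may be zero or negative, so division by zero never contributes. *)
Lemma hcoef_zero (i k n : nat) : (1 <= n <= i)%nat -> hcoef i k n = 0.
Proof.
  intros Hn. destruct i as [|i]; [lia|].
  apply divg_zero; intros j. apply hinner_zero; lia.
Qed.

Lemma hcoef_scal_0 (i n : nat) : (1 <= n)%nat ->
  (2 * INR n - INR (S i)) * hcoef i 0 n = hinner i 0 n.
Proof.
  intros Hn. destruct (le_lt_dec n i) as [Hi|Hi].
  - rewrite hcoef_zero by lia. destruct i as [|i]; [lia|].
    rewrite hinner_zero by lia. ring.
  - unfold hcoef. change (divg ?g ?l 0) with (g 0%nat / l).
    cbv beta. field.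
    apply le_INR in Hi. apply le_INR in Hn. rewrite !S_INR in *. simpl in Hn. lra.
Qed.

(** Multiplication of the generating function by l - x. It survives where l is zero because both
    sides then vanish with the empty chain; for [n > i] one has l > 0. *)
Lemma hcoef_scal_S (i k n : nat) : (1 <= n)%nat ->
  (2 * INR n - INR (S i)) * hcoef i (S k) n = hcoef i k n + hinner i (S k) n.
Proof.
  intros Hn. destruct (le_lt_dec n i) as [Hi|Hi].
  - rewrite !hcoef_zero by lia. destruct i as [|i]; [lia|].
    rewrite hinner_zero by lia. ring.
  - unfold hcoef. change (divg ?g ?l (S k)) with ((divg g l k + g (S k)) / l).
    cbv beta. field.
    apply le_INR in Hi. apply le_INR in Hn. rewrite !S_INR in *. simpl in Hn. lra.
Qed.

Lemma comps_S (k r : nat) :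
  comps k (S r) = flat_map (fun a => map (cons a) (comps (k - a) r)) (seq 1 k).
Proof. reflexivity. Qed.

Lemma lsum_comps_S (F : list nat -> R) (k r : nat) :
  lsum F (comps k (S r))
  = lsum (fun a => lsum (fun ks => F (a :: ks)) (comps (k - a) r)) (seq 1 k).
Proof.
  rewrite comps_S, lsum_flat_map. apply lsum_ext; intros a _.
  now rewrite lsum_map.
Qed.

Lemma lsum_triangle (f : nat -> nat -> R) (k : nat) :
  lsum (fun a => lsum (fun b => f a b) (seq 1 (k - a))) (seq 1 k)
  = lsum (fun b => lsum (fun a => f a b) (seq 1 (k - b))) (seq 1 k).
Proof.
  (* Extension by zero to the full square turns the summation over the triangle into an exchange of
     two independent sums. *)
  set (g := fun a b => if (a + b <=? k)%nat then f a b else 0).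
  assert (E : forall (h : nat -> R) m, (m <= k)%nat ->
     lsum h (seq 1 (k - m)) = lsum (fun b => if (m + b <=? k)%nat then h b else 0) (seq 1 k)).
  { intros h m Hm. assert (Q : seq 1 k = seq 1 (k - m) ++ seq (1 + (k - m)) m).
    { rewrite <- seq_app; f_equal; lia. }
    rewrite Q, lsum_app.
    rewrite (lsum_zero _ (seq (1 + (k - m)) m)).
    - rewrite Rplus_0_r. apply lsum_ext; intros b Hb; apply in_seq in Hb.
      destruct (Nat.leb_spec (m + b) k); [reflexivity|lia].
    - intros b Hb; apply in_seq in Hb.
      destruct (Nat.leb_spec (m + b) k); [lia|reflexivity]. }
  transitivity (lsum (fun a => lsum (g a) (seq 1 k)) (seq 1 k)).
  - apply lsum_ext; intros a Ha; apply in_seq in Ha. apply E; lia.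
  - rewrite lsum_swap. apply lsum_ext; intros b Hb; apply in_seq in Hb.
    rewrite E by lia. apply lsum_ext; intros a _. unfold g. now rewrite Nat.add_comm.
Qed.

(** [comps] peels off the first part, whereas [Tinner] nests with the last index outermost; the
    recursion on nested sums needs the last part split off. *)
Lemma lsum_comps_snoc (r : nat) : forall (F : list nat -> R) (k : nat),
  lsum F (comps k (S r))
  = lsum (fun a => lsum (fun ks => F (ks ++ a :: nil)) (comps (k - a) r)) (seq 1 k).
Proof.
  induction r as [|r IH]; intros F k; rewrite lsum_comps_S.
  - apply lsum_ext; intros a _. simpl comps.
    destruct (k - a)%nat; rewrite ?lsum_cons, ?lsum_nil; reflexivity.
  - transitivity (lsum (fun a => lsum (fun b =>
        lsum (fun ks => F (a :: ks ++ b :: nil)) (comps (k - a - b) r))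
        (seq 1 (k - a))) (seq 1 k)).
    { apply lsum_ext; intros a _. now rewrite IH. }
    rewrite lsum_triangle. apply lsum_ext; intros b _.
    rewrite lsum_comps_S. apply lsum_ext; intros a _.
    now replace (k - a - b)%nat with (k - b - a)%nat by lia.
Qed.

Lemma comps_spec (r : nat) : forall k ks, In ks (comps k r) ->
  length ks = r /\ List.Forall (fun a => (1 <= a)%nat) ks.
Proof.
  induction r as [|r IH]; intros k ks Hk.
  - destruct k; simpl in Hk; [|contradiction]. destruct Hk as [<-|[]].
    split; [reflexivity|constructor].
  - rewrite comps_S in Hk. apply in_flat_map in Hk as (a & Ha & Hk).
    apply in_map_iff in Hk as (l & <- & Hl). apply in_seq in Ha.
    destruct (IH _ _ Hl) as [E F]. split; [simpl; now rewrite E|].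
    constructor; [lia|assumption].
Qed.

Lemma comps_small (r : nat) : forall k, (k < r)%nat -> comps k r = nil.
Proof.
  induction r as [|r IH]; intros k Hk; [lia|]. rewrite comps_S.
  rewrite flat_map_concat_map. apply concat_nil_Forall, List.Forall_map, List.Forall_forall.
  intros a Ha. apply in_seq in Ha. rewrite IH by lia. reflexivity.
Qed.

Lemma Tinner_app (ks ks' : list nat) (j : nat) : (j <= length ks)%nat ->
  forall n, Tinner (ks ++ ks') j n = Tinner ks j n.
Proof.
  induction j as [|j IH]; intros Hj n; [reflexivity|]. simpl Tinner.
  rewrite !isum1E. apply lsum_ext; intros m _.
  rewrite IH, app_nth1 by lia. reflexivity.
Qed.

Lemma Tinner_S (ks : list nat) (j n : nat) : Tinner ks (S j) n =
  isum 1 (n - 1) (fun m => Tinner ks j m / (2 * INR m - INR (S j)) ^ nth j ks 0%nat).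
Proof. reflexivity. Qed.

Lemma lsum_comps_last (i k n : nat) :
  (forall k', lsum (fun ks => Tinner ks i n) (comps (k' + i) i) = hinner i k' n) ->
  lsum (fun ks => Tinner ks i n / (2 * INR n - INR (S i)) ^ nth i ks 0%nat)
    (comps (k + S i) (S i)) = hcoef i k n.
Proof.
  intros E. unfold hcoef. rewrite divg_lsum, lsum_comps_snoc.
  replace (k + S i)%nat with (S k + i)%nat by lia.
  (* If the last part exceeds [S k], less than [i] remains for [i] positive parts, and there is no
     such composition. *)
  rewrite seq_app, lsum_app. rewrite (lsum_zero _ (seq (1 + S k) i)), Rplus_0_r.
  - apply lsum_ext; intros a Ha; apply in_seq in Ha.
    rewrite <- E. replace (S k + i - a)%nat with (S k - a + i)%nat by lia.
    unfold Rdiv. rewrite (Rmult_comm (lsum _ _)), <- lsum_scal. apply lsum_ext; intros ks Hks.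
    apply comps_spec in Hks as [Hl _]. rewrite Tinner_app by lia.
    rewrite app_nth2 by lia. rewrite Hl, Nat.sub_diag. simpl nth. ring.
  - intros a Ha; apply in_seq in Ha. rewrite comps_small by lia. reflexivity.
Qed.

Lemma lsum_Tinner (i : nat) : forall k n,
  lsum (fun ks => Tinner ks i n) (comps (k + i) i) = hinner i k n.
Proof.
  induction i as [|i IH]; intros k n.
  - rewrite Nat.add_0_r. simpl comps. destruct k; simpl.
    + rewrite lsum_cons, lsum_nil; ring.
    + reflexivity.
  - rewrite hinner_S, isum1E.
    transitivity (lsum (fun ks => lsum (fun m =>
       Tinner ks i m / (2 * INR m - INR (S i)) ^ nth i ks 0%nat) (seq 1 (n - 1)))
       (comps (k + S i) (S i))).
    { apply lsum_ext; intros ks _. now rewrite Tinner_S, isum1E. }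
    rewrite lsum_swap. apply lsum_ext; intros m _.
    apply lsum_comps_last. intros k'; apply IH.
Qed.

Lemma lsum_Tbar_term (i k n : nat) :
  lsum (fun ks => Tbar_term ks n) (comps (k + S i) (S i))
  = 2 ^ S i * (-1) ^ n * hcoef i k n.
Proof.
  rewrite <- (lsum_comps_last i k n) by (intros; apply lsum_Tinner).
  rewrite <- lsum_scal. apply lsum_ext; intros ks Hks.
  apply comps_spec in Hks as [Hl _]. unfold Tbar_term. rewrite Hl.
  replace (S i - 1)%nat with i by lia. unfold Rdiv; ring.
Qed.

(* For [n > j] the denominator [2n - j - 1] is at least [n]. *)
Lemma Rabs_div_shift (j n : nat) (x : R) : (j < n)%nat ->
  INR n * Rabs (x / (2 * INR n - INR (S j))) <= Rabs x.
Proof.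
  intros Hj. apply le_INR in Hj as Hj'. assert (H0 : 0 < INR n) by (apply lt_0_INR; lia).
  unfold Rdiv. rewrite Rabs_mult, (Rabs_right (/ _)).
  2:{ apply Rle_ge, Rlt_le, Rinv_0_lt_compat; lra. }
  apply (Rmult_le_reg_r (2 * INR n - INR (S j))); [lra|].
  replace (INR n * (Rabs x * / (2 * INR n - INR (S j))) * (2 * INR n - INR (S j)))
    with (Rabs x * INR n) by (field; lra).
  apply Rmult_le_compat_l; [apply Rabs_pos|lra].
Qed.

Lemma polylog_hinner (i : nat) : forall k, polylog (hinner i k).
Proof.
  induction i as [|i IH]; intros k.
  - apply (polylog_ext (fun _ => match k with O => 1 | S _ => 0 end)); [reflexivity|apply polylog_const].
  - apply (polylog_ext (fun n => isum 1 (n - 1) (hcoef i k))); [reflexivity|].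
    apply Slow_isum_pred.
    assert (HS : forall n x, (i < n)%nat ->
       Rabs (INR n * (x / (2 * INR n - INR (S i)))) <= Rabs x).
    { intros n x Hn. rewrite Rabs_mult, (Rabs_right (INR n)) by (apply Rle_ge, pos_INR).
      now apply Rabs_div_shift. }
    induction k as [|k IHk].
    + apply (polylog_le (hinner i 0)); [|apply IH]. intros n.
      destruct (le_lt_dec n i) as [Hi|Hi]; [|now apply HS].
      destruct n as [|n]; [simpl INR; rewrite Rmult_0_l, Rabs_R0; apply Rabs_pos|].
      rewrite hcoef_zero, Rmult_0_r, Rabs_R0 by lia; apply Rabs_pos.
    + apply (polylog_le (fun n => hcoef i k n + hinner i (S k) n)).
      * intros n. destruct (le_lt_dec n i) as [Hi|Hi]; [|now apply HS].
        destruct n as [|n]; [simpl INR; rewrite Rmult_0_l, Rabs_R0; apply Rabs_pos|].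
        rewrite hcoef_zero, Rmult_0_r, Rabs_R0 by lia; apply Rabs_pos.
      * apply polylog_plus; [|apply IH]. now apply polylog_div_INR.
Qed.

Lemma Tinner_zero (ks : list nat) (j n : nat) : (n <= S j)%nat -> Tinner ks (S j) n = 0.
Proof.
  revert n; induction j as [|j IH]; intros n Hn; rewrite Tinner_S, isum1E;
    apply lsum_zero; intros m Hm; apply in_seq in Hm; [lia|].
  rewrite IH by lia. unfold Rdiv; ring.
Qed.

Lemma Slow_Tinner (ks : list nat) (j : nat) : (j <= length ks)%nat ->
  List.Forall (fun a => (1 <= a)%nat) ks -> Slow (Tinner ks j).
Proof.
  intros Hj F; induction j as [|j IH]; [apply (Slow_const 1)|].
  apply (Slow_isum_pred (fun m => Tinner ks j m / (2 * INR m - INR (S j)) ^ nth j ks 0%nat)).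
  apply (polylog_le (Tinner ks j)); [|apply IH; lia]. intros n.
  destruct (le_lt_dec n j) as [Hn|Hn].
  - destruct n as [|n]; [simpl INR; rewrite Rmult_0_l, Rabs_R0; apply Rabs_pos|].
    destruct j as [|j]; [lia|]. rewrite Tinner_zero by lia.
    unfold Rdiv; rewrite Rmult_0_l, Rmult_0_r; lra.
  - assert (Ha : (1 <= nth j ks 0)%nat).
    { apply (proj1 (List.Forall_forall _ _) F), nth_In; lia. }
    destruct (nth j ks 0%nat) as [|a]; [lia|].
    rewrite Rabs_mult, (Rabs_right (INR n)) by (apply Rle_ge, pos_INR).
    eapply Rle_trans; [|apply (Rabs_div_shift j n); exact Hn].
    apply Rmult_le_compat_l; [apply pos_INR|].
    apply le_INR in Hn. assert (H1 := pos_INR j).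
    rewrite S_INR in *.
    unfold Rdiv; rewrite !Rabs_mult. apply Rmult_le_compat_l; [apply Rabs_pos|].
    set (l := 2 * INR n - (INR j + 1)) in *. assert (Hl : 1 <= l) by (unfold l; lra).
    assert (Hp : 1 <= l ^ a) by now apply pow_R1_Rle.
    rewrite !Rabs_right by (apply Rle_ge, Rlt_le, Rinv_0_lt_compat; try (apply pow_lt); lra).
    apply Rinv_le_contravar; [lra|]. simpl; nra.
Qed.

Lemma ex_series_Tbar_term (k r : nat) (ks : list nat) : (1 <= r)%nat ->
  In ks (comps k r) -> ex_series (fun n => Tbar_term ks (S n)).
Proof.
  intros Hr Hks. apply comps_spec in Hks as [Hl F].
  assert (Ha : (1 <= nth (r - 1) ks 0)%nat).
  { apply (proj1 (List.Forall_forall _ _) F), nth_In; lia. }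
  set (v := fun n => / (2 * INR n - INR r)).
  assert (Sv : Slow1 v) by apply Slow1_inv, pos_INR.
  destruct (nth (r - 1) ks 0%nat) as [|a] eqn:Ea; [lia|].
  apply (ex_series_ext (fun n => (-1) ^ S n * (2 ^ r * Tinner ks (r - 1) (S n) * v (S n) ^ a * v (S n)))).
  { intros n. unfold Tbar_term. rewrite Hl, Ea. unfold v, Rdiv. change (?x ^ S a) with (x * x ^ a).
    rewrite Rinv_mult, pow_inv. eqR; ring. }
  apply (ex_series_alt (fun n => 2 ^ r * Tinner ks (r - 1) n * v n ^ a * v n)).
  apply (Slow1_mult (fun n => 2 ^ r * Tinner ks (r - 1) n * v n ^ a)); auto.
  apply (Slow_mult (fun n => 2 ^ r * Tinner ks (r - 1) n)).
  - apply (Slow_mult (fun _ => 2 ^ r)); [apply Slow_const|]. apply Slow_Tinner; [lia|auto].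
  - apply Slow_pow, Slow1_Slow, Sv.
Qed.

Lemma W_conv_true (k r : nat) : (1 <= r)%nat -> W_conv k r.
Proof.
  intros Hr. apply List.Forall_forall; intros ks Hks. now apply (ex_series_Tbar_term k r).
Qed.

Lemma is_series_W (i k : nat) :
  is_series (fun n => 2 ^ S i * (-1) ^ S n * hcoef i k (S n)) (W (k + S i) (S i)).
Proof.
  change (W (k + S i) (S i)) with
    (lsum (fun ks => Series (fun n => Tbar_term ks (S n))) (comps (k + S i) (S i))).
  eapply is_series_ext; [|apply is_series_lsum].
  - intros n. cbv beta. apply (lsum_Tbar_term i k (S n)).
  - intros ks Hks. cbv beta. apply (ex_series_Tbar_term (k + S i) (S i)); [lia|auto].
Qed.

(** * Growth of the harmonic sums and convergence of the series on the right *)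

Lemma INR_two_div_odd (n : nat) : Rabs (INR n * (2 / (2 * INR n - 1))) <= 2.
Proof.
  destruct n as [|n]; [simpl INR; rewrite Rmult_0_l, Rabs_R0; lra|].
  rewrite S_INR; assert (H := pos_INR n); set (x := INR n) in *.
  rewrite Rabs_right.
  - apply (Rmult_le_reg_r (2 * (x + 1) - 1)); [lra|].
    replace ((x + 1) * (2 / (2 * (x + 1) - 1)) * (2 * (x + 1) - 1)) with (2 * (x + 1))
      by (field; lra). lra.
  - apply Rle_ge, Rmult_le_pos; [lra|]. apply Rlt_le, Rdiv_lt_0_compat; lra.
Qed.

Lemma INR_two_div_even (n : nat) : Rabs (INR n * (2 / (2 * INR n))) <= 1.
Proof.
  destruct n as [|n]; [simpl INR; rewrite Rmult_0_l, Rabs_R0; lra|].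
  assert (0 < INR (S n)) by (apply lt_0_INR; lia).
  replace (INR (S n) * (2 / (2 * INR (S n)))) with 1 by (field; lra).
  rewrite Rabs_R1; lra.
Qed.

Lemma polylog_weight (w U : nat -> R) : polylog (fun n => INR n * w n) -> polylog U ->
  polylog (fun n => INR n * (w n * U n)).
Proof.
  intros Hw HU. apply (polylog_ext (fun n => (INR n * w n) * U n)); [intros; ring|].
  now apply polylog_mult.
Qed.

Lemma Slow_Tn (a : nat) : Slow (fun n => Defs.Tn n a).
Proof.
  induction a as [|a IH]; [apply (Slow_const 1)|]. simpl Defs.Tn.
  destruct (Nat.even a); [apply Slow_isum|apply Slow_isum_pred];
    apply polylog_weight; try apply IH.
  - apply (polylog_eventually _ 2 0); intros; apply INR_two_div_odd.
  - apply (polylog_eventually _ 1 0); intros; apply INR_two_div_even.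
Qed.

Lemma Slow_Sn (a : nat) : Slow (fun n => Defs.Sn n a).
Proof.
  induction a as [|a IH]; [apply (Slow_const 1)|]. simpl Defs.Sn.
  destruct (Nat.even a); [apply Slow_isum_pred|apply Slow_isum];
    apply polylog_weight; try apply IH.
  - apply (polylog_eventually _ 1 0); intros; apply INR_two_div_even.
  - apply (polylog_eventually _ 2 0); intros; apply INR_two_div_odd.
Qed.

Lemma ex_series_even (U V : nat -> R) : Slow U -> Slow V ->
  ex_series (fun n => U (S n) * V (S n) / INR (S n) * (-1) ^ S n).
Proof.
  intros HU HV.
  apply (ex_series_ext (fun n => (-1) ^ S n *
     ((2 * (U (S n) * V (S n))) * / (2 * INR (S n) - 0)))).
  { intros n. assert (0 < INR (S n)) by (apply lt_0_INR; lia). eqR. field. lra. }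
  apply (ex_series_alt (fun n => 2 * (U n * V n) * / (2 * INR n - 0))).
  apply (Slow1_mult (fun n => 2 * (U n * V n))); [|apply Slow1_inv; lra].
  apply (Slow_mult (fun _ => 2)); [apply Slow_const|now apply Slow_mult].
Qed.

Lemma ex_series_odd (U V : nat -> R) : Slow U -> Slow V ->
  ex_series (fun n => U (S n) * V (S n) / (2 * INR (S n) - 1) * (-1) ^ S n).
Proof.
  intros HU HV.
  apply (ex_series_ext (fun n => (-1) ^ S n *
     ((U (S n) * V (S n)) * / (2 * INR (S n) - 1)))).
  { intros n. eqR. unfold Rdiv; ring. }
  apply (ex_series_alt (fun n => (U n * V n) * / (2 * INR n - 1))).
  apply (Slow1_mult (fun n => U n * V n)); [now apply Slow_mult|apply Slow1_inv; lra].
Qed.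

(** * Calculus on the half-line *)

(* In the notation of the header, [uu] is [u], [yy] is [y], [ss] is [y']; [ee j] and [cc i] are
   the divided powers of [x] and [y]. *)
Definition uu (x : R) : R := (1 - exp (- x)) / (1 + exp (- x)).
Definition yy (x : R) : R := 2 * atan (uu x).
Definition ss (x : R) : R := 2 * exp (- x) / (1 + exp (- x) ^ 2).
Definition ee (j : nat) (x : R) : R := x ^ j / INR (fact j).
Definition cc (i : nat) (x : R) : R := yy x ^ i / INR (fact i).

(** The value 0 in front of the sequence gives derivatives and recursions the same form at k = 0 as
    elsewhere. *)
Definition prev (f : nat -> R) (k : nat) : R :=
  match k with O => 0 | S k' => f k' end.

Lemma fact_pos (n : nat) : 1 <= INR (fact n).
Proof. apply (le_INR 1), lt_O_fact. Qed.

Lemma is_derive_val (f : R -> R) (x l l' : R) :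
  is_derive f x l -> l = l' -> is_derive f x l'.
Proof. now intros H <-. Qed.

Lemma is_derive_pow_fact (f : R -> R) (f' x : R) (k : nat) : is_derive f x f' ->
  is_derive (fun y => f y ^ k / INR (fact k)) x
    (f' * prev (fun k => f x ^ k / INR (fact k)) k).
Proof.
  intros H. destruct k as [|k]; simpl prev.
  - apply (is_derive_ext (fun _ => 1)); [intros; simpl; eqR; field|].
    rewrite Rmult_0_r. apply (is_derive_const (V := R_NormedModule) 1).
  - assert (K := is_derive_pow f (S k) x f' H).
    apply (is_derive_ext (fun y => / INR (fact (S k)) * f y ^ S k)).
    { intros t; eqR; unfold Rdiv; ring. }
    eapply is_derive_val.
    + apply (is_derive_scal (fun y => f y ^ S k) x (/ INR (fact (S k)))). exact K.
    + simpl pred. rewrite fact_simpl, mult_INR.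
      assert (P := fact_pos k). assert (Q : 0 < INR (S k)) by (apply lt_0_INR; lia).
      field. split; lra.
Qed.

Lemma is_derive_ee (j : nat) (x : R) : is_derive (ee j) x (prev (fun j => ee j x) j).
Proof.
  eapply is_derive_val; [apply (is_derive_pow_fact (fun y => y) 1 x j), (is_derive_id (K := R_AbsRing))|].
  unfold ee; ring.
Qed.

Lemma is_derive_uu (x : R) : is_derive uu x ((1 - uu x ^ 2) / 2).
Proof.
  assert (P := exp_pos (- x)). unfold uu. auto_derive; [lra|]. field. lra.
Qed.

(** [uu x] is tanh(x/2), so [yy] is the Gudermannian function and [ss] the hyperbolic secant. *)
Lemma is_derive_yy (x : R) : is_derive yy x (ss x).
Proof.
  assert (P := exp_pos (- x)). unfold yy, ss.
  eapply is_derive_val.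
  - apply (is_derive_scal (fun x => atan (uu x))).
    apply (is_derive_comp (V := R_NormedModule) atan uu);
      [apply is_derive_Reals, derivable_pt_lim_atan|apply is_derive_uu].
  - change (scal ?a ?b) with (a * b). unfold uu, Rsqr. field.
    split; nra.
Qed.

Lemma is_derive_cc (i : nat) (x : R) :
  is_derive (cc i) x (ss x * prev (fun i => cc i x) i).
Proof. apply (is_derive_pow_fact yy), is_derive_yy. Qed.

Lemma uu_0 : uu 0 = 0.
Proof. unfold uu. rewrite Ropp_0, exp_0. field. Qed.

Lemma uu_bounds (x : R) : 0 <= x -> 0 <= uu x < 1.
Proof.
  intros Hx. assert (P := exp_pos (- x)).
  assert (Q : exp (- x) <= 1).
  { rewrite <- exp_0. destruct Hx as [Hx| <-]; [left; apply exp_increasing; lra|].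
    rewrite Ropp_0; lra. }
  unfold uu; split.
  - apply Rmult_le_pos; [lra|]. apply Rlt_le, Rinv_0_lt_compat; lra.
  - apply (Rmult_lt_reg_r (1 + exp (- x))); [lra|].
    unfold Rdiv; rewrite Rmult_assoc, Rinv_l by lra. lra.
Qed.

Lemma ss_bounds (x : R) : 0 <= ss x <= 1.
Proof.
  assert (P := exp_pos (- x)). set (t := exp (- x)) in *. unfold ss; fold t; split.
  - apply Rlt_le, Rdiv_lt_0_compat; nra.
  - assert (Q : 0 < 1 + t ^ 2) by nra. apply (Rmult_le_reg_r (1 + t ^ 2)); auto.
    unfold Rdiv; rewrite Rmult_assoc, Rinv_l by lra. generalize (pow2_ge_0 (t - 1)). simpl; lra.
Qed.

(** Chain rule: the second factor is the derivative of [uu] and serves as the weight of the moments,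
    while the first is absorbed into the expansion [BN]. *)
Lemma ss_uu (x : R) : ss x = 2 / (1 + uu x ^ 2) * ((1 - uu x ^ 2) / 2).
Proof.
  assert (P := exp_pos (- x)). unfold ss, uu. field. repeat split; nra.
Qed.

(** * Comparison of functions through their derivatives *)

(** This takes the place of integral estimates: g + f and g - f have nonnegative derivatives, so the
    mean value theorem makes both increase from 0 to [X]. *)
Lemma derive_abs_le (f g f' g' : R -> R) (X : R) :
  (forall x, is_derive f x (f' x)) -> (forall x, is_derive g x (g' x)) ->
  (forall x, 0 <= x -> Rabs (f' x) <= g' x) -> 0 <= X ->
  Rabs (f X - f 0) <= g X - g 0.
Proof.
  intros Hf Hg H HX.
  assert (K : forall (h h' : R -> R), (forall x, is_derive h x (h' x)) ->
     (forall x, 0 <= x -> 0 <= h' x) -> h 0 <= h X).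
  { intros h h' Hh Hp.
    destruct (MVT_gen h 0 X h') as (c & Hc & E).
    - intros x _; apply Hh.
    - intros x _. apply continuity_pt_filterlim.
      apply (ex_derive_continuous (K := R_AbsRing) (V := R_NormedModule)).
      now exists (h' x).
    - rewrite Rmin_left, Rmax_right in Hc by lra.
      assert (0 <= h' c) by (apply Hp; lra). nra. }
  apply Rabs_le_between. split.
  - assert (Q : g 0 + f 0 <= g X + f X); [|lra].
    apply (K (fun x => g x + f x) (fun x => g' x + f' x)).
    + intros x. apply (is_derive_plus (V := R_NormedModule) g f); auto.
    + intros x Hx. specialize (H x Hx). apply Rabs_le_between in H. lra.
  - assert (Q : g 0 - f 0 <= g X - f X); [|lra].
    apply (K (fun x => g x - f x) (fun x => g' x - f' x)).
    + intros x. apply (is_derive_minus (V := R_NormedModule) g f); auto.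
    + intros x Hx. specialize (H x Hx). apply Rabs_le_between in H. lra.
Qed.

Lemma derive_eq (f g f' g' : R -> R) (X : R) :
  (forall x, is_derive f x (f' x)) -> (forall x, is_derive g x (g' x)) ->
  (forall x, f' x = g' x) -> f 0 = g 0 -> 0 <= X -> f X = g X.
Proof.
  intros Hf Hg H E HX.
  assert (K : Rabs ((f X - g X) - (f 0 - g 0)) <= 0 - 0).
  { apply (derive_abs_le (fun x => f x - g x) (fun _ => 0) (fun x => f' x - g' x) (fun _ => 0)); auto.
    - intros x. apply (is_derive_minus (V := R_NormedModule) f g); auto.
    - intros x. apply (is_derive_const (V := R_NormedModule) 0).
    - intros x _. rewrite H, Rminus_diag, Rabs_R0; lra. }
  apply Rabs_le_between in K. lra.
Qed.

Lemma yy_bounds (x : R) : 0 <= x -> 0 <= yy x <= x.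
Proof.
  intros Hx. assert (Y0 : yy 0 = 0) by (unfold yy; rewrite uu_0, atan_0; ring).
  split.
  - unfold yy. apply Rmult_le_pos; [lra|]. destruct (uu_bounds x Hx) as [[H|H] _].
    + rewrite <- atan_0. left; now apply atan_increasing.
    + rewrite <- H, atan_0; lra.
  - assert (K : Rabs (yy x - yy 0) <= x - 0).
    { apply (derive_abs_le yy (fun x => x) ss (fun _ => 1)); auto.
      - apply is_derive_yy.
      - intros; apply (is_derive_id (K := R_AbsRing)).
      - intros y _. destruct (ss_bounds y). rewrite Rabs_right; lra. }
    rewrite Y0 in K. apply Rabs_le_between in K. lra.
Qed.

(** The base 1 + x, rather than x, allows different exponents to be raised to a common one. *)
Lemma pow_div_fact_bounds (y x : R) (i : nat) : 0 <= y <= x ->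
  0 <= y ^ i / INR (fact i) <= (1 + x) ^ i.
Proof.
  intros H. assert (F := fact_pos i). assert (P : 0 <= y ^ i) by (apply pow_le; lra).
  split.
  - apply Rmult_le_pos; auto. apply Rlt_le, Rinv_0_lt_compat; lra.
  - apply Rle_trans with (y ^ i); [|apply pow_incr; lra].
    apply (Rmult_le_reg_r (INR (fact i))); [lra|].
    unfold Rdiv; rewrite Rmult_assoc, Rinv_l by lra. nra.
Qed.

Lemma ee_bounds (j : nat) (x : R) : 0 <= x -> 0 <= ee j x <= (1 + x) ^ j.
Proof. intros; apply pow_div_fact_bounds; lra. Qed.

Lemma cc_bounds (j : nat) (x : R) : 0 <= x -> 0 <= cc j x <= (1 + x) ^ j.
Proof. intros; apply pow_div_fact_bounds. now apply yy_bounds. Qed.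

Lemma ee_0_0 : ee 0 0 = 1.
Proof. unfold ee; simpl; field. Qed.

Lemma ee_S_0 (j : nat) : ee (S j) 0 = 0.
Proof. unfold ee. rewrite pow_i by lia. unfold Rdiv; ring. Qed.

Lemma cc_0_0 : cc 0 0 = 1.
Proof. unfold cc; simpl; field. Qed.

Lemma cc_S_0 (j : nat) : cc (S j) 0 = 0.
Proof.
  unfold cc, yy. rewrite uu_0, atan_0, Rmult_0_r, pow_i by lia. unfold Rdiv; ring.
Qed.

Lemma lsum_head {f : nat -> R} (n : nat) :
  (forall j, f (S j) = 0) -> lsum f (seq 0 (S n)) = f 0%nat.
Proof.
  intros H. rewrite lsum_seq_Sl, lsum_zero; [ring|auto].
Qed.

(** * Exponentially decaying functions *)

Definition expdecay (f : R -> R) : Prop :=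
  exists (C : R) (c : nat), 0 <= C /\
    forall x, 0 <= x -> Rabs (f x) <= C * (1 + x) ^ c * exp (- x).

Lemma expdecay_le (f g : R -> R) :
  (forall x, 0 <= x -> Rabs (g x) <= Rabs (f x)) -> expdecay f -> expdecay g.
Proof.
  intros H (C & c & HC & K); exists C, c; split; auto; intros x Hx.
  eapply Rle_trans; [now apply H|now apply K].
Qed.

Lemma expdecay_exp : expdecay (fun x => exp (- x)).
Proof.
  exists 1, 0%nat; split; [lra|]; intros x _. simpl.
  rewrite Rabs_right by (apply Rle_ge, Rlt_le, exp_pos). lra.
Qed.

Lemma expdecay_0 : expdecay (fun _ => 0).
Proof. exists 0, 0%nat; split; [lra|]; intros; rewrite Rabs_R0; lra. Qed.

Lemma expdecay_plus (f g : R -> R) : expdecay f -> expdecay g -> expdecay (fun x => f x + g x).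
Proof.
  intros (C & c & HC & H) (D & d & HD & K); exists (C + D), (c + d)%nat.
  split; [lra|]; intros x Hx. specialize (H x Hx); specialize (K x Hx).
  assert (H1 : (1 + x) ^ c <= (1 + x) ^ (c + d)) by (apply Rle_pow; [lra|lia]).
  assert (H2 : (1 + x) ^ d <= (1 + x) ^ (c + d)) by (apply Rle_pow; [lra|lia]).
  assert (P := exp_pos (- x)).
  eapply Rle_trans; [apply Rabs_triang|].
  apply Rle_trans with (C * (1 + x) ^ c * exp (- x) + D * (1 + x) ^ d * exp (- x)); [lra|].
  rewrite <- Rmult_plus_distr_r. apply Rmult_le_compat_r; [lra|]. nra.
Qed.

Lemma expdecay_mult (g f : R -> R) (D : R) (d : nat) : 0 <= D ->
  (forall x, 0 <= x -> Rabs (g x) <= D * (1 + x) ^ d) -> expdecay f ->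
  expdecay (fun x => g x * f x).
Proof.
  intros HD H (C & c & HC & K); exists (D * C), (d + c)%nat; split; [nra|].
  intros x Hx. rewrite Rabs_mult, pow_add.
  replace (D * C * ((1 + x) ^ d * (1 + x) ^ c) * exp (- x))
    with ((D * (1 + x) ^ d) * (C * (1 + x) ^ c * exp (- x))) by ring.
  apply Rmult_le_compat; auto; apply Rabs_pos.
Qed.

Lemma expdecay_scal (a : R) (f : R -> R) : expdecay f -> expdecay (fun x => a * f x).
Proof.
  apply (expdecay_mult (fun _ => a) f (Rabs a) 0); [apply Rabs_pos|]; intros; simpl; lra.
Qed.

Lemma expdecay_ee (j : nat) (f : R -> R) : expdecay f -> expdecay (fun x => ee j x * f x).
Proof.
  apply (expdecay_mult (ee j) f 1 j); [lra|]; intros x Hx.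
  destruct (ee_bounds j x Hx). rewrite Rabs_right; lra.
Qed.

Lemma expdecay_cc (j : nat) (f : R -> R) : expdecay f -> expdecay (fun x => cc j x * f x).
Proof.
  apply (expdecay_mult (cc j) f 1 j); [lra|]; intros x Hx.
  destruct (cc_bounds j x Hx). rewrite Rabs_right; lra.
Qed.

Lemma expdecay_lsum {A : Type} (f : A -> R -> R) (l : list A) :
  (forall a, In a l -> expdecay (f a)) -> expdecay (fun x => lsum (fun a => f a x) l).
Proof.
  induction l as [|a l IH]; intros H; [apply expdecay_0|].
  apply (expdecay_plus (f a)); [|apply IH; intros]; apply H; simpl; auto.
Qed.

Lemma pow1_le_exp (c : nat) :
  exists C, 0 <= C /\ forall x, 0 <= x -> (1 + x) ^ c <= C * exp (x / 2).
Proof.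
  destruct (pow_le_exp c (/ 2)) as (C & HC & H); [lra|].
  exists (C * exp (/ 2)); split; [apply Rmult_le_pos; auto; apply Rlt_le, exp_pos|].
  intros x Hx. eapply Rle_trans; [apply H; lra|].
  rewrite Rmult_assoc, <- exp_plus. right; do 2 f_equal; field.
Qed.

Lemma exp_INR_mult (a : R) (m : nat) : exp (INR m * a) = exp a ^ m.
Proof.
  induction m as [|m IH]; [simpl INR; rewrite Rmult_0_l, exp_0; reflexivity|].
  rewrite S_INR, Rmult_plus_distr_r, exp_plus, IH, Rmult_1_l. simpl; ring.
Qed.

Lemma expdecay_lim (f : R -> R) : expdecay f -> is_lim_seq (fun m => f (INR m)) 0.
Proof.
  intros (C & c & HC & H). destruct (pow1_le_exp c) as (D & HD & K).
  apply is_lim_seq_abs_0.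
  (* Half of the exponential absorbs the polynomial factor; along the integers the other half is a
     geometric sequence. *)
  apply (is_lim_seq_le_le (fun _ => 0) _ (fun m => C * D * exp (- / 2) ^ m)).
  - intros m; split; [apply Rabs_pos|]. assert (P := pos_INR m).
    eapply Rle_trans; [now apply H|]. rewrite <- exp_INR_mult.
    replace (exp (INR m * - / 2)) with (exp (INR m / 2) * exp (- INR m)).
    + assert (Q := exp_pos (- INR m)). specialize (K _ P).
      replace (C * D * (exp (INR m / 2) * exp (- INR m)))
        with (C * (D * exp (INR m / 2)) * exp (- INR m)) by ring.
      apply Rmult_le_compat_r; [lra|]. now apply Rmult_le_compat_l.
    + rewrite <- exp_plus. f_equal. field.
  - apply is_lim_seq_const.
  - replace (Finite 0) with (Rbar_mult (C * D) 0) by (simpl; f_equal; ring).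
    apply is_lim_seq_scal_l, is_lim_seq_geom.
    rewrite Rabs_right by (apply Rle_ge, Rlt_le, exp_pos).
    rewrite <- exp_0. apply exp_increasing. lra.
Qed.

(** * The truncated sums over compositions *)

(** At level 0 there is no summation index left and the value is 1 or 0 according to whether [k] is
    0. At higher levels the exponentials that would grow have zero coefficients. *)
Definition Phi (N i k : nat) (x : R) : R :=
  match i with
  | O => hinner 0 k 0
  | S i' => isum 1 N (fun n =>
      2 ^ S i' * (-1) ^ n * hcoef i' k n * exp (- ((2 * INR n - INR (S i')) * x)))
  end.

(* The error made in [Phi_(i+1,k)' = - Phi_(i+1,k-1) + y' Phi_(i,k)] by truncating at [N]. *)
Definition PhiRem (N i k : nat) (x : R) : R :=
  2 ^ S i * (-1) ^ N * exp (INR (S i) * x) * exp (-2 * x) ^ S N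
    / (1 + exp (-2 * x)) * hinner i k (S N).

(** Abel summation: the factor 1 + w produces the differences of [hinner] in [n], which are single
    values of [hcoef] one level down; at level 0 the sequence is constant and the sum is
    geometric. *)
Lemma alt_sum_hinner (w : R) (N i k : nat) :
  (1 + w) * isum 1 N (fun n => (-1) ^ n * w ^ n * hinner i k n)
  = (-1) ^ N * w ^ S N * hinner i k (S N)
    - w * match i with
          | O => hinner 0 k 0
          | S i' => isum 1 N (fun n => (-1) ^ n * w ^ n * hcoef i' k n)
          end.
Proof.
  induction N as [|N IH].
  - rewrite isum1_0. destruct i as [|i]; [simpl; ring|].
    rewrite isum1_0, hinner_S, isum1_0. simpl; ring.
  - rewrite isum1_S, Rmult_plus_distr_l, IH. destruct i as [|i].
    + change (hinner 0 k (S N)) with (hinner 0 k 0). change (hinner 0 k (S (S N))) with (hinner 0 k 0).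
      simpl; ring.
    + rewrite isum1_S. rewrite (hinner_S i k (S (S N))), isum_pred_S by lia.
      rewrite <- hinner_S. simpl; ring.
Qed.

Lemma exp_shift (i n : nat) (x : R) :
  exp (- ((2 * INR n - INR i) * x)) = exp (INR i * x) * exp (-2 * x) ^ n.
Proof. rewrite <- exp_INR_mult, <- exp_plus. f_equal. ring. Qed.

Lemma is_derive_Phi (N i k : nat) (x : R) :
  is_derive (Phi N (S i) k) x
    (- prev (fun k => Phi N (S i) k x) k + ss x * Phi N i k x - PhiRem N i k x).
Proof.
  set (w := exp (-2 * x)). assert (Hw : 0 < w) by apply exp_pos.
  set (E := exp (INR (S i) * x)).
  apply (is_derive_ext (fun x => lsum (fun n =>
      2 ^ S i * (-1) ^ n * hcoef i k n * exp (- ((2 * INR n - INR (S i)) * x))) (seq 1 N))).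
  { intros t. unfold Phi. now rewrite isum1E. }
  eapply is_derive_val.
  { apply (is_derive_lsum (fun n x =>
      2 ^ S i * (-1) ^ n * hcoef i k n * exp (- ((2 * INR n - INR (S i)) * x)))
      (fun n => 2 ^ S i * (-1) ^ n * hcoef i k n *
         (- (2 * INR n - INR (S i)) * exp (- ((2 * INR n - INR (S i)) * x))))).
    intros n _. apply is_derive_scal.
    generalize (2 * INR n - INR (S i)) as l; intros l. auto_derive; [auto|ring]. }
  transitivity (- prev (fun k => Phi N (S i) k x) k
     - 2 ^ S i * E * isum 1 N (fun n => (-1) ^ n * w ^ n * hinner i k n)).
  - rewrite isum1E, <- lsum_scal.
    replace (prev (fun k => Phi N (S i) k x) k) with
      (lsum (fun n => 2 ^ S i * (-1) ^ n * (E * w ^ n) * prev (fun k => hcoef i k n) k) (seq 1 N)).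
    + replace (- lsum (fun n => 2 ^ S i * (-1) ^ n * (E * w ^ n) * prev (fun k => hcoef i k n) k) (seq 1 N))
        with (-1 * lsum (fun n => 2 ^ S i * (-1) ^ n * (E * w ^ n) * prev (fun k => hcoef i k n) k) (seq 1 N)) by ring.
      match goal with |- _ = ?a - ?b => replace (a - b) with (a + -1 * b) by ring end.
      rewrite <- !lsum_scal, <- lsum_plus. apply lsum_ext; intros n Hn.
      apply in_seq in Hn. rewrite exp_shift. fold w E.
      assert (Q : (2 * INR n - INR (S i)) * hcoef i k n = prev (fun k => hcoef i k n) k + hinner i k n).
      { destruct k as [|k]; simpl prev; [rewrite hcoef_scal_0 by lia; ring|].
        now rewrite hcoef_scal_S by lia. }
      (* The factor brought down by differentiation is the denominator l of [hcoef]; multiplying by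
         it lowers [k] by one and leaves an [hinner] term. *)
      transitivity (- (2 ^ S i * (-1) ^ n * (E * w ^ n)) * ((2 * INR n - INR (S i)) * hcoef i k n)); [ring|].
      rewrite Q. ring.
    + destruct k as [|k]; unfold prev.
      * apply lsum_zero; intros; ring.
      * unfold Phi. rewrite isum1E. apply lsum_ext; intros n _.
        rewrite exp_shift. fold w E. ring.
  (* Here w is the square of exp(-x): one factor lowers [E] to the exponential of level [i], the
     other combines with 2/(1 + w) into [ss x]. *)
  - assert (A := alt_sum_hinner w N i k).
    replace (isum 1 N (fun n => (-1) ^ n * w ^ n * hinner i k n)) with
      (((-1) ^ N * w ^ S N * hinner i k (S N)
    - w * match i with
          | O => hinner 0 k 0
          | S i' => isum 1 N (fun n => (-1) ^ n * w ^ n * hcoef i' k n)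
          end) / (1 + w)).
    2:{ rewrite <- A. field. lra. }
    assert (Ew : w = exp (- x) ^ 2).
    { unfold w. simpl. rewrite Rmult_1_r, <- exp_plus. f_equal; ring. }
    assert (EE : E * exp (- x) = exp (INR i * x)).
    { unfold E. rewrite <- exp_plus, S_INR. f_equal; ring. }
    unfold PhiRem. fold w E. unfold ss. rewrite <- Ew.
    replace (Phi N i k x) with (2 ^ i * (E * exp (- x)) *
      match i with
          | O => hinner 0 k 0
          | S i' => isum 1 N (fun n => (-1) ^ n * w ^ n * hcoef i' k n)
          end).
    + set (D := match i with O => _ | S _ => _ end).
      replace (w * D) with (exp (- x) ^ 2 * D) by (rewrite <- Ew; ring).
      change (2 ^ S i) with (2 * 2 ^ i). field. lra.
    + rewrite EE. destruct i as [|i].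
      * simpl Phi. simpl INR. rewrite Rmult_0_l, exp_0. simpl; ring.
      * unfold Phi. rewrite !isum1E, <- lsum_scal. apply lsum_ext; intros n _.
        rewrite exp_shift. fold w. ring.
Qed.

(** Weighting by divided powers of x makes the terms of lower [k] in the derivative of [Phi] cancel
    in pairs, so only the terms with [ss] and the remainders survive. *)
Definition Psi (N i k : nat) (x : R) : R :=
  lsum (fun j => ee j x * Phi N i (k - j) x) (seq 0 (S k)).

Definition PsiRem (N i k : nat) (x : R) : R :=
  lsum (fun j => ee j x * PhiRem N i (k - j) x) (seq 0 (S k)).

Lemma telescope_prev (e phi : nat -> R) (k m : nat) : (m <= k)%nat ->
  lsum (fun j => prev e j * phi (k - j)%nat - e j * prev phi (k - j)) (seq 0 (S m))
  = - e m * prev phi (k - m).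
Proof.
  induction m as [|m IH]; intros Hm.
  - simpl seq; rewrite lsum_cons, lsum_nil; simpl prev. ring.
  - rewrite lsum_seq_S, IH by lia. cbv beta.
    replace (k - m)%nat with (S (k - S m)) by lia.
    change (0 + S m)%nat with (S m). change (prev e (S m)) with (e m).
    change (prev phi (S ?n)) with (phi n). ring.
Qed.

Lemma is_derive_Psi (N i k : nat) (x : R) :
  is_derive (Psi N (S i) k) x (ss x * Psi N i k x - PsiRem N i k x).
Proof.
  unfold Psi at 1. eapply is_derive_val.
  { apply (is_derive_lsum (fun j x => ee j x * Phi N (S i) (k - j) x)
      (fun j => prev (fun j => ee j x) j * Phi N (S i) (k - j) x + ee j x *
         (- prev (fun k => Phi N (S i) k x) (k - j)
          + ss x * Phi N i (k - j) x - PhiRem N i (k - j) x))).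
    intros j _. apply (is_derive_mult (ee j) (Phi N (S i) (k - j)));
      [apply is_derive_ee|apply is_derive_Phi|intros; apply Rmult_comm]. }
  assert (T := telescope_prev (fun j => ee j x) (fun k => Phi N (S i) k x) k k (le_n k)).
  rewrite Nat.sub_diag in T. simpl (prev _ 0) in T. rewrite Rmult_0_r in T.
  transitivity (0 + (ss x * Psi N i k x + -1 * PsiRem N i k x)); [|ring].
  rewrite <- T. unfold Psi, PsiRem. rewrite <- !lsum_scal, <- !lsum_plus.
  apply lsum_ext; intros j _. ring.
Qed.

Lemma Psi_0 (N k : nat) (x : R) : Psi N 0 k x = ee k x.
Proof.
  unfold Psi. rewrite lsum_seq_S, lsum_zero.
  - simpl plus. rewrite Nat.sub_diag. simpl; ring.
  - intros j Hj; apply in_seq in Hj. unfold Phi.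
    destruct (k - j)%nat eqn:E; [lia|]. simpl; ring.
Qed.

Lemma Psi_at_0 (N i k : nat) :
  Psi N (S i) k 0 = isum 1 N (fun n => 2 ^ S i * (-1) ^ n * hcoef i k n).
Proof.
  unfold Psi. rewrite lsum_head.
  - rewrite ee_0_0, Nat.sub_0_r, Rmult_1_l. unfold Phi. rewrite !isum1E.
    apply lsum_ext; intros n _. rewrite Rmult_0_r, Ropp_0, exp_0; ring.
  - intros j. rewrite ee_S_0; ring.
Qed.

(** The same device in y: with alternating signs the products of [ss] and [Psi] cancel down to level
    0, where [Psi] is the bare divided power of x. *)
Definition Ptrunc (N r k : nat) (x : R) : R :=
  lsum (fun i => (-1) ^ i * (cc i x * Psi N (r - i) k x)) (seq 0 r).

Definition PtruncRem (N a k : nat) (x : R) : R :=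
  lsum (fun i => (-1) ^ i * (cc i x * PsiRem N (a - i) k x)) (seq 0 (S a)).

Lemma telescope_alt (c psi : nat -> R) (r m : nat) : (m <= r)%nat ->
  lsum (fun i => (-1) ^ i * (prev c i * psi (S r - i)%nat + c i * psi (r - i)%nat))
    (seq 0 (S m)) = (-1) ^ m * c m * psi (r - m)%nat.
Proof.
  induction m as [|m IH]; intros Hm.
  - simpl seq; rewrite lsum_cons, lsum_nil. simpl prev. ring.
  - rewrite lsum_seq_S, IH by lia. cbv beta. change (0 + S m)%nat with (S m).
    change (prev c (S m)) with (c m).
    change (S r - S m)%nat with (r - m)%nat. simpl pow. ring.
Qed.

Lemma is_derive_Ptrunc (N a k : nat) (x : R) :
  is_derive (Ptrunc N (S a) k) x ((-1) ^ a * (ss x * cc a x) * ee k x - PtruncRem N a k x).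
Proof.
  unfold Ptrunc. eapply is_derive_val.
  { apply (is_derive_lsum (fun i x => (-1) ^ i * (cc i x * Psi N (S a - i) k x))
      (fun i => (-1) ^ i * (ss x * prev (fun i => cc i x) i * Psi N (S a - i) k x
         + cc i x * (ss x * Psi N (a - i) k x - PsiRem N (a - i) k x)))).
    intros i Hi. apply in_seq in Hi. apply is_derive_scal.
    apply (is_derive_mult (cc i) (Psi N (S a - i) k));
      [apply is_derive_cc| |intros; apply Rmult_comm].
    replace (S a - i)%nat with (S (a - i)) by lia. apply is_derive_Psi. }
  assert (T := telescope_alt (fun i => cc i x) (fun i => Psi N i k x) a a (le_n a)).
  cbv beta in T. rewrite Nat.sub_diag, Psi_0 in T.
  transitivity (ss x * ((-1) ^ a * cc a x * ee k x) + -1 * PtruncRem N a k x); [|ring].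
  rewrite <- T. unfold PtruncRem. rewrite <- !lsum_scal, <- !lsum_plus.
  apply lsum_ext; intros j _. ring.
Qed.

Lemma Ptrunc_at_0 (N a k : nat) :
  Ptrunc N (S a) k 0 = isum 1 N (fun n => 2 ^ S a * (-1) ^ n * hcoef a k n).
Proof.
  unfold Ptrunc. rewrite lsum_head.
  - rewrite cc_0_0, Nat.sub_0_r, Psi_at_0. simpl; ring.
  - intros j. rewrite cc_S_0; ring.
Qed.

Lemma expdecay_Phi (N i k : nat) : expdecay (Phi N (S i) k).
Proof.
  apply (expdecay_le (fun x => lsum (fun n =>
     2 ^ S i * (-1) ^ n * hcoef i k n * exp (- ((2 * INR n - INR (S i)) * x))) (seq 1 N))).
  { intros x _. unfold Phi. rewrite isum1E. lra. }
  apply (expdecay_lsum (fun n x =>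
     2 ^ S i * (-1) ^ n * hcoef i k n * exp (- ((2 * INR n - INR (S i)) * x)))).
  (* For [n <= i] the exponential may grow but its coefficient is 0; otherwise its rate 2n - i - 1
     is at least n, hence at least 1. *)
  intros n Hn; apply in_seq in Hn. destruct (le_lt_dec n i) as [Hi|Hi].
  - apply (expdecay_le (fun _ => 0)); [|apply expdecay_0]. intros x _.
    rewrite hcoef_zero, Rmult_0_r, Rmult_0_l by lia. lra.
  - apply (expdecay_scal (2 ^ S i * (-1) ^ n * hcoef i k n)).
    apply (expdecay_le (fun x => exp (- x))); [|apply expdecay_exp]. intros x Hx.
    rewrite !Rabs_right by (apply Rle_ge, Rlt_le, exp_pos).
    apply le_INR in Hi. destruct Hn as [Hn _]. apply le_INR in Hn. simpl (INR 1) in Hn.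
    assert (K : - ((2 * INR n - INR (S i)) * x) <= - x) by nra.
    destruct K as [K|K]; [left; now apply exp_increasing|rewrite K; lra].
Qed.

Lemma expdecay_Ptrunc (N a k : nat) : expdecay (Ptrunc N (S a) k).
Proof.
  apply (expdecay_lsum (fun i x => (-1) ^ i * (cc i x * Psi N (S a - i) k x))).
  intros i Hi; apply in_seq in Hi. apply (expdecay_scal ((-1) ^ i)), expdecay_cc.
  replace (S a - i)%nat with (S (a - i)) by lia.
  apply (expdecay_lsum (fun j x => ee j x * Phi N (S (a - i)) (k - j) x)).
  intros j _. apply expdecay_ee, expdecay_Phi.
Qed.

Definition hinner_bound (a k n : nat) : R :=
  lsum (fun i => lsum (fun j => 2 ^ S (a - i) * Rabs (hinner (a - i) (k - j) n))
    (seq 0 (S k))) (seq 0 (S a)).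

Lemma polylog_hinner_bound (a k : nat) : polylog (hinner_bound a k).
Proof.
  apply (polylog_lsum (fun i n => lsum (fun j => 2 ^ S (a - i) * Rabs (hinner (a - i) (k - j) n))
    (seq 0 (S k)))). intros i _.
  apply (polylog_lsum (fun j n => 2 ^ S (a - i) * Rabs (hinner (a - i) (k - j) n))). intros j _.
  apply polylog_scal. eapply polylog_le; [|apply (polylog_hinner (a - i) (k - j))].
  intros; rewrite Rabs_Rabsolu; lra.
Qed.

(** The rate 2(N + 1) - (i + 1) is at least N + 2 as soon as i + 1 <= N. The unit beyond N + 1 is
    kept to pay for the polynomial factors in x. *)
Lemma PhiRem_le (N i k : nat) (x : R) : (S i <= N)%nat -> 0 <= x ->
  Rabs (PhiRem N i k x) <= 2 ^ S i * Rabs (hinner i k (S N)) * exp (- ((INR N + 2) * x)).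
Proof.
  intros Hi Hx. unfold PhiRem. set (w := exp (-2 * x)). assert (Hw : 0 < w) by apply exp_pos.
  replace (2 ^ S i * (-1) ^ N * exp (INR (S i) * x) * w ^ S N / (1 + w) * hinner i k (S N))
    with ((-1) ^ N * (2 ^ S i * hinner i k (S N)) * (exp (INR (S i) * x) * w ^ S N / (1 + w)))
    by (field; lra).
  rewrite !Rabs_mult, pow_1_abs, Rmult_1_l.
  rewrite (Rabs_right (2 ^ S i)) by (apply Rle_ge, pow_le; lra).
  apply Rmult_le_compat_l; [apply Rmult_le_pos; [apply pow_le; lra|apply Rabs_pos]|].
  unfold w. rewrite <- exp_shift. fold w.
  set (q := exp (- ((2 * INR (S N) - INR (S i)) * x))).
  assert (Hq : 0 < q) by apply exp_pos.
  rewrite Rabs_right by (apply Rle_ge, Rlt_le, Rdiv_lt_0_compat; lra).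
  apply Rle_trans with q.
  - apply (Rmult_le_reg_r (1 + w)); [lra|].
    unfold Rdiv; rewrite Rmult_assoc, Rinv_l by lra. nra.
  - unfold q. apply le_INR in Hi. rewrite (S_INR N).
    assert (K : - ((2 * (INR N + 1) - INR (S i)) * x) <= - ((INR N + 2) * x)) by nra.
    destruct K as [K|K]; [left; now apply exp_increasing|rewrite K; lra].
Qed.

Lemma PtruncRem_le (a k : nat) : exists C, 0 <= C /\ forall N x, (S a <= N)%nat -> 0 <= x ->
  Rabs (PtruncRem N a k x) <= C * hinner_bound a k (S N) * exp (- (INR (S N) * x)).
Proof.
  destruct (pow1_le_exp (a + k)) as (C & HC & H). exists C; split; auto.
  intros N x HN Hx. unfold PtruncRem, hinner_bound.
  eapply Rle_trans; [apply lsum_Rabs|].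
  rewrite <- lsum_scal, Rmult_comm, <- lsum_scal.
  apply lsum_le; intros i Hi; apply in_seq in Hi.
  rewrite Rabs_mult, pow_1_abs, Rmult_1_l, Rabs_mult.
  destruct (cc_bounds i x Hx) as [c0 c1]. rewrite (Rabs_right (cc i x)) by lra.
  unfold PsiRem. eapply Rle_trans; [apply Rmult_le_compat_l, lsum_Rabs; auto|].
  rewrite <- lsum_scal, <- lsum_scal, <- lsum_scal.
  apply lsum_le; intros j Hj; apply in_seq in Hj.
  destruct (ee_bounds j x Hx) as [e0 e1].
  rewrite Rabs_mult, (Rabs_right (ee j x)) by lra.
  assert (R1 := PhiRem_le N (a - i) (k - j) x ltac:(lia) Hx).
  set (h := 2 ^ S (a - i) * Rabs (hinner (a - i) (k - j) (S N))) in *.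
  assert (Hh : 0 <= h) by (apply Rmult_le_pos; [apply pow_le; lra|apply Rabs_pos]).
  (* The divided powers cost one factor exp(x), which lowers the decay rate from N + 2 to N + 1. *)
  assert (E1 : cc i x * ee j x <= C * exp x).
  { apply Rle_trans with ((1 + x) ^ i * (1 + x) ^ j); [apply Rmult_le_compat; auto|].
    rewrite <- pow_add. apply Rle_trans with ((1 + x) ^ (a + k)); [apply Rle_pow; [lra|lia]|].
    eapply Rle_trans; [now apply H|]. apply Rmult_le_compat_l; auto.
    destruct Hx as [Hx| <-]; [left; apply exp_increasing; lra|].
    right; f_equal; field. }
  assert (P := exp_pos (- ((INR N + 2) * x))).
  replace (exp (- (INR (S N) * x))) with (exp x * exp (- ((INR N + 2) * x))).
  2:{ rewrite <- exp_plus, S_INR. f_equal; ring. }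
  rewrite <- Rmult_assoc.
  apply Rle_trans with (C * exp x * (h * exp (- ((INR N + 2) * x)))).
  - apply Rmult_le_compat; auto; [nra|apply Rabs_pos].
  - right; ring.
Qed.

(** * The truncated expansion of the powers of the arctangent *)

Definition mexp (b : bool) (n : nat) : nat := if b then (2 * n - 2)%nat else (2 * n - 1)%nat.

(* [BN a N] truncates the expansion of [2 / (1 + u^2) * y^a / a!] in powers of [u], up to the
   sign [atan_sign a]; [AN a N] is its primitive. *)
Definition BN (a N : nat) (u : R) : R :=
  isum 1 N (fun n => 2 * (-1) ^ n * Defs.Tn n a * u ^ mexp (Nat.even a) n).

Definition AN (a N : nat) (u : R) : R :=
  isum 1 N (fun n => 2 * (-1) ^ n * Defs.Tn n a *
    (u ^ S (mexp (Nat.even a) n) / INR (S (mexp (Nat.even a) n)))).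

(** The signs run -, -, +, +. The first comes from (-1)^n starting at n = 1; a step from odd to even
    [a] moves the power u^(2n) to index n + 1, which flips the sign. *)
Fixpoint atan_sign (a : nat) : R :=
  match a with
  | O => -1
  | S a' => if Nat.even a' then atan_sign a' else - atan_sign a'
  end.

Fixpoint BN_bound (a N : nat) : R :=
  match a with
  | O => 2
  | S a' => 2 * BN_bound a' N + 2 * (Rabs (Defs.Tn N a) + Rabs (Defs.Tn (S N) a))
  end.

Lemma atan_sign_cases (a : nat) : atan_sign a = 1 \/ atan_sign a = -1.
Proof.
  induction a as [|a IH]; [right; reflexivity|]. simpl.
  destruct (Nat.even a), IH as [-> | ->]; [now left|now right|right|left]; ring.
Qed.

Lemma atan_sign_sqr (a : nat) : atan_sign a * atan_sign a = 1.
Proof. destruct (atan_sign_cases a) as [-> | ->]; ring. Qed.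

Lemma Rabs_atan_sign (a : nat) : Rabs (atan_sign a) = 1.
Proof. destruct (atan_sign_cases a) as [-> | ->]; [apply Rabs_R1|rewrite Rabs_left; lra]. Qed.

Lemma BN_bound_ge0 (a N : nat) : 0 <= BN_bound a N.
Proof.
  induction a as [|a IH]; [simpl; lra|].
  change (BN_bound (S a) N) with (2 * BN_bound a N + 2 * (Rabs (Defs.Tn N (S a)) + Rabs (Defs.Tn (S N) (S a)))).
  generalize (Rabs_pos (Defs.Tn N (S a))) (Rabs_pos (Defs.Tn (S N) (S a))); lra.
Qed.

Lemma polylog_BN_bound (a : nat) : polylog (BN_bound a).
Proof.
  induction a as [|a IH]; [apply (polylog_const 2)|].
  apply (polylog_ext (fun N => 2 * BN_bound a N + 2 * (Rabs (Defs.Tn N (S a)) + Rabs (Defs.Tn (S N) (S a)))));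
    [reflexivity|].
  assert (K : polylog (fun N => Rabs (Defs.Tn N (S a)))).
  { eapply polylog_le; [|apply (proj1 (Slow_Tn (S a)))]. intros; rewrite Rabs_Rabsolu; lra. }
  apply polylog_plus; apply polylog_scal; auto. apply polylog_plus; auto.
  now apply (polylog_shift (fun N => Rabs (Defs.Tn N (S a)))).
Qed.

Lemma Tn_even (n a : nat) : Nat.even a = true ->
  Defs.Tn n (S a) = isum 1 n (fun i => 2 / (2 * INR i - 1) * Defs.Tn i a).
Proof. intros E; simpl; now rewrite E. Qed.

Lemma Tn_odd (n a : nat) : Nat.even a = false ->
  Defs.Tn n (S a) = isum 1 (n - 1) (fun i => 2 / (2 * INR i) * Defs.Tn i a).
Proof. intros E; simpl; now rewrite E. Qed.

Lemma Sn_even (n a : nat) : Nat.even a = true ->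
  Defs.Sn n (S a) = isum 1 (n - 1) (fun i => 2 / (2 * INR i) * Defs.Sn i a).
Proof. intros E; simpl; now rewrite E. Qed.

Lemma Sn_odd (n a : nat) : Nat.even a = false ->
  Defs.Sn n (S a) = isum 1 n (fun i => 2 / (2 * INR i - 1) * Defs.Sn i a).
Proof. intros E; simpl; now rewrite E. Qed.

Lemma even_S (a : nat) : Nat.even (S a) = negb (Nat.even a).
Proof. rewrite Nat.even_succ, <- Nat.negb_even. reflexivity. Qed.

Lemma INR_2S (N : nat) : INR (S (2 * N)) = 2 * INR (S N) - 1.
Proof. rewrite (S_INR (2 * N)), mult_INR, (S_INR N). simpl; ring. Qed.

Lemma INR_2SS (N : nat) : INR (S (S (2 * N))) = 2 * INR (S N).
Proof. rewrite (S_INR (S (2 * N))), INR_2S; ring. Qed.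

Lemma BN_rec_0 (N : nat) (u : R) : (1 + u ^ 2) * BN 0 N u = -2 + 2 * (-1) ^ N * u ^ (2 * N).
Proof.
  unfold BN; simpl Nat.even. induction N as [|N IH]; [rewrite isum1_0; simpl; ring|].
  rewrite isum1_S, Rmult_plus_distr_l, IH. unfold mexp.
  replace (2 * S N - 2)%nat with (2 * N)%nat by lia.
  replace (2 * S N)%nat with (S (S (2 * N))) by lia. simpl Defs.Tn. simpl pow. ring.
Qed.

(** The factor 1 + u^2 turns the coefficients into differences of consecutive T-sums, and such a
    difference is a single summand, namely a coefficient of the primitive [AN]. *)
Lemma BN_rec_even (a N : nat) (u : R) : Nat.even a = true ->
  (1 + u ^ 2) * BN (S a) N u
  = 2 * AN a N u + 2 * (-1) ^ N * Defs.Tn N (S a) * u ^ S (2 * N).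
Proof.
  intros E. unfold BN, AN. rewrite even_S, E. simpl negb.
  induction N as [|N IH]; [rewrite (Tn_even 0 a E), !isum1_0; ring|].
  rewrite !isum1_S, !Rmult_plus_distr_l, IH. unfold mexp.
  replace (2 * S N - 2)%nat with (2 * N)%nat by lia.
  replace (2 * S N - 1)%nat with (S (2 * N)) by lia.
  replace (2 * S N)%nat with (S (S (2 * N))) by lia. rewrite INR_2S.
  assert (P : 1 <= INR (S N)) by (apply (le_INR 1); lia).
  rewrite (Tn_even (S N) a E), isum1_S, <- (Tn_even N a E).
  generalize (2 * N)%nat (Defs.Tn N (S a)) (Defs.Tn (S N) a); intros d x y.
  change (u ^ S (S (S d))) with (u * (u * (u ^ S d))).
  change ((-1) ^ S N) with (-1 * (-1) ^ N). field. lra.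
Qed.

(** Here the sum defining T at n + 1 stops at n, whence a shift of the index: the sign changes and
    the boundary coefficient sits at N + 1. *)
Lemma BN_rec_odd (a N : nat) (u : R) : Nat.even a = false ->
  (1 + u ^ 2) * BN (S a) N u
  = - 2 * AN a N u + 2 * (-1) ^ N * Defs.Tn (S N) (S a) * u ^ (2 * N).
Proof.
  intros E. unfold BN, AN. rewrite even_S, E. simpl negb.
  induction N as [|N IH]; [rewrite (Tn_odd 1 a E), !isum1_0; ring|].
  rewrite !isum1_S, !Rmult_plus_distr_l, IH. unfold mexp.
  replace (2 * S N - 2)%nat with (2 * N)%nat by lia.
  replace (2 * S N - 1)%nat with (S (2 * N)) by lia.
  replace (2 * S N)%nat with (S (S (2 * N))) by lia. rewrite INR_2SS.
  assert (P : 1 <= INR (S N)) by (apply (le_INR 1); lia).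
  rewrite (Tn_odd (S (S N)) a E), isum_pred_S, <- (Tn_odd (S N) a E) by lia.
  generalize (2 * N)%nat (Defs.Tn (S N) (S a)) (Defs.Tn (S N) a); intros d x y.
  change (u ^ S (S d)) with (u * (u * (u ^ d))).
  change ((-1) ^ S N) with (-1 * (-1) ^ N). field. lra.
Qed.

Lemma is_derive_pow_uu (n : nat) (x : R) :
  is_derive (fun x => uu x ^ S n / INR (S n)) x (uu x ^ n * ((1 - uu x ^ 2) / 2)).
Proof.
  apply (is_derive_ext (fun x => / INR (S n) * uu x ^ S n)).
  { intros t; eqR; unfold Rdiv; ring. }
  eapply is_derive_val.
  - apply (is_derive_scal (fun y => uu y ^ S n)), is_derive_pow, is_derive_uu.
  - simpl pred. assert (Q : 0 < INR (S n)) by (apply lt_0_INR; lia). field. lra.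
Qed.

Lemma is_derive_AN (a N : nat) (x : R) :
  is_derive (fun x => AN a N (uu x)) x (BN a N (uu x) * ((1 - uu x ^ 2) / 2)).
Proof.
  apply (is_derive_ext (fun x => lsum (fun n => 2 * (-1) ^ n * Defs.Tn n a *
    (uu x ^ S (mexp (Nat.even a) n) / INR (S (mexp (Nat.even a) n)))) (seq 1 N))).
  { intros t; unfold AN; now rewrite isum1E. }
  eapply is_derive_val.
  - apply (is_derive_lsum (fun n x => 2 * (-1) ^ n * Defs.Tn n a *
      (uu x ^ S (mexp (Nat.even a) n) / INR (S (mexp (Nat.even a) n))))
      (fun n => 2 * (-1) ^ n * Defs.Tn n a *
        (uu x ^ mexp (Nat.even a) n * ((1 - uu x ^ 2) / 2)))).
    intros n _. apply is_derive_scal, is_derive_pow_uu.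
  - unfold BN. rewrite isum1E, Rmult_comm, <- lsum_scal.
    apply lsum_ext; intros; ring.
Qed.

Lemma AN_0 (a N : nat) : AN a N 0 = 0.
Proof.
  unfold AN; rewrite isum1E; apply lsum_zero; intros n _.
  rewrite pow_i by lia. unfold Rdiv; ring.
Qed.

Lemma Rabs_div_1plus (u y z : R) :
  Rabs (y - 2 / (1 + u ^ 2) * z) <= Rabs ((1 + u ^ 2) * y - 2 * z).
Proof.
  assert (P : 1 <= 1 + u ^ 2) by (generalize (pow2_ge_0 u); lra).
  replace ((1 + u ^ 2) * y - 2 * z) with ((1 + u ^ 2) * (y - 2 / (1 + u ^ 2) * z))
    by (field; lra).
  rewrite Rabs_mult, (Rabs_right (1 + u ^ 2)) by lra.
  generalize (Rabs_pos (y - 2 / (1 + u ^ 2) * z)); nra.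
Qed.

(** Induction on [a] follows y^(a+1)/(a+1)! as a primitive: the error u^(2N) integrates to
    u^(2N+1)/(2N+1), which is again at most u^(2N), and division by 1 + u^2 does not enlarge it. *)
Lemma BN_err (a N : nat) : forall x, 0 <= x ->
  Rabs (BN a N (uu x) - 2 / (1 + uu x ^ 2) * (atan_sign a * cc a x)) <= BN_bound a N * uu x ^ (2 * N).
Proof.
  induction a as [|a IH]; intros x Hx; destruct (uu_bounds x Hx) as [u0 u1];
    assert (Pu : forall n, 0 <= uu x ^ n) by (intros; now apply pow_le).
  - eapply Rle_trans; [apply Rabs_div_1plus|]. rewrite BN_rec_0.
    replace (-2 + 2 * (-1) ^ N * uu x ^ (2 * N) - 2 * (atan_sign 0 * cc 0 x))
      with (2 * ((-1) ^ N * uu x ^ (2 * N))) by (unfold cc; simpl; field).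
    rewrite !Rabs_mult, pow_1_abs, (Rabs_right 2), (Rabs_right (uu x ^ _)) by (try apply Rle_ge; auto; lra).
    simpl BN_bound. lra.
  - assert (AE : Rabs (AN a N (uu x) - atan_sign a * cc (S a) x) <= BN_bound a N * uu x ^ (2 * N)).
    { replace (AN a N (uu x) - atan_sign a * cc (S a) x)
        with ((AN a N (uu x) - atan_sign a * cc (S a) x) - (AN a N (uu 0) - atan_sign a * cc (S a) 0))
        by (rewrite uu_0, AN_0, cc_S_0; ring).
      apply Rle_trans with (BN_bound a N * (uu x ^ S (2 * N) / INR (S (2 * N)))
          - BN_bound a N * (uu 0 ^ S (2 * N) / INR (S (2 * N)))).
      - apply (derive_abs_le (fun x => AN a N (uu x) - atan_sign a * cc (S a) x)
          (fun x => BN_bound a N * (uu x ^ S (2 * N) / INR (S (2 * N))))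
          (fun x => (BN a N (uu x) - 2 / (1 + uu x ^ 2) * (atan_sign a * cc a x)) * ((1 - uu x ^ 2) / 2))
          (fun x => BN_bound a N * (uu x ^ (2 * N) * ((1 - uu x ^ 2) / 2)))); auto.
        + intros y. eapply is_derive_val.
          * apply (is_derive_minus (V := R_NormedModule) (fun x => AN a N (uu x))
              (fun x => atan_sign a * cc (S a) x)); [apply is_derive_AN|].
            apply is_derive_scal, is_derive_cc.
          * change (minus ?a ?b) with (a - b). simpl prev. rewrite ss_uu.
            field. generalize (pow2_ge_0 (uu y)); lra.
        + intros y. apply is_derive_scal, is_derive_pow_uu.
        + intros y Hy. destruct (uu_bounds y Hy) as [v0 v1].
          assert (Q : 0 <= (1 - uu y ^ 2) / 2) by nra.
          rewrite Rabs_mult, (Rabs_right ((1 - uu y ^ 2) / 2)), <- (Rmult_assoc (BN_bound a N)) by lra.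
          apply Rmult_le_compat_r; auto.
      - rewrite uu_0, pow_i by lia.
        assert (Q : 1 <= INR (S (2 * N))) by (apply (le_INR 1); lia).
        replace (BN_bound a N * (0 / INR (S (2 * N)))) with 0 by (field; lra).
        rewrite Rminus_0_r. apply Rmult_le_compat_l; [apply BN_bound_ge0|].
        apply (Rmult_le_reg_r (INR (S (2 * N)))); [lra|].
        unfold Rdiv; rewrite Rmult_assoc, Rinv_l by lra.
        change (uu x ^ S (2 * N)) with (uu x * uu x ^ (2 * N)). specialize (Pu (2 * N)%nat). nra. }
    eapply Rle_trans; [apply Rabs_div_1plus|].
    change (BN_bound (S a) N) with (2 * BN_bound a N + 2 * (Rabs (Defs.Tn N (S a)) + Rabs (Defs.Tn (S N) (S a)))).
    assert (T1 := Rabs_pos (Defs.Tn N (S a))). assert (T2 := Rabs_pos (Defs.Tn (S N) (S a))).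
    (* A single estimate for both parities: [s] is the sign in front of the primitive, [T] and [r]
       the boundary coefficient and its power of u. *)
    assert (G : forall s T r, Rabs s = 1 -> 0 <= r <= uu x ^ (2 * N) ->
       Rabs T <= Rabs (Defs.Tn N (S a)) + Rabs (Defs.Tn (S N) (S a)) ->
       Rabs (2 * s * (AN a N (uu x) - atan_sign a * cc (S a) x) + 2 * (-1) ^ N * T * r)
       <= (2 * BN_bound a N + 2 * (Rabs (Defs.Tn N (S a)) + Rabs (Defs.Tn (S N) (S a)))) * uu x ^ (2 * N)).
    { intros s T r Hs Hr HT. eapply Rle_trans; [apply Rabs_triang|].
      rewrite !Rabs_mult, Hs, pow_1_abs, (Rabs_right 2), (Rabs_right r) by lra.
      rewrite Rmult_plus_distr_r. apply Rplus_le_compat; [lra|].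
      assert (H1 := Rabs_pos T).
      assert (Rabs T * r <= (Rabs (Defs.Tn N (S a)) + Rabs (Defs.Tn (S N) (S a))) * uu x ^ (2 * N))
        by (apply Rmult_le_compat; lra). lra. }
    change (atan_sign (S a)) with (if Nat.even a then atan_sign a else - atan_sign a).
    destruct (Nat.even a) eqn:E.
    + rewrite BN_rec_even by auto.
      replace (2 * AN a N (uu x) + 2 * (-1) ^ N * Defs.Tn N (S a) * uu x ^ S (2 * N) - 2 * (atan_sign a * cc (S a) x))
        with (2 * 1 * (AN a N (uu x) - atan_sign a * cc (S a) x) + 2 * (-1) ^ N * Defs.Tn N (S a) * uu x ^ S (2 * N)) by ring.
      apply G; [apply Rabs_R1| |lra].
      split; auto. change (uu x ^ S (2 * N)) with (uu x * uu x ^ (2 * N)).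
      specialize (Pu (2 * N)%nat). nra.
    + rewrite BN_rec_odd by auto.
      replace (-2 * AN a N (uu x) + 2 * (-1) ^ N * Defs.Tn (S N) (S a) * uu x ^ (2 * N) - 2 * (- atan_sign a * cc (S a) x))
        with (2 * (-1) * (AN a N (uu x) - atan_sign a * cc (S a) x) + 2 * (-1) ^ N * Defs.Tn (S N) (S a) * uu x ^ (2 * N)) by ring.
      apply G; [rewrite Rabs_left; lra| |lra].
      split; auto. lra.
Qed.

(** * Moments *)

(** After the substitution v = uu x this is the integral of v^e (2 artanh v)^k / k! from 0 to uu X;
    in the variable x the integrand stays smooth and the singularity at v = 1 moves to infinity. *)
Definition moment (e k : nat) (X : R) : R :=
  RInt (fun x => uu x ^ e * ((1 - uu x ^ 2) / 2) * ee k x) 0 X.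

(** The weight (1 - u)/2 equals exp(-x)/(1 + exp(-x)), so this is a truncated Fermi-Dirac integral
    for the alternating zeta value at k + 1. *)
Definition zmoment (k : nat) (X : R) : R := RInt (fun x => (1 - uu x) / 2 * ee k x) 0 X.

Lemma ex_derive_uu (x : R) : ex_derive uu x.
Proof. eexists; apply is_derive_uu. Qed.

Lemma ex_derive_ee (k : nat) (x : R) : ex_derive (ee k) x.
Proof. eexists; apply is_derive_ee. Qed.

Lemma is_derive_RInt_0 (f : R -> R) (x : R) : (forall y, ex_derive f y) ->
  is_derive (fun X => RInt f 0 X) x (f x).
Proof.
  intros H.
  assert (Hc : forall y, continuous f y)
    by (intros; now apply (ex_derive_continuous (K := R_AbsRing) (V := R_NormedModule))).
  apply (is_derive_RInt (V := R_NormedModule) f (fun X => RInt f 0 X) 0 x); [|apply Hc].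
  apply filter_forall; intros y. apply (RInt_correct (V := R_CompleteNormedModule)).
  apply (ex_RInt_continuous (V := R_CompleteNormedModule)); intros; apply Hc.
Qed.

Lemma is_derive_moment (e k : nat) (x : R) :
  is_derive (moment e k) x (uu x ^ e * ((1 - uu x ^ 2) / 2) * ee k x).
Proof.
  apply (is_derive_RInt_0 (fun x => uu x ^ e * ((1 - uu x ^ 2) / 2) * ee k x)).
  intros y. apply (ex_derive_mult (fun x => uu x ^ e * ((1 - uu x ^ 2) / 2)));
    [|apply ex_derive_ee].
  apply (ex_derive_mult (fun x => uu x ^ e)).
  - apply ex_derive_pow, ex_derive_uu.
  - assert (K := ex_derive_uu y). auto_derive; auto.
Qed.

Lemma is_derive_zmoment (k : nat) (x : R) : is_derive (zmoment k) x ((1 - uu x) / 2 * ee k x).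
Proof.
  apply (is_derive_RInt_0 (fun x => (1 - uu x) / 2 * ee k x)).
  intros y. apply (ex_derive_mult (fun x => (1 - uu x) / 2)); [|apply ex_derive_ee].
  assert (K := ex_derive_uu y). auto_derive; auto.
Qed.

Lemma moment_0 (e k : nat) : moment e k 0 = 0.
Proof. apply (RInt_point (V := R_CompleteNormedModule)). Qed.

Lemma zmoment_0 (k : nat) : zmoment k 0 = 0.
Proof. apply (RInt_point (V := R_CompleteNormedModule)). Qed.

Lemma moment_base (e : nat) (X : R) : 0 <= X -> moment e 0 X = uu X ^ S e / INR (S e).
Proof.
  intros HX. apply (derive_eq (moment e 0) (fun X => uu X ^ S e / INR (S e)) (fun x => uu x ^ e * ((1 - uu x ^ 2) / 2) * ee 0 x)
     (fun x => uu x ^ e * ((1 - uu x ^ 2) / 2))); auto.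
  - intros; apply is_derive_moment.
  - intros; apply is_derive_pow_uu.
  - intros; unfold ee; simpl; field.
  - rewrite moment_0, uu_0, pow_i by lia. unfold Rdiv; ring.
Qed.

Lemma geom_even (n : nat) (u : R) :
  isum 1 n (fun i => u ^ mexp true i) * (1 - u ^ 2) = 1 - u ^ (2 * n).
Proof.
  induction n as [|n IH]; [rewrite isum1_0; simpl; ring|].
  rewrite isum1_S, Rmult_plus_distr_r, IH. unfold mexp.
  replace (2 * S n - 2)%nat with (2 * n)%nat by lia.
  replace (2 * S n)%nat with (S (S (2 * n))) by lia. simpl pow. ring.
Qed.

Lemma geom_odd (n : nat) (u : R) :
  isum 1 n (fun i => u ^ mexp false i) * (1 - u ^ 2) = u - u ^ S (2 * n).
Proof.
  induction n as [|n IH]; [rewrite isum1_0; simpl; ring|].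
  rewrite isum1_S, Rmult_plus_distr_r, IH. unfold mexp.
  replace (2 * S n - 1)%nat with (S (2 * n)) by lia.
  replace (2 * S n)%nat with (S (S (2 * n))) by lia. simpl pow. ring.
Qed.

Lemma is_derive_isum_moment (b : bool) (n k : nat) (x : R) :
  is_derive (fun x => isum 1 n (fun i => moment (mexp b i) k x)) x
    (isum 1 n (fun i => uu x ^ mexp b i) * ((1 - uu x ^ 2) / 2) * ee k x).
Proof.
  apply (is_derive_ext (fun x => lsum (fun i => moment (mexp b i) k x) (seq 1 n))).
  { intros t; now rewrite isum1E. }
  eapply is_derive_val.
  - apply (is_derive_lsum (fun i x => moment (mexp b i) k x)
      (fun i => uu x ^ mexp b i * ((1 - uu x ^ 2) / 2) * ee k x)).
    intros; apply is_derive_moment.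
  - rewrite isum1E.
    transitivity ((((1 - uu x ^ 2) / 2) * ee k x) * lsum (fun i => uu x ^ mexp b i) (seq 1 n)); [|ring].
    rewrite <- lsum_scal. apply lsum_ext; intros; ring.
Qed.

Lemma is_derive_boundary (e k : nat) (x : R) :
  is_derive (fun x => (uu x ^ S e - 1) / INR (S e) * ee (S k) x) x
    (uu x ^ e * ((1 - uu x ^ 2) / 2) * ee (S k) x + (uu x ^ S e - 1) / INR (S e) * ee k x).
Proof.
  apply (is_derive_mult (fun x => (uu x ^ S e - 1) / INR (S e)) (ee (S k)));
    [|apply is_derive_ee|intros; apply Rmult_comm].
  apply (is_derive_ext (fun x => uu x ^ S e / INR (S e) - / INR (S e))).
  { intros; eqR; unfold Rdiv; ring. }
  eapply is_derive_val.
  - apply (is_derive_minus (V := R_NormedModule) (fun x => uu x ^ S e / INR (S e)));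
      [apply is_derive_pow_uu|apply is_derive_const].
  - change (minus ?a ?b) with (a - b). change (@zero _) with 0. ring.
Qed.

(* Integration by parts with the primitive [(u^(e+1) - 1) / (e+1)] of [u^e], which
   vanishes where [ee k] blows up. *)
Lemma moment_rec_even (n k : nat) (X : R) : (1 <= n)%nat -> 0 <= X ->
  moment (mexp false n) (S k) X = (uu X ^ S (mexp false n) - 1) / INR (S (mexp false n)) * ee (S k) X
    + / INR n * isum 1 n (fun i => moment (mexp true i) k X).
Proof.
  intros Hn HX. apply (derive_eq (moment (mexp false n) (S k)) (fun X => (uu X ^ S (mexp false n) - 1) / INR (S (mexp false n)) * ee (S k) X
    + / INR n * isum 1 n (fun i => moment (mexp true i) k X))
    (fun x => uu x ^ (mexp false n) * ((1 - uu x ^ 2) / 2) * ee (S k) x)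
    (fun x => uu x ^ (mexp false n) * ((1 - uu x ^ 2) / 2) * ee (S k) x
      + (uu x ^ S (mexp false n) - 1) / INR (S (mexp false n)) * ee k x
      + / INR n * (isum 1 n (fun i => uu x ^ mexp true i) * ((1 - uu x ^ 2) / 2) * ee k x))); auto.
  - intros; apply is_derive_moment.
  - intros x. apply (is_derive_plus (V := R_NormedModule)
      (fun X => (uu X ^ S (mexp false n) - 1) / INR (S (mexp false n)) * ee (S k) X)
      (fun X => / INR n * isum 1 n (fun i => moment (mexp true i) k X))).
    + apply is_derive_boundary.
    + apply (is_derive_scal (fun X => isum 1 n (fun i => moment (mexp true i) k X))), is_derive_isum_moment.
  - intros x. assert (G := geom_even n (uu x)).
    replace (isum 1 n (fun i => uu x ^ mexp true i) * ((1 - uu x ^ 2) / 2))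
      with ((1 - uu x ^ (2 * n)) / 2) by (rewrite <- G; field).
    unfold mexp. replace (S (2 * n - 1)) with (2 * n)%nat by lia.
    assert (P : 1 <= INR n) by (apply (le_INR 1); lia).
    rewrite mult_INR. simpl (INR 2). field. lra.
  - rewrite moment_0, ee_S_0, isum1E, lsum_zero; [ring|]. intros; apply moment_0.
Qed.

(** Unlike 1 - u^(2n), the polynomial 1 - u^(2n-1) is not divisible by 1 - u^2. Splitting off 1 - u
    leaves a multiple of 1 - u^2, and the part split off is the source of the alternating zeta
    values. *)
Lemma moment_rec_odd (n k : nat) (X : R) : (1 <= n)%nat -> 0 <= X ->
  moment (mexp true n) (S k) X = (uu X ^ S (mexp true n) - 1) / INR (S (mexp true n)) * ee (S k) X
    + 2 / (2 * INR n - 1) * (zmoment k X + isum 1 (n - 1) (fun i => moment (mexp false i) k X)).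
Proof.
  intros Hn HX. apply (derive_eq (moment (mexp true n) (S k)) (fun X => (uu X ^ S (mexp true n) - 1) / INR (S (mexp true n)) * ee (S k) X
    + 2 / (2 * INR n - 1) * (zmoment k X + isum 1 (n - 1) (fun i => moment (mexp false i) k X)))
    (fun x => uu x ^ (mexp true n) * ((1 - uu x ^ 2) / 2) * ee (S k) x)
    (fun x => uu x ^ (mexp true n) * ((1 - uu x ^ 2) / 2) * ee (S k) x
      + (uu x ^ S (mexp true n) - 1) / INR (S (mexp true n)) * ee k x
      + 2 / (2 * INR n - 1) * ((1 - uu x) / 2 * ee k x +
          isum 1 (n - 1) (fun i => uu x ^ mexp false i) * ((1 - uu x ^ 2) / 2) * ee k x))); auto.
  - intros; apply is_derive_moment.
  - intros x. apply (is_derive_plus (V := R_NormedModule)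
      (fun X => (uu X ^ S (mexp true n) - 1) / INR (S (mexp true n)) * ee (S k) X)
      (fun X => 2 / (2 * INR n - 1) * (zmoment k X + isum 1 (n - 1) (fun i => moment (mexp false i) k X)))).
    + apply is_derive_boundary.
    + apply (is_derive_scal (fun X => zmoment k X + isum 1 (n - 1) (fun i => moment (mexp false i) k X))).
      apply (is_derive_plus (V := R_NormedModule) (zmoment k)
        (fun X => isum 1 (n - 1) (fun i => moment (mexp false i) k X)));
        [apply is_derive_zmoment|apply is_derive_isum_moment].
  - intros x. assert (G := geom_odd (n - 1) (uu x)).
    replace (isum 1 (n - 1) (fun i => uu x ^ mexp false i) * ((1 - uu x ^ 2) / 2))
      with ((uu x - uu x ^ S (2 * (n - 1))) / 2) by (rewrite <- G; field).
    unfold mexp. replace (2 * n - 2)%nat with (2 * (n - 1))%nat by lia.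
    rewrite INR_2S. replace (S (n - 1)) with n by lia.
    assert (P : 1 <= INR n) by (apply (le_INR 1); lia). field. lra.
  - rewrite moment_0, zmoment_0, ee_S_0, isum1E, lsum_zero; [ring|]. intros; apply moment_0.
Qed.

(** * Limits of the moments as X tends to infinity *)

(** Bernoulli's inequality gives 1 - u^e <= e (1 - u), and 1 - u <= 2 exp(-x). This makes the
    boundary terms of the integrations by parts vanish at infinity. *)
Lemma expdecay_uu_pow (e : nat) : expdecay (fun x => uu x ^ e - 1).
Proof.
  apply (expdecay_le (fun x => (INR e * 2) * exp (- x))); [|apply expdecay_scal, expdecay_exp].
  intros x Hx. destruct (uu_bounds x Hx) as [u0 u1]. assert (P := exp_pos (- x)).
  rewrite (Rabs_right (INR e * 2 * exp (- x)))
    by (apply Rle_ge, Rmult_le_pos; [generalize (pos_INR e)|]; lra).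
  rewrite Rabs_left1; [|generalize (pow_incr (uu x) 1 e); rewrite pow1; lra].
  assert (U : 1 - uu x <= 2 * exp (- x)).
  { unfold uu. apply (Rmult_le_reg_r (1 + exp (- x))); [lra|].
    replace ((1 - (1 - exp (- x)) / (1 + exp (- x))) * (1 + exp (- x))) with (2 * exp (- x))
      by (field; lra). nra. }
  assert (B : 1 - uu x ^ e <= INR e * (1 - uu x)).
  { induction e as [|e IH]; [simpl; lra|]. rewrite S_INR. simpl pow.
    assert (Q : 0 <= uu x ^ e) by now apply pow_le.
    assert (Q1 : uu x ^ e <= 1) by (generalize (pow_incr (uu x) 1 e); rewrite pow1; lra). nra. }
  assert (Q := pos_INR e). nra.
Qed.

(* [exp_tail k n] is the integral of [ee k y * exp (- n y)] over [x < y < oo]. *)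
Fixpoint exp_tail (k n : nat) (x : R) : R :=
  match k with
  | O => ee 0 x * exp (- (INR n * x)) / INR n
  | S k' => ee k x * exp (- (INR n * x)) / INR n + exp_tail k' n x / INR n
  end.

Lemma is_derive_exp_tail (k n : nat) (x : R) : (1 <= n)%nat ->
  is_derive (exp_tail k n) x (- (ee k x * exp (- (INR n * x)))).
Proof.
  intros Hn. assert (P : 1 <= INR n) by (apply (le_INR 1); lia).
  assert (Q : forall k, is_derive (fun x => ee k x * exp (- (INR n * x)) / INR n) x
     (prev (fun k => ee k x) k * exp (- (INR n * x)) / INR n - ee k x * exp (- (INR n * x)))).
  { intros j. apply (is_derive_ext (fun x => / INR n * (ee j x * exp (- (INR n * x))))).
    { intros; eqR; unfold Rdiv; ring. }
    eapply is_derive_val.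
    - apply (is_derive_scal (fun x => ee j x * exp (- (INR n * x)))).
      apply (is_derive_mult (ee j) (fun x => exp (- (INR n * x))) x (prev (fun k => ee k x) j) (- INR n * exp (- (INR n * x))));
        [apply is_derive_ee| |intros; apply Rmult_comm].
      generalize (INR n) as c; intros c. auto_derive; auto; ring.
    - change (plus ?a ?b) with (a + b). change (mult ?a ?b) with (a * b). field. lra. }
  induction k as [|k IH].
  - eapply is_derive_val; [apply (Q 0%nat)|]. simpl prev. field; lra.
  - eapply is_derive_val.
    + apply (is_derive_plus (V := R_NormedModule)
        (fun x => ee (S k) x * exp (- (INR n * x)) / INR n) (fun x => exp_tail k n x / INR n)); [apply Q|].
      apply (is_derive_ext (fun x => / INR n * exp_tail k n x)); [intros; eqR; unfold Rdiv; ring|].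
      apply is_derive_scal, IH.
    + change (plus ?a ?b) with (a + b). simpl prev. field; lra.
Qed.

Lemma exp_tail_at_0 (k n : nat) : (1 <= n)%nat -> exp_tail k n 0 = / INR n ^ S k.
Proof.
  intros Hn. assert (P : 1 <= INR n) by (apply (le_INR 1); lia).
  induction k as [|k IH].
  - simpl exp_tail. rewrite ee_0_0, Rmult_0_r, Ropp_0, exp_0. simpl. field; lra.
  - change (exp_tail (S k) n 0) with (ee (S k) 0 * exp (- (INR n * 0)) / INR n + exp_tail k n 0 / INR n).
    rewrite IH, ee_S_0. change (INR n ^ S (S k)) with (INR n * INR n ^ S k).
    field. split; [|lra]. apply pow_nonzero; lra.
Qed.

Lemma exp_tail_ge0 (k n : nat) (x : R) : (1 <= n)%nat -> 0 <= x -> 0 <= exp_tail k n x.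
Proof.
  intros Hn Hx. assert (P : 1 <= INR n) by (apply (le_INR 1); lia).
  assert (Q : forall k, 0 <= ee k x * exp (- (INR n * x)) / INR n).
  { intros j. apply Rmult_le_pos; [|apply Rlt_le, Rinv_0_lt_compat; lra].
    apply Rmult_le_pos; [now apply ee_bounds|apply Rlt_le, exp_pos]. }
  induction k as [|k IH]; simpl exp_tail; [apply (Q 0%nat)|].
  apply Rplus_le_le_0_compat; [apply (Q (S k))|].
  apply Rmult_le_pos; auto. apply Rlt_le, Rinv_0_lt_compat; lra.
Qed.

Lemma expdecay_exp_tail (k n : nat) : (1 <= n)%nat -> expdecay (exp_tail k n).
Proof.
  intros Hn. assert (P : 1 <= INR n) by (apply (le_INR 1); lia).
  assert (Q : forall k, expdecay (fun x => ee k x * exp (- (INR n * x)) / INR n)).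
  { intros j. apply (expdecay_le (fun x => ee j x * exp (- x))); [|apply expdecay_ee, expdecay_exp].
    intros x Hx. unfold Rdiv. rewrite !Rabs_mult.
    rewrite !(Rabs_right (exp _)) by (apply Rle_ge, Rlt_le, exp_pos).
    rewrite (Rabs_right (/ _)) by (apply Rle_ge, Rlt_le, Rinv_0_lt_compat; lra).
    rewrite Rmult_assoc. apply Rmult_le_compat_l; [apply Rabs_pos|].
    assert (E : exp (- (INR n * x)) <= exp (- x)).
    { assert (K : - (INR n * x) <= - x) by nra.
      destruct K as [K|K]; [left; now apply exp_increasing|rewrite K; lra]. }
    assert (I : / INR n <= 1) by (rewrite <- Rinv_1; apply Rinv_le_contravar; lra).
    assert (I0 : 0 < / INR n) by (apply Rinv_0_lt_compat; lra).
    generalize (exp_pos (- (INR n * x))); nra. }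
  induction k as [|k IH]; [apply (Q 0%nat)|].
  apply (expdecay_plus (fun x => ee (S k) x * exp (- (INR n * x)) / INR n) (fun x => exp_tail k n x / INR n));
    [apply Q|].
  apply (expdecay_le (fun x => / INR n * exp_tail k n x)); [|now apply expdecay_scal].
  intros x _. right; f_equal; unfold Rdiv; ring.
Qed.

Lemma zbar_partial (k : nat) :
  is_lim_seq (fun N => isum 1 (S N) (fun n => (-1) ^ (n - 1) * / INR n ^ S k)) (zbar (S k)).
Proof.
  apply (is_lim_seq_ext (sum_n (fun n => (-1) ^ n / INR (S n) ^ S k))).
  { intros N. rewrite <- (sum_n_isum1 (fun n => (-1) ^ (n - 1) * / INR n ^ S k)).
    apply sum_n_ext; intros n. now replace (S n - 1)%nat with n by lia. }
  change (is_series (fun n => (-1) ^ n / INR (S n) ^ S k)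
    (Series (fun n => (-1) ^ n / INR (S n) ^ S k))).
  apply Series_correct.
  set (v := fun n => / (2 * INR n - 0)).
  assert (Sv : Slow1 v) by (apply Slow1_inv; lra).
  apply (ex_series_ext (fun n => (-1) ^ S n * ((- 2 ^ S k * v (S n) ^ k) * v (S n)))).
  { intros n. unfold v. assert (P : 0 < INR (S n)) by (apply lt_0_INR; lia).
    change ((-1) ^ S n) with (-1 * (-1) ^ n). rewrite pow_inv, Rminus_0_r, Rpow_mult_distr.
    change (INR (S n) ^ S k) with (INR (S n) * INR (S n) ^ k).
    change (2 ^ S k) with (2 * 2 ^ k). eqR. field.
    repeat split; try apply pow_nonzero; lra. }
  apply (ex_series_alt (fun n => (- 2 ^ S k * v n ^ k) * v n)).
  apply (Slow1_mult (fun n => - 2 ^ S k * v n ^ k)); auto.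
  apply (Slow_mult (fun _ => - 2 ^ S k)); [apply Slow_const|]. apply Slow_pow, Slow1_Slow, Sv.
Qed.

(** The bound [b N] is uniform in [m], so [N] is fixed first and [m] sent to infinity afterwards; no
    exchange of limits is needed. *)
Lemma is_lim_seq_approx (u s b : nat -> R) (v : nat -> nat -> R) (l : R) :
  (forall N m, Rabs (u m - (s N + v N m)) <= b N) ->
  (forall N, is_lim_seq (v N) 0) -> is_lim_seq s l -> is_lim_seq b 0 -> is_lim_seq u l.
Proof.
  intros H Hv Hs Hb. apply is_lim_seq_spec. intros e.
  assert (e3 : 0 < e / 3) by (destruct e; simpl; lra).
  apply is_lim_seq_spec in Hs. apply is_lim_seq_spec in Hb.
  destruct (Hs (mkposreal _ e3)) as [N1 K1]. destruct (Hb (mkposreal _ e3)) as [N2 K2].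
  set (N := max N1 N2). specialize (Hv N). apply is_lim_seq_spec in Hv.
  destruct (Hv (mkposreal _ e3)) as [M K3]. exists M; intros m Hm.
  specialize (K1 N ltac:(lia)). specialize (K2 N ltac:(lia)). specialize (K3 m Hm).
  specialize (H N m). simpl in K1, K2, K3.
  apply Rabs_lt_between in K1. apply Rabs_lt_between in K2. apply Rabs_lt_between in K3.
  apply Rabs_le_between in H. apply Rabs_lt_between. lra.
Qed.

Lemma alt_geom (t : R) (N : nat) :
  (1 + t) * isum 1 N (fun n => (-1) ^ (n - 1) * t ^ n) = t - (-1) ^ N * t ^ S N.
Proof.
  induction N as [|N IH]; [rewrite isum1_0; simpl; ring|].
  rewrite isum1_S, Rmult_plus_distr_l, IH. replace (S N - 1)%nat with N by lia. simpl; ring.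
Qed.

(** The geometric expansion of t/(1 + t) in t = exp(-x) errs by at most its first omitted term
    t^(N+1), whose integral over the half-line is 1/(N+1)^(k+1), whatever [X] is. *)
Lemma zmoment_err (k N : nat) (X : R) : 0 <= X ->
  Rabs (zmoment k X - (isum 1 N (fun n => (-1) ^ (n - 1) * / INR n ^ S k)
    + -1 * lsum (fun n => (-1) ^ (n - 1) * exp_tail k n X) (seq 1 N))) <= / INR (S N) ^ S k.
Proof.
  intros HX.
  apply Rle_trans with (- exp_tail k (S N) X - - exp_tail k (S N) 0).
  2:{ rewrite exp_tail_at_0 by lia. generalize (exp_tail_ge0 k (S N) X ltac:(lia) HX). lra. }
  (* The partial zeta sum consists of the values of [exp_tail] at 0, so the whole difference is an
     increment from 0 to [X]. *)
  replace (zmoment k X - _) with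
    ((zmoment k X + lsum (fun n => (-1) ^ (n - 1) * exp_tail k n X) (seq 1 N))
     - (zmoment k 0 + lsum (fun n => (-1) ^ (n - 1) * exp_tail k n 0) (seq 1 N))).
  2:{ rewrite zmoment_0, isum1E.
      replace (lsum (fun n => (-1) ^ (n - 1) * exp_tail k n 0) (seq 1 N))
        with (lsum (fun n => (-1) ^ (n - 1) * / INR n ^ S k) (seq 1 N)); [ring|].
      apply lsum_ext; intros n Hn; apply in_seq in Hn. now rewrite exp_tail_at_0 by lia. }
  apply (derive_abs_le (fun X => zmoment k X + lsum (fun n => (-1) ^ (n - 1) * exp_tail k n X) (seq 1 N))
    (fun X => - exp_tail k (S N) X)
    (fun x => (1 - uu x) / 2 * ee k x
       + lsum (fun n => (-1) ^ (n - 1) * - (ee k x * exp (- (INR n * x)))) (seq 1 N))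
    (fun x => ee k x * exp (- (INR (S N) * x)))); auto.
  - intros x. apply (is_derive_plus (V := R_NormedModule) (zmoment k)
      (fun X => lsum (fun n => (-1) ^ (n - 1) * exp_tail k n X) (seq 1 N))); [apply is_derive_zmoment|].
    apply (is_derive_lsum (fun n X => (-1) ^ (n - 1) * exp_tail k n X)).
    intros n Hn; apply in_seq in Hn. apply is_derive_scal, is_derive_exp_tail; lia.
  - intros x. eapply is_derive_val.
    + apply (is_derive_opp (V := R_NormedModule) (exp_tail k (S N))), is_derive_exp_tail; lia.
    + change (opp ?a) with (- a). ring.
  - intros x Hx. assert (P := exp_pos (- x)). set (t := exp (- x)) in *.
    destruct (ee_bounds k x Hx) as [e0 _].
    assert (Et : forall n, exp (- (INR n * x)) = t ^ n).
    { intros n. unfold t. rewrite <- exp_INR_mult. f_equal; ring. }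
    rewrite Et.
    replace (lsum (fun n => (-1) ^ (n - 1) * - (ee k x * exp (- (INR n * x)))) (seq 1 N))
      with (- ee k x * isum 1 N (fun n => (-1) ^ (n - 1) * t ^ n)).
    2:{ rewrite isum1E, <- lsum_scal. apply lsum_ext; intros n _. rewrite Et; ring. }
    replace (isum 1 N (fun n => (-1) ^ (n - 1) * t ^ n))
      with ((t - (-1) ^ N * t ^ S N) / (1 + t)) by (rewrite <- alt_geom; field; lra).
    replace ((1 - uu x) / 2) with (t / (1 + t)) by (unfold uu; fold t; field; lra).
    replace (t / (1 + t) * ee k x + - ee k x * ((t - (-1) ^ N * t ^ S N) / (1 + t)))
      with ((-1) ^ N * (ee k x * t ^ S N * / (1 + t))) by (field; lra).
    assert (Q : 0 <= t ^ S N) by (apply pow_le; lra).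
    assert (I0 : 0 < / (1 + t)) by (apply Rinv_0_lt_compat; lra).
    assert (I1 : / (1 + t) <= 1) by (rewrite <- Rinv_1; apply Rinv_le_contravar; lra).
    assert (Q1 : 0 <= ee k x * t ^ S N) by now apply Rmult_le_pos.
    rewrite Rabs_mult, pow_1_abs, Rmult_1_l, Rabs_right by nra. nra.
Qed.

Lemma zmoment_lim (k : nat) : is_lim_seq (fun m => zmoment k (INR m)) (zbar (S k)).
Proof.
  apply (is_lim_seq_approx _ (fun N => isum 1 (S N) (fun n => (-1) ^ (n - 1) * / INR n ^ S k))
    (fun N => / INR (S (S N)) ^ S k)
    (fun N m => -1 * lsum (fun n => (-1) ^ (n - 1) * exp_tail k n (INR m)) (seq 1 (S N)))).
  - intros N m. apply zmoment_err, pos_INR.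
  - intros N. apply (expdecay_lim (fun x => -1 * lsum (fun n => (-1) ^ (n - 1) * exp_tail k n x) (seq 1 (S N)))).
    apply expdecay_scal. apply (expdecay_lsum (fun n x => (-1) ^ (n - 1) * exp_tail k n x)).
    intros n Hn; apply in_seq in Hn. apply expdecay_scal, expdecay_exp_tail; lia.
  - apply zbar_partial.
  - apply (is_lim_seq_incr_1 (fun N => / INR (S N) ^ S k)).
    apply (polylog_lim0 (fun N => / INR N ^ S k)).
    apply (polylog_eventually _ 1 1); intros n Hn.
    assert (P : 1 <= INR n) by (apply (le_INR 1); lia).
    assert (Q : 1 <= INR n ^ k) by now apply pow_R1_Rle.
    change (INR n ^ S k) with (INR n * INR n ^ k).
    replace (INR n * / (INR n * INR n ^ k)) with (/ INR n ^ k) by (field; lra).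
    rewrite Rabs_right by (apply Rle_ge, Rlt_le, Rinv_0_lt_compat; lra).
    rewrite <- Rinv_1. apply Rinv_le_contravar; lra.
Qed.

(* [limit_moment true k n] and [limit_moment false k n] are the integrals over [0 < u < 1] of
   [(2 artanh u)^k / k!] against [u^(2n-2)] and [u^(2n-1)]. *)
Fixpoint limit_moment (b : bool) (k n : nat) : R :=
  match k with
  | O => / INR (S (mexp b n))
  | S k' => if b then 2 / (2 * INR n - 1) * (zbar k + isum 1 (n - 1) (limit_moment false k'))
            else / INR n * isum 1 n (limit_moment true k')
  end.

Lemma moment_lim (k : nat) : forall b n, (1 <= n)%nat ->
  is_lim_seq (fun m => moment (mexp b n) k (INR m)) (limit_moment b k n).
Proof.
  induction k as [|k IH]; intros b n Hn.
  - apply (is_lim_seq_ext (fun m => / INR (S (mexp b n)) * (uu (INR m) ^ S (mexp b n) - 1)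
      + / INR (S (mexp b n)))).
    { intros m. rewrite moment_base by apply pos_INR. unfold Rdiv; ring. }
    change (limit_moment b 0 n) with (/ INR (S (mexp b n))).
    replace (Finite (/ INR (S (mexp b n)))) with (Finite (0 + / INR (S (mexp b n)))) by (f_equal; ring).
    apply is_lim_seq_plus'; [|apply is_lim_seq_const].
    apply (expdecay_lim (fun x => / INR (S (mexp b n)) * (uu x ^ S (mexp b n) - 1))).
    apply expdecay_scal, expdecay_uu_pow.
  - assert (V : is_lim_seq (fun m => (uu (INR m) ^ S (mexp b n) - 1) / INR (S (mexp b n)) * ee (S k) (INR m)) 0).
    { apply (expdecay_lim (fun x => (uu x ^ S (mexp b n) - 1) / INR (S (mexp b n)) * ee (S k) x)).
      apply (expdecay_le (fun x => / INR (S (mexp b n)) * (ee (S k) x * (uu x ^ S (mexp b n) - 1)))).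
      - intros x _. right; f_equal; unfold Rdiv; ring.
      - apply expdecay_scal, expdecay_ee, expdecay_uu_pow. }
    assert (L : forall b' n', is_lim_seq (fun m => isum 1 n' (fun i => moment (mexp b' i) k (INR m)))
                 (isum 1 n' (limit_moment b' k))).
    { intros b' n'. rewrite isum1E.
      apply (is_lim_seq_ext (fun m => lsum (fun i => moment (mexp b' i) k (INR m)) (seq 1 n'))).
      { intros; now rewrite isum1E. }
      apply (is_lim_seq_lsum (fun i m => moment (mexp b' i) k (INR m))).
      intros i Hi; apply in_seq in Hi. apply IH; lia. }
    rewrite <- (Rplus_0_l (limit_moment b (S k) n)). destruct b.
    + apply (is_lim_seq_ext (fun m => (uu (INR m) ^ S (mexp true n) - 1) / INR (S (mexp true n)) * ee (S k) (INR m)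
        + 2 / (2 * INR n - 1) * (zmoment k (INR m) + isum 1 (n - 1) (fun i => moment (mexp false i) k (INR m))))).
      { intros m. now rewrite moment_rec_odd by (try apply pos_INR; lia). }
      apply is_lim_seq_plus'; auto.
      apply (is_lim_seq_mult' (fun _ => 2 / (2 * INR n - 1)) _ (2 / (2 * INR n - 1))); [apply is_lim_seq_const|].
      apply is_lim_seq_plus'; [apply zmoment_lim|apply L].
    + apply (is_lim_seq_ext (fun m => (uu (INR m) ^ S (mexp false n) - 1) / INR (S (mexp false n)) * ee (S k) (INR m)
        + / INR n * isum 1 n (fun i => moment (mexp true i) k (INR m)))).
      { intros m. now rewrite moment_rec_even by (try apply pos_INR; lia). }
      apply is_lim_seq_plus'; auto.
      apply (is_lim_seq_mult' (fun _ => / INR n) _ (/ INR n)); [apply is_lim_seq_const|apply L].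
Qed.

Lemma polylog_limit_moment (k : nat) : forall b, polylog (fun n => INR n * limit_moment b k n).
Proof.
  induction k as [|k IH]; intros b.
  - apply (polylog_eventually _ 1 1); intros n Hn. change (limit_moment b 0 n) with (/ INR (S (mexp b n))).
    assert (P : 1 <= INR n) by (apply (le_INR 1); lia).
    assert (Q : INR n <= INR (S (mexp b n))) by (apply le_INR; unfold mexp; destruct b; lia).
    rewrite Rabs_right.
    + apply (Rmult_le_reg_r (INR (S (mexp b n)))); [lra|]. rewrite Rmult_assoc, Rinv_l by lra. lra.
    + apply Rle_ge, Rmult_le_pos; [lra|]. apply Rlt_le, Rinv_0_lt_compat; lra.
  - destruct b.
    + apply (polylog_ext (fun n => (INR n * (2 / (2 * INR n - 1))) * (zbar (S k) + isum 1 (n - 1) (limit_moment false k)))).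
      { intros n; change (limit_moment true (S k) n) with
          (2 / (2 * INR n - 1) * (zbar (S k) + isum 1 (n - 1) (limit_moment false k))); ring. }
      apply polylog_mult; [apply (polylog_eventually _ 2 0); intros; apply INR_two_div_odd|].
      apply polylog_plus; [apply polylog_const|]. apply Slow_isum_pred, IH.
    + apply (polylog_le (fun n => isum 1 n (limit_moment true k))); [|apply polylog_isum, IH].
      intros n. change (limit_moment false (S k) n) with (/ INR n * isum 1 n (limit_moment true k)). destruct n as [|n]; [simpl INR; rewrite Rmult_0_l, Rabs_R0; apply Rabs_pos|].
      assert (P : 0 < INR (S n)) by (apply lt_0_INR; lia).
      right; f_equal; field; lra.
Qed.

(** * Comparison of the two truncations *)

(** [Ptrunc] and the truncated expansion integrated against the moments have, up to sign and error,
    the same derivative. At 0 only the partial sum for [W] is left, at infinity only the sum with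
    limit moments, so the two differ by the integrated errors. *)
Lemma partial_sums_close (a k : nat) : exists b : nat -> R, is_lim_seq b 0 /\
  forall N, (S a <= N)%nat ->
  Rabs (isum 1 N (fun n => 2 ^ S a * (-1) ^ n * hcoef a k n)
    + (-1) ^ a * atan_sign a * isum 1 N (fun n => 2 * (-1) ^ n * Defs.Tn n a * limit_moment (Nat.even a) k n))
  <= b N.
Proof.
  destruct (PtruncRem_le a k) as (C & HC & HR). set (sg := (-1) ^ a * atan_sign a).
  (* The first summand integrates the decay exp(-(N+1)x) of [PtruncRem], the second is the limit
     moment of the error u^(2N) in [BN]. *)
  exists (fun N => C * hinner_bound a k (S N) / INR (S N) + BN_bound a N * limit_moment true k (S N)). split.
  - replace (Finite 0) with (Finite (0 + 0)) by (f_equal; ring).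
    apply is_lim_seq_plus'.
    + apply (polylog_lim0 (fun n => C * hinner_bound a k n / INR n)).
      apply (polylog_le (fun n => C * hinner_bound a k n)); [|apply polylog_scal, polylog_hinner_bound].
      intros [|n]; [simpl INR; rewrite Rmult_0_l, Rabs_R0; apply Rabs_pos|].
      assert (P : 0 < INR (S n)) by (apply lt_0_INR; lia). right; f_equal; field; lra.
    + apply is_lim_seq_incr_1, (polylog_lim0 (fun n => BN_bound a n * limit_moment true k (S n))).
      apply (polylog_ext (fun n => BN_bound a n * (INR n * limit_moment true k (S n)))); [intros; ring|].
      apply polylog_mult; [apply polylog_BN_bound|].
      apply (polylog_le (fun n => INR (S n) * limit_moment true k (S n))).
      * intros n. rewrite !Rabs_mult. apply Rmult_le_compat_r; [apply Rabs_pos|].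
        rewrite !Rabs_right by (apply Rle_ge, pos_INR). apply le_INR; lia.
      * apply (polylog_shift (fun n => INR n * limit_moment true k n)), polylog_limit_moment.
  - intros N HN.
    set (GJ := fun X => lsum (fun n => 2 * (-1) ^ n * Defs.Tn n a * moment (mexp (Nat.even a) n) k X) (seq 1 N)).
    set (F := fun X => Ptrunc N (S a) k X - sg * GJ X).
    set (h := C * hinner_bound a k (S N)).
    assert (P : 0 < INR (S N)) by (apply lt_0_INR; lia).
    assert (Hh : 0 <= h).
    { apply Rmult_le_pos; auto. unfold hinner_bound.
      apply Rle_trans with (lsum (fun _ : nat => 0) (seq 0 (S a))); [right; symmetry; now apply lsum_zero|].
      apply lsum_le; intros i _.
      apply Rle_trans with (lsum (fun _ : nat => 0) (seq 0 (S k))); [right; symmetry; now apply lsum_zero|].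
      apply lsum_le; intros j _. apply Rmult_le_pos; [apply pow_le; lra|apply Rabs_pos]. }
    assert (Hsg : Rabs sg = 1).
    { unfold sg. rewrite Rabs_mult, pow_1_abs, Rabs_atan_sign; ring. }
    assert (D : forall X, 0 <= X -> Rabs (F X - F 0) <= h / INR (S N) + BN_bound a N * moment (2 * N) k X).
    { intros X HX.
      apply Rle_trans with ((- (h / INR (S N)) * exp (- (INR (S N) * X)) + BN_bound a N * moment (2 * N) k X)
        - (- (h / INR (S N)) * exp (- (INR (S N) * 0)) + BN_bound a N * moment (2 * N) k 0)).
      2:{ rewrite moment_0, Rmult_0_r, Ropp_0, exp_0.
          assert (Q : 0 <= h / INR (S N))
            by (apply Rmult_le_pos; auto; apply Rlt_le, Rinv_0_lt_compat; lra).
          generalize (exp_pos (- (INR (S N) * X))). nra. }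
      apply (derive_abs_le F
        (fun X => - (h / INR (S N)) * exp (- (INR (S N) * X)) + BN_bound a N * moment (2 * N) k X)
        (fun x => ((-1) ^ a * (ss x * cc a x) * ee k x - PtruncRem N a k x)
           - sg * (BN a N (uu x) * ((1 - uu x ^ 2) / 2) * ee k x))
        (fun x => h * exp (- (INR (S N) * x))
           + BN_bound a N * (uu x ^ (2 * N) * ((1 - uu x ^ 2) / 2) * ee k x))); auto.
      - intros x. apply (is_derive_minus (V := R_NormedModule) (Ptrunc N (S a) k) (fun X => sg * GJ X));
          [apply is_derive_Ptrunc|].
        apply is_derive_scal. unfold GJ. eapply is_derive_val.
        + apply (is_derive_lsum (fun n X => 2 * (-1) ^ n * Defs.Tn n a * moment (mexp (Nat.even a) n) k X)
            (fun n => 2 * (-1) ^ n * Defs.Tn n a *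
               (uu x ^ mexp (Nat.even a) n * ((1 - uu x ^ 2) / 2) * ee k x))).
          intros n _. apply is_derive_scal, is_derive_moment.
        + unfold BN. rewrite isum1E.
          transitivity ((((1 - uu x ^ 2) / 2) * ee k x) *
            lsum (fun n => 2 * (-1) ^ n * Defs.Tn n a * uu x ^ mexp (Nat.even a) n) (seq 1 N)); [|ring].
          rewrite <- lsum_scal. apply lsum_ext; intros; ring.
      - intros x. apply (is_derive_plus (V := R_NormedModule)
          (fun X => - (h / INR (S N)) * exp (- (INR (S N) * X))) (fun X => BN_bound a N * moment (2 * N) k X)).
        + revert P. generalize (INR (S N)) as c; intros c P.
          auto_derive; auto. field. lra.
        + apply is_derive_scal, is_derive_moment.
      - intros x Hx. destruct (uu_bounds x Hx) as [u0 u1]. destruct (ee_bounds k x Hx) as [e0 _].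
        assert (Q : 0 <= (1 - uu x ^ 2) / 2) by nra.
        replace ((-1) ^ a * (ss x * cc a x) * ee k x - PtruncRem N a k x
           - sg * (BN a N (uu x) * ((1 - uu x ^ 2) / 2) * ee k x))
          with (- PtruncRem N a k x + - (sg * ((BN a N (uu x) - 2 / (1 + uu x ^ 2) * (atan_sign a * cc a x))
             * ((1 - uu x ^ 2) / 2 * ee k x)))).
        (* [atan_sign a] squares to 1, so [sg * atan_sign a] is (-1)^a and the main terms cancel. *)
        2:{ rewrite ss_uu. unfold sg.
            replace ((-1) ^ a * (2 / (1 + uu x ^ 2) * ((1 - uu x ^ 2) / 2) * cc a x))
              with ((atan_sign a * atan_sign a) * ((-1) ^ a * (2 / (1 + uu x ^ 2) * ((1 - uu x ^ 2) / 2) * cc a x)))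
              by (rewrite atan_sign_sqr; ring).
            field. generalize (pow2_ge_0 (uu x)); lra. }
        eapply Rle_trans; [apply Rabs_triang|]. rewrite !Rabs_Ropp.
        apply Rplus_le_compat; [now apply HR|].
        rewrite !Rabs_mult, Hsg, Rmult_1_l, (Rabs_right ((1 - uu x ^ 2) / 2)), (Rabs_right (ee k x)) by lra.
        rewrite (Rmult_assoc (uu x ^ _)), <- (Rmult_assoc (BN_bound a N)).
        apply Rmult_le_compat_r; [now apply Rmult_le_pos|]. now apply BN_err. }
    assert (E0 : F 0 = isum 1 N (fun n => 2 ^ S a * (-1) ^ n * hcoef a k n)).
    { unfold F, GJ. rewrite Ptrunc_at_0, lsum_zero; [ring|]. intros; rewrite moment_0; ring. }
    assert (L : is_lim_seq (fun m => Rabs (F (INR m) - F 0))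
      (Rabs (0 - sg * isum 1 N (fun n => 2 * (-1) ^ n * Defs.Tn n a * limit_moment (Nat.even a) k n) - F 0))).
    { apply (is_lim_seq_abs (fun m => F (INR m) - F 0)
        (0 - sg * isum 1 N (fun n => 2 * (-1) ^ n * Defs.Tn n a * limit_moment (Nat.even a) k n) - F 0)).
      apply is_lim_seq_minus'; [|apply is_lim_seq_const].
      apply is_lim_seq_minus'; [apply expdecay_lim, expdecay_Ptrunc|].
      apply (is_lim_seq_mult' (fun _ => sg) _ sg); [apply is_lim_seq_const|].
      rewrite isum1E. unfold GJ.
      apply (is_lim_seq_lsum (fun n m => 2 * (-1) ^ n * Defs.Tn n a * moment (mexp (Nat.even a) n) k (INR m))).
      intros n Hn; apply in_seq in Hn.
      apply (is_lim_seq_mult' (fun _ => 2 * (-1) ^ n * Defs.Tn n a) _ (2 * (-1) ^ n * Defs.Tn n a));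
        [apply is_lim_seq_const|]. apply moment_lim; lia. }
    rewrite <- E0.
    replace (Rabs (F 0 + sg * _)) with
      (Rabs (0 - sg * isum 1 N (fun n => 2 * (-1) ^ n * Defs.Tn n a * limit_moment (Nat.even a) k n) - F 0)).
    2:{ rewrite <- Rabs_Ropp. f_equal. ring. }
    match goal with |- ?x <= ?y => change (Rbar_le x y) end.
    apply (is_lim_seq_le (fun m => Rabs (F (INR m) - F 0))
      (fun m => h / INR (S N) + BN_bound a N * moment (2 * N) k (INR m)) _
      (h / INR (S N) + BN_bound a N * limit_moment true k (S N))).
    + intros m. apply D, pos_INR.
    + exact L.
    + apply is_lim_seq_plus'; [apply is_lim_seq_const|].
      apply (is_lim_seq_mult' (fun _ => BN_bound a N) _ (BN_bound a N)); [apply is_lim_seq_const|].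
      (* The error exponent is even for either parity of [a], hence [true] at index [S N]. *)
      replace (2 * N)%nat with (mexp true (S N)) by (unfold mexp; lia). apply moment_lim; lia.
Qed.

(** Convergence is inherited: the series for [W] converges and the partial sums of the two series
    differ by a null sequence. *)
Lemma W_limit_moment (a k : nat) :
  is_series (fun n => - ((-1) ^ a * atan_sign a) *
    (2 * (-1) ^ S n * Defs.Tn (S n) a * limit_moment (Nat.even a) k (S n))) (W (k + S a) (S a)).
Proof.
  destruct (partial_sums_close a k) as (b & Hb & H).
  assert (HW := is_series_W a k).
  set (sg := (-1) ^ a * atan_sign a) in *.
  change (is_lim_seq (sum_n (fun n => - sg *
    (2 * (-1) ^ S n * Defs.Tn (S n) a * limit_moment (Nat.even a) k (S n)))) (W (k + S a) (S a))).
  set (w := sum_n (fun n => 2 ^ S a * (-1) ^ S n * hcoef a k (S n))).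
  set (v := sum_n (fun n => - sg * (2 * (-1) ^ S n * Defs.Tn (S n) a * limit_moment (Nat.even a) k (S n)))).
  assert (D : is_lim_seq (fun n => w n - v n) 0).
  { apply is_lim_seq_abs_0.
    apply (is_lim_seq_le_le_loc (fun _ => 0) _ (fun n => b (S n))).
    - exists (S a); intros n Hn. split; [apply Rabs_pos|].
      specialize (H (S n) ltac:(lia)). eapply Rle_trans; [|exact H]. right; f_equal.
      unfold w, v. rewrite (sum_n_isum1 (fun n => 2 ^ S a * (-1) ^ n * hcoef a k n)).
      rewrite (sum_n_isum1 (fun n => - sg * (2 * (-1) ^ n * Defs.Tn n a * limit_moment (Nat.even a) k n))).
      rewrite (isum1E (S n) (fun n => - sg * _)), lsum_scal, <- isum1E. ring.
    - apply is_lim_seq_const.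
    - now apply (is_lim_seq_incr_1 b). }
  apply (is_lim_seq_ext (fun n => w n - (w n - v n))); [intros; ring|].
  replace (Finite (W (k + S a) (S a))) with (Finite (W (k + S a) (S a) - 0)) by (f_equal; ring).
  apply is_lim_seq_minus'; [exact HW|exact D].
Qed.

(** * Evaluation of the moments *)

(** Adding two outer summations at once preserves the parity of the depth, so T, S and the moments
    all obey recursions with the same operators. *)
Definition sumOE (f : nat -> R) (n : nat) : R :=
  isum 1 n (fun i => 2 / (2 * INR i - 1) * isum 1 (i - 1) (fun j => 2 / (2 * INR j) * f j)).

Definition sumEO (f : nat -> R) (n : nat) : R :=
  isum 1 (n - 1) (fun i => 2 / (2 * INR i) * isum 1 i (fun j => 2 / (2 * INR j - 1) * f j)).

Lemma isum1_ext (n : nat) (f g : nat -> R) :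
  (forall i, (1 <= i)%nat -> f i = g i) -> isum 1 n f = isum 1 n g.
Proof. intros H; rewrite !isum1E; apply lsum_ext; intros i Hi; apply in_seq in Hi; apply H; lia. Qed.

Lemma isum1_plus (n : nat) (f g : nat -> R) :
  isum 1 n (fun i => f i + g i) = isum 1 n f + isum 1 n g.
Proof. rewrite !isum1E; apply lsum_plus. Qed.

Lemma isum1_scal (n : nat) (c : R) (f : nat -> R) :
  isum 1 n (fun i => c * f i) = c * isum 1 n f.
Proof. rewrite !isum1E; apply lsum_scal. Qed.

Lemma weighted_plus (n : nat) (w f g : nat -> R) :
  isum 1 n (fun i => w i * (f i + g i)) = isum 1 n (fun i => w i * f i) + isum 1 n (fun i => w i * g i).
Proof. rewrite <- isum1_plus; apply isum1_ext; intros; ring. Qed.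

Lemma weighted_scal (n : nat) (c : R) (w f : nat -> R) :
  isum 1 n (fun i => w i * (c * f i)) = c * isum 1 n (fun i => w i * f i).
Proof. rewrite <- isum1_scal; apply isum1_ext; intros; ring. Qed.

Lemma weighted_ext (n : nat) (w f g : nat -> R) :
  (forall i, (1 <= i)%nat -> f i = g i) -> isum 1 n (fun i => w i * f i) = isum 1 n (fun i => w i * g i).
Proof. intros H; apply isum1_ext; intros i Hi; now rewrite H. Qed.

Lemma sumOE_ext (f g : nat -> R) (n : nat) :
  (forall i, (1 <= i)%nat -> f i = g i) -> sumOE f n = sumOE g n.
Proof. intros H; apply (weighted_ext n (fun i => 2 / (2 * INR i - 1))); intros; now apply weighted_ext. Qed.

Lemma sumEO_ext (f g : nat -> R) (n : nat) :
  (forall i, (1 <= i)%nat -> f i = g i) -> sumEO f n = sumEO g n.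
Proof. intros H; apply (weighted_ext (n - 1) (fun i => 2 / (2 * INR i))); intros; now apply weighted_ext. Qed.

Lemma sumOE_plus (f g : nat -> R) (n : nat) : sumOE (fun i => f i + g i) n = sumOE f n + sumOE g n.
Proof.
  unfold sumOE. rewrite <- weighted_plus. apply isum1_ext; intros i _. now rewrite weighted_plus.
Qed.

Lemma sumEO_plus (f g : nat -> R) (n : nat) : sumEO (fun i => f i + g i) n = sumEO f n + sumEO g n.
Proof.
  unfold sumEO. rewrite <- weighted_plus. apply isum1_ext; intros i _. now rewrite weighted_plus.
Qed.

Lemma sumOE_scal (c : R) (f : nat -> R) (n : nat) : sumOE (fun i => c * f i) n = c * sumOE f n.
Proof.
  unfold sumOE. rewrite <- weighted_scal. apply isum1_ext; intros i _. now rewrite weighted_scal.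
Qed.

Lemma sumEO_scal (c : R) (f : nat -> R) (n : nat) : sumEO (fun i => c * f i) n = c * sumEO f n.
Proof.
  unfold sumEO. rewrite <- weighted_scal. apply isum1_ext; intros i _. now rewrite weighted_scal.
Qed.

Lemma sumOE_lsum (c : nat -> R) (f : nat -> nat -> R) (l : list nat) (n : nat) :
  sumOE (fun i => lsum (fun j => c j * f j i) l) n = lsum (fun j => c j * sumOE (f j) n) l.
Proof.
  induction l as [|a l IH].
  - transitivity (0 * sumOE (fun _ => 0) n); [|rewrite lsum_nil; ring].
    rewrite <- sumOE_scal. apply sumOE_ext; intros; rewrite lsum_nil; ring.
  - rewrite lsum_cons, <- IH, <- sumOE_scal, <- sumOE_plus. now apply sumOE_ext.
Qed.

Lemma sumEO_lsum (c : nat -> R) (f : nat -> nat -> R) (l : list nat) (n : nat) :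
  sumEO (fun i => lsum (fun j => c j * f j i) l) n = lsum (fun j => c j * sumEO (f j) n) l.
Proof.
  induction l as [|a l IH].
  - transitivity (0 * sumEO (fun _ => 0) n); [|rewrite lsum_nil; ring].
    rewrite <- sumEO_scal. apply sumEO_ext; intros; rewrite lsum_nil; ring.
  - rewrite lsum_cons, <- IH, <- sumEO_scal, <- sumEO_plus. now apply sumEO_ext.
Qed.

Lemma Tn_SS_odd (n a : nat) : Nat.even a = false ->
  Defs.Tn n (S (S a)) = sumOE (fun i => Defs.Tn i a) n.
Proof.
  intros E. rewrite Tn_even by now rewrite even_S, E.
  apply weighted_ext; intros i _. now rewrite Tn_odd.
Qed.

Lemma Tn_SS_even (n a : nat) : Nat.even a = true ->
  Defs.Tn n (S (S a)) = sumEO (fun i => Defs.Tn i a) n.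
Proof.
  intros E. rewrite Tn_odd by now rewrite even_S, E.
  apply weighted_ext; intros i _. now rewrite Tn_even.
Qed.

Lemma Sn_SS_even (n a : nat) : Nat.even a = true ->
  Defs.Sn n (S (S a)) = sumOE (fun i => Defs.Sn i a) n.
Proof.
  intros E. rewrite Sn_odd by now rewrite even_S, E.
  apply weighted_ext; intros i _. now rewrite Sn_even.
Qed.

Lemma Sn_SS_odd (n a : nat) : Nat.even a = false ->
  Defs.Sn n (S (S a)) = sumEO (fun i => Defs.Sn i a) n.
Proof.
  intros E. rewrite Sn_even by now rewrite even_S, E.
  apply weighted_ext; intros i _. now rewrite Sn_odd.
Qed.

(** This normalisation removes the factor 1/n or 1/(2n - 1) that stays outside in the final series;
    what remains is summed with the weights of T and S. *)
Definition nmoment_even (k n : nat) : R := INR n * limit_moment false k n.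
Definition nmoment_odd (k n : nat) : R := (2 * INR n - 1) * limit_moment true k n.

Lemma Tn_1 (n : nat) : Defs.Tn n 1 = isum 1 n (fun i => 2 / (2 * INR i - 1)).
Proof. rewrite Tn_even by reflexivity. apply isum1_ext; intros; simpl; ring. Qed.

Lemma Sn_1 (n : nat) : Defs.Sn n 1 = isum 1 (n - 1) (fun i => 2 / (2 * INR i)).
Proof. rewrite Sn_even by reflexivity. apply isum1_ext; intros; simpl; ring. Qed.

Lemma limit_moment_true_0 (n : nat) : (1 <= n)%nat -> limit_moment true 0 n = / (2 * INR n - 1).
Proof.
  intros Hn. change (limit_moment true 0 n) with (/ INR (S (2 * n - 2))).
  replace (2 * n - 2)%nat with (2 * (n - 1))%nat by lia. rewrite INR_2S.
  now replace (S (n - 1)) with n by lia.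
Qed.

Lemma limit_moment_false_0 (n : nat) : (1 <= n)%nat -> limit_moment false 0 n = / (2 * INR n).
Proof.
  intros Hn. change (limit_moment false 0 n) with (/ INR (S (2 * n - 1))).
  replace (2 * n - 1)%nat with (S (2 * (n - 1))) by lia. rewrite INR_2SS.
  now replace (S (n - 1)) with n by lia.
Qed.

Lemma nmoment_even_0 (n : nat) : (1 <= n)%nat -> nmoment_even 0 n = / 2.
Proof.
  intros Hn. assert (P : 1 <= INR n) by (apply (le_INR 1); lia).
  unfold nmoment_even. rewrite limit_moment_false_0 by auto. field; lra.
Qed.

Lemma nmoment_even_S (k n : nat) : (1 <= n)%nat ->
  nmoment_even (S k) n = isum 1 n (fun i => 2 / (2 * INR i - 1) * (/ 2 * nmoment_odd k i)).
Proof.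
  intros Hn. assert (P : 1 <= INR n) by (apply (le_INR 1); lia).
  unfold nmoment_even. change (limit_moment false (S k) n) with (/ INR n * isum 1 n (limit_moment true k)).
  rewrite <- Rmult_assoc, Rinv_r, Rmult_1_l by lra.
  apply isum1_ext; intros i Hi. unfold nmoment_odd.
  assert (Q : 1 <= INR i) by (apply (le_INR 1); lia). field; lra.
Qed.

Lemma nmoment_odd_0 (n : nat) : (1 <= n)%nat -> nmoment_odd 0 n = 1.
Proof.
  intros Hn. assert (P : 1 <= INR n) by (apply (le_INR 1); lia).
  unfold nmoment_odd. rewrite limit_moment_true_0 by auto. field; lra.
Qed.

Lemma nmoment_odd_S (k n : nat) : (1 <= n)%nat ->
  nmoment_odd (S k) n = 2 * zbar (S k) + 2 * isum 1 (n - 1) (fun i => 2 / (2 * INR i) * nmoment_even k i).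
Proof.
  intros Hn. assert (P : 1 <= INR n) by (apply (le_INR 1); lia).
  unfold nmoment_odd. change (limit_moment true (S k) n) with
    (2 / (2 * INR n - 1) * (zbar (S k) + isum 1 (n - 1) (limit_moment false k))).
  replace (isum 1 (n - 1) (fun i => 2 / (2 * INR i) * nmoment_even k i))
    with (isum 1 (n - 1) (limit_moment false k)); [field; lra|].
  apply isum1_ext; intros i Hi. unfold nmoment_even.
  assert (Q : 1 <= INR i) by (apply (le_INR 1); lia). field; lra.
Qed.

Lemma nmoment_even_SS (k n : nat) : (1 <= n)%nat ->
  nmoment_even (S (S k)) n = zbar (S k) * Defs.Tn n 1 + sumOE (nmoment_even k) n.
Proof.
  intros Hn. rewrite nmoment_even_S by auto. rewrite Tn_1, <- isum1_scal. unfold sumOE.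
  rewrite <- isum1_plus. apply isum1_ext; intros i Hi. rewrite nmoment_odd_S by auto. field.
  assert (Q : 1 <= INR i) by (apply (le_INR 1); lia). lra.
Qed.

Lemma nmoment_odd_SS (k n : nat) : (1 <= n)%nat ->
  nmoment_odd (S (S k)) n = 2 * zbar (S (S k)) + sumEO (nmoment_odd k) n.
Proof.
  intros Hn. rewrite nmoment_odd_S by auto. f_equal. rewrite <- isum1_scal. unfold sumEO.
  apply isum1_ext; intros i Hi. rewrite nmoment_even_S, weighted_scal by auto. field.
  assert (Q : 1 <= INR i) by (apply (le_INR 1); lia). lra.
Qed.

Lemma even_2j1 (j : nat) : Nat.even (2 * j + 1) = false.
Proof. rewrite Nat.add_1_r, Nat.even_succ, <- Nat.negb_even, Nat.even_mul. reflexivity. Qed.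

Lemma even_2j (j : nat) : Nat.even (2 * j) = true.
Proof. now rewrite Nat.even_mul. Qed.

(** The recursion starts from half of T_n({1}_1); the convention that the zeta value at 0 is 1/2
    makes this the last term of the sum. *)
Lemma nmoment_even_odd (p : nat) : forall n, (1 <= n)%nat ->
  nmoment_even (2 * p + 1) n = fsum (S p) (fun j => zbar (2 * p - 2 * j) * Defs.Tn n (2 * j + 1)).
Proof.
  induction p as [|p IH]; intros n Hn.
  - rewrite fsumE. simpl seq. rewrite lsum_cons, lsum_nil.
    change (nmoment_even (2 * 0 + 1) n) with (nmoment_even 1 n). rewrite nmoment_even_S by auto.
    change (zbar (2 * 0 - 2 * 0)) with (/ 2). change (2 * 0 + 1)%nat with 1%nat.
    rewrite Tn_1, Rplus_0_r, <- isum1_scal. apply isum1_ext; intros i Hi.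
    rewrite nmoment_odd_0 by auto. ring.
  - replace (2 * S p + 1)%nat with (S (S (2 * p + 1))) by lia. rewrite nmoment_even_SS by auto.
    rewrite (sumOE_ext _ _ n IH), fsumE, lsum_seq_Sl. f_equal.
    + now replace (2 * S p - 2 * 0)%nat with (S (2 * p + 1)) by lia.
    + transitivity (sumOE (fun i => lsum (fun j => zbar (2 * p - 2 * j) * Defs.Tn i (2 * j + 1)) (seq 0 (S p))) n);
        [reflexivity|].
      rewrite (sumOE_lsum (fun j => zbar (2 * p - 2 * j)) (fun j i => Defs.Tn i (2 * j + 1))).
      apply lsum_ext; intros j _.
      replace (2 * S p - 2 * S j)%nat with (2 * p - 2 * j)%nat by lia.
      replace (2 * S j + 1)%nat with (S (S (2 * j + 1))) by lia.
      now rewrite Tn_SS_odd by apply even_2j1.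
Qed.

(** Here the start is the constant 1/2, half of the empty S-sum, and each application of [sumOE]
    deepens that S-sum by two. *)
Lemma nmoment_even_even (p : nat) : forall n, (1 <= n)%nat ->
  nmoment_even (2 * p) n = fsum p (fun j => zbar (2 * p - 1 - 2 * j) * Defs.Tn n (2 * j + 1))
    + / 2 * Defs.Sn n (2 * p).
Proof.
  induction p as [|p IH]; intros n Hn.
  - change (2 * 0)%nat with 0%nat. rewrite nmoment_even_0 by auto. rewrite fsumE. simpl seq.
    rewrite lsum_nil. simpl Defs.Sn. ring.
  - replace (2 * S p)%nat with (S (S (2 * p))) by lia. rewrite nmoment_even_SS by auto.
    rewrite (sumOE_ext _ _ n IH), sumOE_plus, sumOE_scal, fsumE, lsum_seq_Sl.
    rewrite Sn_SS_even by apply even_2j. rewrite <- Rplus_assoc. f_equal. f_equal.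
    transitivity (sumOE (fun i => lsum (fun j => zbar (2 * p - 1 - 2 * j) * Defs.Tn i (2 * j + 1)) (seq 0 p)) n);
      [reflexivity|].
    rewrite (sumOE_lsum (fun j => zbar (2 * p - 1 - 2 * j)) (fun j i => Defs.Tn i (2 * j + 1))).
    apply lsum_ext; intros j _.
    replace (S (S (2 * p)) - 1 - 2 * S j)%nat with (2 * p - 1 - 2 * j)%nat by lia.
    replace (2 * S j + 1)%nat with (S (S (2 * j + 1))) by lia.
    now rewrite Tn_SS_odd by apply even_2j1.
Qed.

(** The S-sum grows from the constant moment 1/2 at [nmoment_even 0], which enters the first step as
    S_n({1}_1). *)
Lemma nmoment_odd_odd (p : nat) : forall n, (1 <= n)%nat ->
  nmoment_odd (2 * p + 1) n = 2 * fsum (S p) (fun j => zbar (2 * p + 1 - 2 * j) * Defs.Tn n (2 * j))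
    + Defs.Sn n (2 * p + 1).
Proof.
  induction p as [|p IH]; intros n Hn.
  - rewrite fsumE. simpl seq. rewrite lsum_cons, lsum_nil.
    change (2 * 0 + 1)%nat with 1%nat. rewrite nmoment_odd_S by auto.
    change (1 - 2 * 0)%nat with 1%nat. change (Defs.Tn n (2 * 0)) with 1.
    rewrite Sn_1, <- isum1_scal. rewrite Rplus_0_r, Rmult_1_r. f_equal.
    apply isum1_ext; intros i Hi. rewrite nmoment_even_0 by auto. field.
    assert (Q : 1 <= INR i) by (apply (le_INR 1); lia). lra.
  - replace (2 * S p + 1)%nat with (S (S (2 * p + 1))) by lia. rewrite nmoment_odd_SS by auto.
    rewrite (sumEO_ext _ _ n IH), sumEO_plus, sumEO_scal, fsumE, lsum_seq_Sl.
    rewrite Sn_SS_odd by apply even_2j1.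
    rewrite Rmult_plus_distr_l, <- Rplus_assoc. f_equal. f_equal.
    + replace (S (S (2 * p + 1)) - 2 * 0)%nat with (S (S (2 * p + 1))) by lia.
      change (Defs.Tn n (2 * 0)) with 1. ring.
    + f_equal.
      transitivity (sumEO (fun i => lsum (fun j => zbar (2 * p + 1 - 2 * j) * Defs.Tn i (2 * j)) (seq 0 (S p))) n);
        [reflexivity|].
      rewrite (sumEO_lsum (fun j => zbar (2 * p + 1 - 2 * j)) (fun j i => Defs.Tn i (2 * j))).
      apply lsum_ext; intros j _.
      replace (S (S (2 * p + 1)) - 2 * S j)%nat with (2 * p + 1 - 2 * j)%nat by lia.
      replace (2 * S j)%nat with (S (S (2 * j))) by lia.
      now rewrite Tn_SS_even by apply even_2j.
Qed.

(** The start is 1, twice the zeta convention at 0 times the empty T-sum, so no S-sum appears. *)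
Lemma nmoment_odd_even (p : nat) : forall n, (1 <= n)%nat ->
  nmoment_odd (2 * p) n = 2 * fsum (S p) (fun j => zbar (2 * p - 2 * j) * Defs.Tn n (2 * j)).
Proof.
  induction p as [|p IH]; intros n Hn.
  - rewrite fsumE. simpl seq. rewrite lsum_cons, lsum_nil.
    change (2 * 0)%nat with 0%nat. rewrite nmoment_odd_0 by auto.
    change (zbar (0 - 0)) with (/ 2). change (Defs.Tn n 0) with 1. field.
  - replace (2 * S p)%nat with (S (S (2 * p))) by lia. rewrite nmoment_odd_SS by auto.
    rewrite (sumEO_ext _ _ n IH), sumEO_scal, fsumE, lsum_seq_Sl.
    rewrite Rmult_plus_distr_l. f_equal.
    + replace (S (S (2 * p)) - 2 * 0)%nat with (S (S (2 * p))) by lia.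
      change (Defs.Tn n (2 * 0)) with 1. ring.
    + f_equal.
      transitivity (sumEO (fun i => lsum (fun j => zbar (2 * p - 2 * j) * Defs.Tn i (2 * j)) (seq 0 (S p))) n);
        [reflexivity|].
      rewrite (sumEO_lsum (fun j => zbar (2 * p - 2 * j)) (fun j i => Defs.Tn i (2 * j))).
      apply lsum_ext; intros j _.
      replace (S (S (2 * p)) - 2 * S j)%nat with (2 * p - 2 * j)%nat by lia.
      replace (2 * S j)%nat with (S (S (2 * j))) by lia.
      now rewrite Tn_SS_even by apply even_2j.
Qed.

(** * Signs, termwise summation and the four parity cases *)

Lemma atan_sign_2q (q : nat) : atan_sign (2 * q) = - (-1) ^ q.
Proof.
  induction q as [|q IH]; [simpl; ring|].
  replace (2 * S q)%nat with (S (S (2 * q))) by lia.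
  change (atan_sign (S (S (2 * q)))) with
    (if Nat.even (S (2 * q)) then atan_sign (S (2 * q)) else - atan_sign (S (2 * q))).
  change (atan_sign (S (2 * q))) with (if Nat.even (2 * q) then atan_sign (2 * q) else - atan_sign (2 * q)).
  rewrite even_S, even_2j, IH. simpl; ring.
Qed.

Lemma sign_even (q : nat) : - ((-1) ^ (2 * q) * atan_sign (2 * q)) = (-1) ^ q.
Proof. rewrite atan_sign_2q, pow_1_even. ring. Qed.

Lemma sign_odd (q : nat) : - ((-1) ^ (2 * q + 1) * atan_sign (2 * q + 1)) = (-1) ^ S q.
Proof.
  rewrite Nat.add_1_r.
  change (atan_sign (S (2 * q))) with (if Nat.even (2 * q) then atan_sign (2 * q) else - atan_sign (2 * q)).
  rewrite even_2j, atan_sign_2q, pow_1_odd. simpl; ring.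
Qed.

Lemma ex_series_TT_even (a b : nat) : ex_series (fun n => TT_even a b (S n)).
Proof. apply (ex_series_even (fun n => Defs.Tn n a) (fun n => Defs.Tn n b)); apply Slow_Tn. Qed.

Lemma ex_series_TS_even (a b : nat) : ex_series (fun n => TS_even a b (S n)).
Proof.
  apply (ex_series_even (fun n => Defs.Tn n a) (fun n => Defs.Sn n b)); [apply Slow_Tn|apply Slow_Sn].
Qed.

Lemma ex_series_TT_odd (a b : nat) : ex_series (fun n => TT_odd a b (S n)).
Proof. apply (ex_series_odd (fun n => Defs.Tn n a) (fun n => Defs.Tn n b)); apply Slow_Tn. Qed.

Lemma ex_series_TS_odd (a b : nat) : ex_series (fun n => TS_odd a b (S n)).
Proof.
  apply (ex_series_odd (fun n => Defs.Tn n a) (fun n => Defs.Sn n b)); [apply Slow_Tn|apply Slow_Sn].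
Qed.

Lemma is_series_fsum (c : R) (p : nat) (z : nat -> R) (u : nat -> nat -> R) :
  (forall j, ex_series (u j)) ->
  is_series (fun n => c * fsum p (fun j => z j * u j n))
    (c * fsum p (fun j => z j * Series (u j))).
Proof.
  intros Hu. apply (is_series_scal_l (K := R_AbsRing) c (fun n => fsum p (fun j => z j * u j n))).
  rewrite fsumE.
  replace (lsum (fun j => z j * Series (u j)) (seq 0 p))
    with (lsum (fun j => Series (fun n => z j * u j n)) (seq 0 p))
    by (apply lsum_ext; intros; apply Series_scal_l).
  apply (is_series_lsum (fun j n => z j * u j n)). intros j _.
  apply (ex_series_scal_l (K := R_AbsRing) (z j) (u j)), Hu.
Qed.

Lemma is_series_fsum_plus (c c' : R) (p : nat) (z : nat -> R) (u : nat -> nat -> R) (v : nat -> R) :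
  (forall j, ex_series (u j)) -> ex_series v ->
  is_series (fun n => c * fsum p (fun j => z j * u j n) + c' * v n)
    (c * fsum p (fun j => z j * Series (u j)) + c' * Series v).
Proof.
  intros Hu Hv.
  apply (is_series_plus (V := R_NormedModule) (fun n => c * fsum p (fun j => z j * u j n)) (fun n => c' * v n)).
  - now apply is_series_fsum.
  - apply (is_series_scal_l (K := R_AbsRing) c' v), Series_correct, Hv.
Qed.

Lemma W_series (a k : nat) (f : nat -> R) (l : R) :
  (forall n, (1 <= n)%nat -> - ((-1) ^ a * atan_sign a) *
     (2 * (-1) ^ n * Defs.Tn n a * limit_moment (Nat.even a) k n) = f n) ->
  is_series (fun n => f (S n)) l -> W (k + S a) (S a) = l.
Proof.
  intros E Hl. rewrite <- (is_series_unique _ _ Hl). symmetry. apply is_series_unique.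
  eapply is_series_ext; [|apply W_limit_moment]. intros n; cbv beta. apply E; lia.
Qed.

Lemma W_even_odd (q p : nat) :
  W (2 * p + 1 + S (2 * q + 1)) (S (2 * q + 1)) =
  2 * (-1) ^ S q * fsum (S p) (fun j => zbar (2 * p - 2 * j) *
     Series (fun n => TT_even (2 * q + 1) (2 * j + 1) (S n))).
Proof.
  apply (W_series _ _ (fun n => 2 * (-1) ^ S q * fsum (S p) (fun j => zbar (2 * p - 2 * j) *
     TT_even (2 * q + 1) (2 * j + 1) n))).
  - intros n Hn. rewrite sign_odd, even_2j1.
    assert (P : 1 <= INR n) by (apply (le_INR 1); lia).
    replace (limit_moment false (2 * p + 1) n) with (/ INR n * nmoment_even (2 * p + 1) n) by (unfold nmoment_even; field; lra).
    rewrite nmoment_even_odd, !fsumE by auto.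
    replace (lsum (fun j => zbar (2 * p - 2 * j) * TT_even (2 * q + 1) (2 * j + 1) n) (seq 0 (S p)))
      with ((Defs.Tn n (2 * q + 1) / INR n * (-1) ^ n) *
            lsum (fun j => zbar (2 * p - 2 * j) * Defs.Tn n (2 * j + 1)) (seq 0 (S p))).
    + field; lra.
    + rewrite <- lsum_scal. apply lsum_ext; intros j _. unfold TT_even. field; lra.
  - apply (is_series_fsum (2 * (-1) ^ S q) (S p) (fun j => zbar (2 * p - 2 * j))
      (fun j n => TT_even (2 * q + 1) (2 * j + 1) (S n)));
      intros; apply ex_series_TT_even.
Qed.

Lemma W_even_even (q p : nat) :
  W (2 * p + S (2 * q + 1)) (S (2 * q + 1)) =
  2 * (-1) ^ S q * fsum p (fun j => zbar (2 * p - 1 - 2 * j) *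
     Series (fun n => TT_even (2 * q + 1) (2 * j + 1) (S n)))
  + (-1) ^ S q * Series (fun n => TS_even (2 * q + 1) (2 * p) (S n)).
Proof.
  apply (W_series _ _ (fun n => 2 * (-1) ^ S q * fsum p (fun j => zbar (2 * p - 1 - 2 * j) *
     TT_even (2 * q + 1) (2 * j + 1) n) + (-1) ^ S q * TS_even (2 * q + 1) (2 * p) n)).
  - intros n Hn. rewrite sign_odd, even_2j1.
    assert (P : 1 <= INR n) by (apply (le_INR 1); lia).
    replace (limit_moment false (2 * p) n) with (/ INR n * nmoment_even (2 * p) n) by (unfold nmoment_even; field; lra).
    rewrite nmoment_even_even, !fsumE by auto.
    replace (lsum (fun j => zbar (2 * p - 1 - 2 * j) * TT_even (2 * q + 1) (2 * j + 1) n) (seq 0 p))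
      with ((Defs.Tn n (2 * q + 1) / INR n * (-1) ^ n) *
            lsum (fun j => zbar (2 * p - 1 - 2 * j) * Defs.Tn n (2 * j + 1)) (seq 0 p)).
    + unfold TS_even. field; lra.
    + rewrite <- lsum_scal. apply lsum_ext; intros j _. unfold TT_even. field; lra.
  - apply (is_series_fsum_plus (2 * (-1) ^ S q) ((-1) ^ S q) p (fun j => zbar (2 * p - 1 - 2 * j))
      (fun j n => TT_even (2 * q + 1) (2 * j + 1) (S n)) (fun n => TS_even (2 * q + 1) (2 * p) (S n)));
      intros; [apply ex_series_TT_even|apply ex_series_TS_even].
Qed.

Lemma W_odd_odd (q p : nat) :
  W (2 * p + 1 + S (2 * q)) (S (2 * q)) =
  4 * (-1) ^ q * fsum (S p) (fun j => zbar (2 * p + 1 - 2 * j) *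
     Series (fun n => TT_odd (2 * q) (2 * j) (S n)))
  + 2 * (-1) ^ q * Series (fun n => TS_odd (2 * q) (2 * p + 1) (S n)).
Proof.
  apply (W_series _ _ (fun n => 4 * (-1) ^ q * fsum (S p) (fun j => zbar (2 * p + 1 - 2 * j) *
     TT_odd (2 * q) (2 * j) n) + 2 * (-1) ^ q * TS_odd (2 * q) (2 * p + 1) n)).
  - intros n Hn. rewrite sign_even, even_2j.
    assert (P : 1 <= INR n) by (apply (le_INR 1); lia).
    replace (limit_moment true (2 * p + 1) n) with (/ (2 * INR n - 1) * nmoment_odd (2 * p + 1) n)
      by (unfold nmoment_odd; field; lra).
    rewrite nmoment_odd_odd, !fsumE by auto.
    replace (lsum (fun j => zbar (2 * p + 1 - 2 * j) * TT_odd (2 * q) (2 * j) n) (seq 0 (S p)))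
      with ((Defs.Tn n (2 * q) / (2 * INR n - 1) * (-1) ^ n) *
            lsum (fun j => zbar (2 * p + 1 - 2 * j) * Defs.Tn n (2 * j)) (seq 0 (S p))).
    + unfold TS_odd. field; lra.
    + rewrite <- lsum_scal. apply lsum_ext; intros j _. unfold TT_odd. field; lra.
  - apply (is_series_fsum_plus (4 * (-1) ^ q) (2 * (-1) ^ q) (S p) (fun j => zbar (2 * p + 1 - 2 * j))
      (fun j n => TT_odd (2 * q) (2 * j) (S n)) (fun n => TS_odd (2 * q) (2 * p + 1) (S n)));
      intros; [apply ex_series_TT_odd|apply ex_series_TS_odd].
Qed.

Lemma W_odd_even (q p : nat) :
  W (2 * p + S (2 * q)) (S (2 * q)) =
  4 * (-1) ^ q * fsum (S p) (fun j => zbar (2 * p - 2 * j) *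
     Series (fun n => TT_odd (2 * q) (2 * j) (S n))).
Proof.
  apply (W_series _ _ (fun n => 4 * (-1) ^ q * fsum (S p) (fun j => zbar (2 * p - 2 * j) *
     TT_odd (2 * q) (2 * j) n))).
  - intros n Hn. rewrite sign_even, even_2j.
    assert (P : 1 <= INR n) by (apply (le_INR 1); lia).
    replace (limit_moment true (2 * p) n) with (/ (2 * INR n - 1) * nmoment_odd (2 * p) n)
      by (unfold nmoment_odd; field; lra).
    rewrite nmoment_odd_even, !fsumE by auto.
    replace (lsum (fun j => zbar (2 * p - 2 * j) * TT_odd (2 * q) (2 * j) n) (seq 0 (S p)))
      with ((Defs.Tn n (2 * q) / (2 * INR n - 1) * (-1) ^ n) *
            lsum (fun j => zbar (2 * p - 2 * j) * Defs.Tn n (2 * j)) (seq 0 (S p))).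
    + field; lra.
    + rewrite <- lsum_scal. apply lsum_ext; intros j _. unfold TT_odd. field; lra.
  - apply (is_series_fsum (4 * (-1) ^ q) (S p) (fun j => zbar (2 * p - 2 * j))
      (fun j n => TT_odd (2 * q) (2 * j) (S n)));
      intros; apply ex_series_TT_odd.
Qed.

Lemma fsum_ext (n : nat) (f g : nat -> R) :
  (forall j, (j < n)%nat -> f j = g j) -> fsum n f = fsum n g.
Proof. intros H; apply lsum_ext; intros j Hj; apply in_seq in Hj; apply H; lia. Qed.

Theorem mainTheorem4 (m p : nat) (hm : (1 <= m)%nat) (hp : (1 <= p)%nat) :
  (* (1) *)
  (W_conv (2*p + 2*m - 1) (2*m) /\
   (forall j, (j <= p - 1)%nat ->
      ex_series (fun n => TT_even (2*m - 1) (2*j + 1) (S n))) /\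
   W (2*p + 2*m - 1) (2*m) =
     2 * (-1) ^ m * fsum p (fun j =>
        zbar (2*p - 2 - 2*j) * Series (fun n => TT_even (2*m - 1) (2*j + 1) (S n))))
  /\
  (* (2) *)
  (W_conv (2*p + 2*m - 2) (2*m) /\
   (forall j, (j + 2 <= p)%nat ->
      ex_series (fun n => TT_even (2*m - 1) (2*j + 1) (S n))) /\
   ex_series (fun n => TS_even (2*m - 1) (2*p - 2) (S n)) /\
   W (2*p + 2*m - 2) (2*m) =
     2 * (-1) ^ m * fsum (p - 1) (fun j =>
        zbar (2*p - 3 - 2*j) * Series (fun n => TT_even (2*m - 1) (2*j + 1) (S n)))
     + (-1) ^ m * Series (fun n => TS_even (2*m - 1) (2*p - 2) (S n)))
  /\
  (* (3) *)
  (W_conv (2*p + 2*m - 2) (2*m - 1) /\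
   (forall j, (j <= p - 1)%nat ->
      ex_series (fun n => TT_odd (2*m - 2) (2*j) (S n))) /\
   ex_series (fun n => TS_odd (2*m - 2) (2*p - 1) (S n)) /\
   W (2*p + 2*m - 2) (2*m - 1) =
     4 * (-1) ^ (m - 1) * fsum p (fun j =>
        zbar (2*p - 1 - 2*j) * Series (fun n => TT_odd (2*m - 2) (2*j) (S n)))
     + 2 * (-1) ^ (m - 1) * Series (fun n => TS_odd (2*m - 2) (2*p - 1) (S n)))
  /\
  (* (4) *)
  (W_conv (2*p + 2*m - 3) (2*m - 1) /\
   (forall j, (j <= p - 1)%nat ->
      ex_series (fun n => TT_odd (2*m - 2) (2*j) (S n))) /\
   W (2*p + 2*m - 3) (2*m - 1) =
     4 * (-1) ^ (m - 1) * fsum p (fun j =>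
        zbar (2*p - 2 - 2*j) * Series (fun n => TT_odd (2*m - 2) (2*j) (S n)))).
Proof.
  (* With successors for [m] and [p], the depth is [2 * q + 2] or [2 * q + 1] and its complement in
     the weight [2 * p] or [2 * p + 1]; the four combinations of parities are the four formulas. *)
  destruct m as [|q]; [lia|]. destruct p as [|p]; [lia|].
  replace (2 * S q - 1)%nat with (2 * q + 1)%nat by lia.
  replace (2 * S q - 2)%nat with (2 * q)%nat by lia.
  replace (2 * S p - 2)%nat with (2 * p)%nat by lia.
  replace (2 * S p - 1)%nat with (2 * p + 1)%nat by lia.
  replace (S p - 1)%nat with p by lia. replace (S q - 1)%nat with q by lia.
  repeat split; intros; try (apply W_conv_true; lia);
    try apply ex_series_TT_even; try apply ex_series_TS_even;
    try apply ex_series_TT_odd; try apply ex_series_TS_odd.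
  - replace (2 * S p + 2 * S q - 1)%nat with (2 * p + 1 + S (2 * q + 1))%nat by lia.
    replace (2 * S q)%nat with (S (2 * q + 1)) by lia. apply W_even_odd.
  - replace (2 * S p + 2 * S q - 2)%nat with (2 * p + S (2 * q + 1))%nat by lia.
    replace (2 * S q)%nat with (S (2 * q + 1)) by lia. rewrite W_even_even.
    do 2 f_equal. apply fsum_ext; intros j Hj.
    now replace (2 * S p - 3 - 2 * j)%nat with (2 * p - 1 - 2 * j)%nat by lia.
  - replace (2 * S p + 2 * S q - 2)%nat with (2 * p + 1 + S (2 * q))%nat by lia.
    replace (2 * q + 1)%nat with (S (2 * q)) by lia. apply W_odd_odd.
  - replace (2 * S p + 2 * S q - 3)%nat with (2 * p + S (2 * q))%nat by lia.
    replace (2 * q + 1)%nat with (S (2 * q)) by lia. apply W_odd_even.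
Qed.
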